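(* Let $A\in\mathbb{C}^{n\times n}$, let $v\in\mathbb{C}^n$ with $\|v\|=1$, and let $\tau>0$. Put $$a=\lambda_{\min}\left(\tfrac{A+A^*}{2}\right),\qquad b=\lambda_{\max}\left(\tfrac{A+A^*}{2}\right),\qquad c=\max_i\left|\lambda_i\left(\tfrac{A-A^*}{2}\right)\right|,$$ and assume $a<b$ and $c>0$. Let $w_k(\tau)=V_ke^{-\tau H_k}e_1$ be the Arnoldi approximation to $w(\tau)=e^{-\tau A}v$ obtained from $k$ iterations of the Arnoldi process for $A$ and $v$. Then for any $0<q<1$, $$\|w(\tau)-w_k(\tau)\|\le 2\,Q\,\tau\,\|A\|\,\frac{q^{k-1}}{1-q}\,e^{-\tau\min\{a,0\}-\tau\tilde z},$$ where $Q=11.08$, $$\tilde z=a-\frac1\lambda\int_0^{\frac12\left(\frac1q-q\right)}\frac{\sqrt{m+s^2}}{\sqrt{1+s^2}}\,ds,$$ $m\in(0,1)$ is determined from $a,b,c$ by $$\frac{E(m)-(1-m)K(m)}{\beta}=\frac{E(1-m)-mK(1-m)}{\alpha},\qquad \alpha=\frac{b-a}{2},\ \beta=c,$$ and $\lambda$ is the common value of the two sides of this equation.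
   Context: $\|\cdot\|$ is the Euclidean norm on vectors and the induced spectral norm on matrices; $\lambda_i(M)$ denote the eigenvalues of $M$. Arnoldi process: starting from $v_1=v$, $k$ iterations produce an orthonormal set $\{v_1,\dots,v_{k+1}\}$ via $h_{j+1,j}v_{j+1}=Av_j-\sum_{i=1}^j h_{i,j}v_i$ with $h_{j+1,j}\ge 0$, $h_{i,j}=v_i^*Av_j$ for $i\le j$ ($1\le j\le k$). $V_k=[v_1,\dots,v_k]$, and $H_k=[h_{ij}]_{1\le i,j\le k}$ is upper Hessenberg, with $AV_k=V_kH_k+h_{k+1,k}v_{k+1}e_k^T$. $e_1,e_k$ are coordinate vectors of $\mathbb{R}^k$. Complete elliptic integrals, for $0<m<1$: $K(m)=\int_0^{\pi/2}(1-m\sin^2\theta)^{-1/2}d\theta$, $E(m)=\int_0^{\pi/2}(1-m\sin^2\theta)^{1/2}d\theta$. For any $\alpha,\beta>0$ the displayed equation has a unique solution $m\in(0,1)$. *)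

(* Defs.v *)
From HB Require Import structures.
From mathcomp Require Import all_boot all_order all_algebra.
From mathcomp Require Import all_classical all_reals all_analysis.
From mathcomp Require Import complex.

Set Implicit Arguments.
Unset Strict Implicit.
Unset Printing Implicit Defensive.

Import Order.TTheory GRing.Theory Num.Theory.
Import numFieldNormedType.Exports.

Local Open Scope classical_set_scope.
Local Open Scope ring_scope.
Local Open Scope complex_scope.
Local Open Scope sesquilinear_scope.

Section LinearAlgebra.
Variable R : realType.
Implicit Types (m n : nat).

Definition cdot n (x y : 'cV[R[i]]_n) : R[i] := (x ^t* *m y) 0 0.

(* The norm `|z| of z : R[i] lies in R[i]; complex.Re `|z| is the modulus in R. *)
Definition enorm n (x : 'cV[R[i]]_n) : R :=
  Num.sqrt (\sum_(i < n) complex.Re `|x i 0| ^+ 2).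

Definition opnorm m n (M : 'M[R[i]]_(m, n)) : R :=
  sup [set enorm (M *m x) | x in [set x : 'cV[R[i]]_n | enorm x = 1]].

(* The eigenvalues of a Hermitian matrix are real, so for such M the infimum
   (supremum) below is the minimum (maximum) of the finite spectrum of M. *)
Definition lambda_min n (M : 'M[R[i]]_n) : R :=
  inf [set x : R | eigenvalue M x%:C].

Definition lambda_max n (M : 'M[R[i]]_n) : R :=
  sup [set x : R | eigenvalue M x%:C].

Definition spectral_radius n (M : 'M[R[i]]_n) : R :=
  sup [set complex.Re `|z| | z in [set z : R[i] | eigenvalue M z]].

(* R[i] has no canonical topology instance, so the exponential series is summed
   entrywise, real and imaginary parts separately. *)
Definition mexp_sum n (M : 'M[R[i]]_n) (N : nat) : 'M[R[i]]_n :=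
  \sum_(0 <= l < N) (l`!%:R^-1 : R[i]) *: M ^+ l.

Definition mexp n (M : 'M[R[i]]_n) : 'M[R[i]]_n :=
  \matrix_(i, j) (limn (fun N => complex.Re (mexp_sum M N i j))
               +i* limn (fun N => complex.Im (mexp_sum M N i j))).

End LinearAlgebra.

Section Arnoldi.
Variables (R : realType) (n : nat).

(* [vs] and [h] are indexed from 1; [vs 0], [h 0 _] and [h _ 0] are unused, as
   are all values outside the ranges 1..k+1 (for [vs]) and
   1..k+1, 1..k (for [h]). *)
Record arnoldi (A : 'M[R[i]]_n) (v : 'cV[R[i]]_n) (k : nat)
    (vs : nat -> 'cV[R[i]]_n) (h : nat -> nat -> R[i]) : Prop := Arnoldi {
  arnoldi_start : vs 1%N = v;
  arnoldi_orthonormal : forall i j : nat,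
    (1 <= i <= k.+1)%N -> (1 <= j <= k.+1)%N ->
    cdot (vs i) (vs j) = (i == j)%:R;
  arnoldi_coef : forall i j : nat, (1 <= i <= j)%N -> (j <= k)%N ->
    h i j = cdot (vs i) (A *m vs j);
  arnoldi_subdiag : forall j : nat, (1 <= j <= k)%N -> 0 <= h j.+1 j;
  arnoldi_step : forall j : nat, (1 <= j <= k)%N ->
    h j.+1 j *: vs j.+1 = A *m vs j - \sum_(1 <= i < j.+1) h i j *: vs i;
  arnoldi_hessenberg : forall i j : nat,
    (j.+1 < i)%N -> (i <= k)%N -> (1 <= j)%N -> h i j = 0
}.

Definition arnoldi_basis (k : nat) (vs : nat -> 'cV[R[i]]_n) :
  'M[R[i]]_(n, k) := \matrix_(i < n, j < k) vs j.+1 i 0.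

Definition arnoldi_hess (k : nat) (h : nat -> nat -> R[i]) : 'M[R[i]]_k :=
  \matrix_(i < k, j < k) h i.+1 j.+1.

Definition first_basis_vector (k : nat) : 'cV[R[i]]_k :=
  \col_(i < k) ((i : nat) == 0%N)%:R.

Definition expm_exact (A : 'M[R[i]]_n) (v : 'cV[R[i]]_n) (tau : R) :
  'cV[R[i]]_n := mexp ((- tau)%:C *: A) *m v.

Definition expm_arnoldi (k : nat) (vs : nat -> 'cV[R[i]]_n)
    (h : nat -> nat -> R[i]) (tau : R) : 'cV[R[i]]_n :=
  arnoldi_basis k vs *m mexp ((- tau)%:C *: arnoldi_hess k h)
    *m first_basis_vector k.

End Arnoldi.

Section EllipticIntegrals.
Variable R : realType.

Definition ellipticK (m : R) : R :=
  \int[@lebesgue_measure R]_(t in `[0, pi / 2])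
    (Num.sqrt (1 - m * sin t ^+ 2))^-1.

Definition ellipticE (m : R) : R :=
  \int[@lebesgue_measure R]_(t in `[0, pi / 2])
    Num.sqrt (1 - m * sin t ^+ 2).

End EllipticIntegrals.

(* Main.v *)
Require Import Defs.
From HB Require Import structures.
From mathcomp Require Import all_boot all_order all_algebra.
From mathcomp Require Import all_classical all_reals all_analysis.
From mathcomp Require Import complex ring lra zify.

Set Implicit Arguments.
Unset Strict Implicit.
Unset Printing Implicit Defensive.

Import Order.TTheory GRing.Theory Num.Theory.
Import numFieldNormedType.Exports.

Local Open Scope classical_set_scope.
Local Open Scope ring_scope.
Local Open Scope complex_scope.
Local Open Scope sesquilinear_scope.

(** The numerical range of A lies in the rectangle [a, b] x 'i [-c, c], and so
    does that of the Hessenberg matrix H, a compression of A. The exterior of the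
    unit disk is mapped onto the exterior of this rectangle by
    psi w = (a + b) / 2 + C Psi w, where w Psi' w is a square root of
    w^2 + w^-2 - 2 (1 - 2 m) and C = 1 / (2 lambda). The equation that defines m
    and lambda says that C Psi (corner m) is the vector from the center of the
    rectangle to a corner, because Psi at corner m, a point of the unit circle,
    is given by complete elliptic integrals
    (Re_Psi_corner, Im_Psi_corner); integrating Psi' along the real axis gives
    z = Re psi (- 1 / q), the leftmost point of the level curve |w| = 1 / q
    (Psi_real_integral, Re_Psi_le).

    The level curves of psi are convex with normal direction w Psi' w, and their
    tangents do not meet the rectangle (support). Hence the function
    w Psi' w (Psi w - H0)^-1, with H0 the normalized matrix, has positive real
    part for |w| > 1 (Re_gfun_ge0). By Caratheodory's argument its Laurent
    coefficients are bounded by 3 (mean_bound_gfun); they are the Faber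
    polynomials of H0. A power of kappa - sigma H0 is recovered from the same
    function by a contour integral, whose powers of w below k - 1 contribute
    nothing to the entry in the last row and first column, because a Hessenberg
    matrix reaches that entry only with its power k - 1. Cauchy's estimate on the
    circle |w| = 1 / q bounds the other coefficients, and a geometric series in q
    results (faber_bound). The contour integrals are limits of averages over
    roots of unity, so that Cauchy's theorem is the telescoping of a sum.

    The exponentials are limits of powers (1 - tau A / N)^N (mexp_euler). The
    difference of these powers for A and for H is a sum of N defects, each a
    multiple of the last entry of (1 - tau H / N)^j e_1 (euler_defect). Such a
    power of 1 - (tau / N) psi is at most exp (- j tau z / N) on the level curve,
    up to a quadratic term in tau / N, and 1 - tau A / N has norm at most
    exp (- tau a / N) up to a quadratic term, with a >= z. Adding up gives the
    bound with exp (- tau z) and the constant 12 (arnoldi_error), which implies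
    the claim since min (a, 0) <= 0 and 12 <= 2 * 11.08. *)

(** * Complex numbers: modulus, limits and absolutely convergent series *)

Section Modulus.
Variable R : realType.
Implicit Types (x y z : R[i]) (r s : R).

Definition cabs z : R := Num.sqrt (complex.Re z ^+ 2 + complex.Im z ^+ 2).

Lemma cabs_normc z : cabs z = Normc.normc z.
Proof. by case: z. Qed.

Lemma cabsE z : complex.Re `|z| = cabs z.
Proof. by rewrite normc_def. Qed.

Lemma cabs_ge0 z : 0 <= cabs z.
Proof. exact: sqrtr_ge0. Qed.

Lemma sqr_cabs z : cabs z ^+ 2 = complex.Re z ^+ 2 + complex.Im z ^+ 2.
Proof. by rewrite sqr_sqrtr // addr_ge0 ?sqr_ge0. Qed.

Lemma cabs0 : cabs 0 = 0.
Proof. by rewrite cabs_normc Normc.normc0. Qed.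

Lemma cabs1 : cabs 1 = 1.
Proof. by rewrite cabs_normc Normc.normc1. Qed.

Lemma cabs_eq0 z : cabs z = 0 -> z = 0.
Proof. by rewrite cabs_normc; apply: Normc.eq0_normc. Qed.

Lemma cabs_gt0 z : (0 < cabs z) = (z != 0).
Proof.
rewrite lt_neqAle cabs_ge0 andbT eq_sym.
by apply/idP/idP; apply: contraNN => /eqP; [move=> ->; rewrite cabs0|move/cabs_eq0->].
Qed.

Lemma cabsM x y : cabs (x * y) = cabs x * cabs y.
Proof. by rewrite !cabs_normc Normc.normcM. Qed.

Lemma cabsX z n : cabs (z ^+ n) = cabs z ^+ n.
Proof. by elim: n => [|n IH]; rewrite ?cabs1 // !exprS cabsM IH. Qed.

Lemma cabsV z : cabs z^-1 = (cabs z)^-1.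
Proof. by rewrite !cabs_normc Normc.normcV. Qed.

Lemma cabsN z : cabs (- z) = cabs z.
Proof. by case: z => a b; rewrite /cabs /= !sqrrN. Qed.

Lemma cabsD x y : cabs (x + y) <= cabs x + cabs y.
Proof. by rewrite !cabs_normc; apply: le_normcD. Qed.

Lemma cabsB x y : cabs (x - y) <= cabs x + cabs y.
Proof. by rewrite -(cabsN y); apply: cabsD. Qed.

Lemma cabs_distC x y : cabs (x - y) = cabs (y - x).
Proof. by rewrite -cabsN opprB. Qed.

Lemma cabs_dist x y : cabs x <= cabs y + cabs (x - y).
Proof. by rewrite -{1}(subrK y x) addrC cabsD. Qed.

Lemma cabs_real r : cabs r%:C = `|r|.
Proof. by rewrite /cabs /= expr0n addr0 sqrtr_sqr. Qed.

Lemma cabs_conj z : cabs z^* = cabs z.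
Proof. by case: z => a b; rewrite /cabs /= sqrrN. Qed.

Lemma cabs_nat n : cabs n%:R = n%:R.
Proof. by rewrite -(rmorph_nat (real_complex R)) cabs_real normr_nat. Qed.

Lemma Re_le_cabs z : `|complex.Re z| <= cabs z.
Proof. by rewrite -sqrtr_sqr ler_wsqrtr // lerDl sqr_ge0. Qed.

Lemma Im_le_cabs z : `|complex.Im z| <= cabs z.
Proof. by rewrite -sqrtr_sqr ler_wsqrtr // lerDr sqr_ge0. Qed.

Lemma cabs_le z : cabs z <= `|complex.Re z| + `|complex.Im z|.
Proof.
rewrite -(@ler_pXn2r _ 2%N) ?nnegrE ?cabs_ge0 ?addr_ge0 //.
rewrite sqr_cabs sqrrD !real_normK ?num_real // -addrA lerD2l lerDr.
by rewrite mulrn_wge0 // mulr_ge0.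
Qed.

Lemma cabs_sum I (s : seq I) (P : pred I) (F : I -> R[i]) :
  cabs (\sum_(i <- s | P i) F i) <= \sum_(i <- s | P i) cabs (F i).
Proof.
elim/big_ind2 : _ => [|x1 x2 y1 y2 h1 h2|//]; first by rewrite cabs0.
by rewrite (le_trans (cabsD _ _)) // lerD.
Qed.

Lemma sqr_cabsE z : (cabs z ^+ 2)%:C = z^* * z.
Proof.
rewrite sqr_cabs; case: z => a b /=; apply/eqP.
by rewrite eq_complex /=; apply/andP; split; apply/eqP; ring.
Qed.

Lemma ReD x y : complex.Re (x + y) = complex.Re x + complex.Re y.
Proof. by case: x y => [? ?] []. Qed.
Lemma ImD x y : complex.Im (x + y) = complex.Im x + complex.Im y.
Proof. by case: x y => [? ?] []. Qed.
Lemma ReN x : complex.Re (- x) = - complex.Re x.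
Proof. by case: x. Qed.
Lemma ImN x : complex.Im (- x) = - complex.Im x.
Proof. by case: x. Qed.
Lemma ReM x y : complex.Re (x * y) =
  complex.Re x * complex.Re y - complex.Im x * complex.Im y.
Proof. by case: x y => [? ?] []. Qed.
Lemma ImM x y : complex.Im (x * y) =
  complex.Re x * complex.Im y + complex.Im x * complex.Re y.
Proof. by case: x y => [? ?] []. Qed.
Lemma Re_conj x : complex.Re x^* = complex.Re x.
Proof. by case: x. Qed.
Lemma Im_conj x : complex.Im x^* = - complex.Im x.
Proof. by case: x. Qed.

Lemma Re_conjM x y : complex.Re (x^* * y) =
  complex.Re x * complex.Re y + complex.Im x * complex.Im y.
Proof. by rewrite ReM Re_conj Im_conj mulNr opprK. Qed.
Lemma Im_conjM x y : complex.Im (x^* * y) =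
  complex.Re x * complex.Im y - complex.Im x * complex.Re y.
Proof. by rewrite ImM Re_conj Im_conj mulNr. Qed.

Definition ReImE := (ReD, ImD, ReN, ImN, ReM, ImM, Re_conj, Im_conj).

Lemma complex_eq x y :
  complex.Re x = complex.Re y -> complex.Im x = complex.Im y -> x = y.
Proof. by case: x y => [? ?] [? ?] /= -> ->. Qed.

End Modulus.

Section ComplexLimit.
Variable R : realType.
Implicit Types (f g : nat -> R[i]) (x y z : R[i]).

Definition ccvg f z := forall e : R, 0 < e ->
  exists J0, forall J, (J0 <= J)%N -> cabs (f J - z) <= e.

Definition clim f : R[i] :=
  limn (fun J => complex.Re (f J)) +i* limn (fun J => complex.Im (f J)).

Arguments clim : simpl never.

Lemma cvgn_leP (u : R^nat) (l : R) :
  (forall e, 0 < e -> exists J0, forall J, (J0 <= J)%N -> `|u J - l| <= e) ->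
  u @ \oo --> l.
Proof.
move=> h; apply/cvgrPdist_le => e e0; have [J0 hJ] := h e e0.
by exists J0 => // J /= J0J; rewrite distrC hJ.
Qed.

Lemma cvgn_le_eps (u : R^nat) (l e : R) : 0 < e -> u @ \oo --> l ->
  exists J0, forall J, (J0 <= J)%N -> `|u J - l| <= e.
Proof.
move=> e0 /cvgrPdist_le/(_ e e0)[J0 _ h]; exists J0 => J J0J.
by rewrite distrC h.
Qed.

Lemma ccvg_clim f z : ccvg f z -> clim f = z.
Proof.
move=> h; rewrite /clim; apply: complex_eq; rewrite /=; apply/cvg_lim => //.
  apply: cvgn_leP => e /h[J0 hJ]; exists J0 => J /hJ; apply: le_trans.
  by rewrite -ReN -ReD Re_le_cabs.
apply: cvgn_leP => e /h[J0 hJ]; exists J0 => J /hJ; apply: le_trans.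
by rewrite -ImN -ImD Im_le_cabs.
Qed.

Lemma clim_ccvg f : cvgn (fun J => complex.Re (f J)) ->
  cvgn (fun J => complex.Im (f J)) -> ccvg f (clim f).
Proof.
move=> hr hi e e0; have e2 : 0 < e / 2 by rewrite divr_gt0.
have [J1 h1] := cvgn_le_eps e2 hr; have [J2 h2] := cvgn_le_eps e2 hi.
exists (maxn J1 J2) => J; rewrite geq_max => /andP[/h1 k1 /h2 k2].
apply: le_trans (cabs_le _) _; rewrite !ReImE /=.
by rewrite (le_trans (lerD k1 k2)) // -splitr.
Qed.

Lemma ccvg_unique f x y : ccvg f x -> ccvg f y -> x = y.
Proof. by move=> /ccvg_clim <- /ccvg_clim <-. Qed.

Lemma ccvg_cst z : ccvg (fun=> z) z.
Proof. by move=> e e0; exists 0%N => J _; rewrite subrr cabs0 ltW. Qed.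

Lemma eq_ccvg f g x : f =1 g -> ccvg f x -> ccvg g x.
Proof. by move=> fg h e /h[J0 hJ]; exists J0 => J /hJ; rewrite fg. Qed.

Lemma ccvgD f g x y : ccvg f x -> ccvg g y -> ccvg (fun J => f J + g J) (x + y).
Proof.
move=> hf hg e e0; have e2 : 0 < e / 2 by rewrite divr_gt0.
have [J1 h1] := hf _ e2; have [J2 h2] := hg _ e2.
exists (maxn J1 J2) => J; rewrite geq_max => /andP[/h1 k1 /h2 k2].
rewrite (_ : _ - _ = (f J - x) + (g J - y)); last by ring.
by rewrite (le_trans (cabsD _ _)) // (le_trans (lerD k1 k2)) // -splitr.
Qed.

Lemma ccvgZ f x z : ccvg f x -> ccvg (fun J => z * f J) (z * x).
Proof.
move=> hf e e0; have z0 := cabs_ge0 z.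
have e2 : 0 < e / (cabs z + 1) by rewrite divr_gt0 // ltr_wpDl.
have [J0 h] := hf _ e2; exists J0 => J /h hJ.
rewrite -mulrBr cabsM (le_trans (ler_wpM2l z0 hJ)) //.
by rewrite mulrCA ler_piMr ?(ltW e0) // ler_pdivrMr ?ltr_wpDl //; lra.
Qed.

Lemma ccvgB f g x y : ccvg f x -> ccvg g y -> ccvg (fun J => f J - g J) (x - y).
Proof.
move=> hf hg; have := ccvgD hf (ccvgZ (-1) hg); rewrite mulN1r.
by apply: eq_ccvg => J; rewrite mulN1r.
Qed.

Lemma ccvgS f x : ccvg f x -> ccvg (fun J => f J.+1) x.
Proof. by move=> h e /h[J0 hJ]; exists J0 => J J0J; apply/hJ/leqW. Qed.

Lemma ccvg_le f z (M : R) :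
  ccvg f z -> (forall J, cabs (f J) <= M) -> cabs z <= M.
Proof.
move=> hf hM; apply/ler_addgt0Pr => e /hf[J0 h].
have := h J0 (leqnn _); rewrite cabs_distC => hz.
by rewrite (le_trans (cabs_dist z (f J0))) // lerD.
Qed.

Lemma ccvg_bounded f z : ccvg f z -> exists M, forall J, cabs (f J) <= M.
Proof.
move=> /(_ 1 ltr01)[J0 h].
exists (cabs z + 1 + \sum_(j < J0) cabs (f j)) => J.
have s0 : 0 <= \sum_(j < J0) cabs (f j) by apply: sumr_ge0 => *; apply: cabs_ge0.
have [/h hJ|ltJ] := leqP J0 J.
  by have := cabs_dist (f J) z; have := cabs_ge0 z; lra.
rewrite (bigD1 (Ordinal ltJ)) //=.
have := cabs_ge0 z; set S := \sum_(_ < _ | _) _.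
have : 0 <= S by apply: sumr_ge0 => *; apply: cabs_ge0.
lra.
Qed.

Lemma ccvgM f g x y : ccvg f x -> ccvg g y -> ccvg (fun J => f J * g J) (x * y).
Proof.
move=> hf hg; have [M hM] := ccvg_bounded hf.
have M0 : 0 <= M by exact: le_trans (cabs_ge0 _) (hM 0%N).
have h1 : ccvg (fun J => f J * (g J - y)) 0.
  move=> e e0; have e2 : 0 < e / (M + 1) by rewrite divr_gt0 // ltr_wpDl.
  have [J0 h] := hg _ e2; exists J0 => J /h hJ; rewrite subr0 cabsM.
  apply: le_trans (ler_pM (cabs_ge0 _) (cabs_ge0 _) (hM J) hJ) _.
  by rewrite mulrCA ler_piMr ?(ltW e0) // ler_pdivrMr ?ltr_wpDl //; lra.
have := ccvgD h1 (ccvgZ y hf); rewrite add0r [y * x]mulrC.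
by apply: eq_ccvg => J; ring.
Qed.

Lemma ccvg_conj f x : ccvg f x -> ccvg (fun J => (f J)^*) x^*.
Proof.
move=> hf e /hf[J0 h]; exists J0 => J /h.
by rewrite -cabs_conj rmorphB.
Qed.

End ComplexLimit.

Section AbsoluteSeries.
Variable R : realType.
Implicit Types (a b : nat -> R[i]) (d : nat -> R).

Definition dominated d a := forall j, cabs (a j) <= d j.
Definition summable d := exists A, forall J, \sum_(j < J) d j <= A.
Definition psum a J : R[i] := \sum_(j < J) a j.
Definition csum a : R[i] := clim (psum a).

Arguments csum : simpl never.

Lemma summable_tail d : (forall j, 0 <= d j) -> summable d ->
  forall e, 0 < e -> exists J0, forall J J', (J0 <= J)%N -> (J <= J')%N ->
    \sum_(J <= j < J') d j <= e.
Proof.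
move=> d0 [A hA] e e0.
have ndS : nondecreasing_seq (series d).
  by apply: nondecreasing_series => *; apply: d0.
have cvS : cvgn (series d).
  apply: nondecreasing_is_cvgn => //; exists A => _ [J _ <-].
  by rewrite /series /= big_mkord.
have e2 : 0 < e / 2 by rewrite divr_gt0.
have [J0 h] := cvgn_le_eps e2 cvS; exists J0 => J J' J0J JJ'.
have := h _ J0J; have := h _ (leq_trans J0J JJ').
rewrite /series /= (big_cat_nat (n := J) (p := J')) //=.
set l := limn _; set s1 := \sum_(0 <= _ < _) _; set s2 := \sum_(_ <= _ < _) _.
rewrite !ler_norml => /andP[_ h1] /andP[h2 _]; lra.
Qed.

Lemma dominated_ge0 d a : dominated d a -> forall j, 0 <= d j.
Proof. by move=> h j; exact: le_trans (cabs_ge0 _) (h j). Qed.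

Lemma psum_dist d a J J' : dominated d a -> (J <= J')%N ->
  cabs (psum a J' - psum a J) <= \sum_(J <= j < J') d j.
Proof.
move=> ad JJ'; rewrite /psum -(big_mkord xpredT a) -(big_mkord xpredT a).
rewrite (@big_cat_nat _ _ _ J 0%N J') //= addrAC subrr add0r.
by rewrite (le_trans (cabs_sum _ _ _)) // ler_sum.
Qed.

Lemma psum_ccvg d a : dominated d a -> summable d -> ccvg (psum a) (csum a).
Proof.
move=> ad sd; have d0 := dominated_ge0 ad.
have [A hA] := sd.
have cv (g : R[i] -> R) : (forall z, `|g z| <= cabs z) ->
    (forall x y, g (x + y) = g x + g y) -> g 0 = 0 ->
    cvgn (fun J => g (psum a J)).
  move=> gle gD g0.
  have -> : (fun J => g (psum a J)) = series (fun j => g (a j)).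
    apply/funext => J; rewrite /series /psum /= big_mkord.
    by rewrite (big_morph g gD g0).
  apply: normed_cvg; apply: nondecreasing_is_cvgn.
    by apply: nondecreasing_series => *; apply: normr_ge0.
  exists A => _ [J _ <-]; apply: le_trans _ (hA J).
  rewrite -(big_mkord xpredT d); apply: ler_sum => j _.
  exact: le_trans (gle _) (ad _).
apply: clim_ccvg.
  by apply: cv => // *; rewrite ?Re_le_cabs // ReD.
by apply: cv => // *; rewrite ?Im_le_cabs // ImD.
Qed.

(** The rate of convergence depends on the dominating series alone, so it is
    uniform over every family of series with the same majorant. *)
Lemma csum_tail d : (forall j, 0 <= d j) -> summable d ->
  forall e, 0 < e -> exists J0, forall J, (J0 <= J)%N -> forall a,
    dominated d a -> cabs (csum a - psum a J) <= e.
Proof.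
move=> d0 sd e e0; have [J0 h] := summable_tail d0 sd e0.
exists J0 => J J0J a ad.
have hc : ccvg (fun J' => psum a (J + J') - psum a J) (csum a - psum a J).
  apply: ccvgB (ccvg_cst _) => e' e0'.
  have [J1 h1] := psum_ccvg ad sd e0'.
  by exists J1 => J' J1J'; apply: h1; apply: leq_trans (leq_addl _ _).
apply: (ccvg_le hc) => J'.
exact: le_trans (psum_dist ad (leq_addr _ _)) (h _ _ J0J (leq_addr _ _)).
Qed.

Lemma csum_le d a (M : R) : dominated d a -> summable d ->
  (forall J, cabs (psum a J) <= M) -> cabs (csum a) <= M.
Proof. by move=> ad sd; apply: ccvg_le (psum_ccvg ad sd). Qed.

Lemma csum_le_sum d a A : dominated d a -> (forall J, \sum_(j < J) d j <= A) ->
  cabs (csum a) <= A.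
Proof.
move=> ad hA; apply: (@csum_le d) => //; first by exists A.
move=> J; apply: le_trans _ (hA J); rewrite (le_trans (cabs_sum _ _ _)) //.
by apply: ler_sum => j _; apply: ad.
Qed.

Lemma psumZ a z J : psum (fun j => z * a j) J = z * psum a J.
Proof. by rewrite /psum mulr_sumr. Qed.

Definition conv (T : pzSemiRingType) (a b : nat -> T) (n : nat) : T :=
  \sum_(i < n.+1) a i * b (n - i)%N.

Lemma convC (T : comPzSemiRingType) (f g : nat -> T) n : conv f g n = conv g f n.
Proof.
rewrite /conv (reindex_inj rev_ord_inj) /=; apply: eq_bigr => i _.
by rewrite mulrC subSS subKn // -ltnS.
Qed.

Lemma sum_conv (T : pzSemiRingType) (a b : nat -> T) J :
  \sum_(n < J) conv a b n = \sum_(i < J) a i * \sum_(j < J - i) b j.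
Proof.
elim: J => [|J IH]; first by rewrite !big_ord0.
rewrite big_ord_recr /= IH /conv.
transitivity (\sum_(i < J.+1) a i * (\sum_(j < J - i) b j) +
              \sum_(i < J.+1) a i * b (J - i)%N).
  congr (_ + _); rewrite [in RHS]big_ord_recr /= subnn.
  by rewrite [X in _ + _ * X]big_ord0 mulr0 addr0.
rewrite -big_split /=; apply: eq_bigr => i _.
rewrite -mulrDr; congr (_ * _).
have iJ : (i <= J)%N by rewrite -ltnS.
by rewrite subSn // big_ord_recr.
Qed.

Lemma psum_conv a b J : psum (conv a b) J = \sum_(i < J) a i * psum b (J - i).
Proof. exact: sum_conv. Qed.

(** Cauchy products: the square of indices differs from the triangle by terms
    with a large index in one of the two factors, and both tails are small. *)
Lemma csum_conv d d' a b : dominated d a -> dominated d' b -> summable d ->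
  summable d' -> ccvg (psum (conv a b)) (csum a * csum b).
Proof.
move=> ad bd sd sd'; have [A hA] := sd; have [B hB] := sd'.
have ca := psum_ccvg ad sd; have cb := psum_ccvg bd sd'.
have d0 := dominated_ge0 ad; have d0' := dominated_ge0 bd.
have A0 : 0 <= A by have := hA 0%N; rewrite big_ord0.
have B0 : 0 <= B by have := hB 0%N; rewrite big_ord0.
have sb J : cabs (psum b J) <= B.
  apply: le_trans _ (hB J); rewrite (le_trans (cabs_sum _ _ _)) //.
  by apply: ler_sum => j _; apply: bd.
suff h0 : ccvg (fun J => psum a J * psum b J - psum (conv a b) J) 0.
  have := ccvgB (ccvgM ca cb) h0; rewrite subr0.
  by apply: eq_ccvg => J /=; ring.
move=> e e0; set K := A + 2 * B + 1; have K0 : 0 < K by rewrite /K; lra.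
have e1 : 0 < e / K by rewrite divr_gt0.
have [J1 h1] := summable_tail d0 sd e1.
have [J2 h2] := summable_tail d0' sd' e1.
exists (J1 + J2)%N => J hJ; rewrite subr0 psum_conv /psum mulr_suml -sumrB.
have J1J : (J1 <= J)%N by apply: leq_trans hJ; apply: leq_addr.
rewrite -(big_mkord xpredT (fun i => a i * _ - a i * psum b (J - i))).
rewrite (big_cat_nat (n := J1)) //=.
have p1 : cabs (\sum_(0 <= i < J1) (a i * (\sum_(j < J) b j) - a i * psum b (J - i)))
    <= A * (e / K).
  apply: le_trans (cabs_sum _ _ _) _.
  apply: le_trans _ (ler_wpM2r (ltW e1) (hA J1)).
  rewrite big_mkord mulr_suml; apply: ler_sum => i _.
  rewrite -mulrBr cabsM ler_pM ?cabs_ge0 //.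
  apply: le_trans (psum_dist bd (leq_subr _ _)) _; apply: h2 (leq_subr _ _).
  by rewrite leq_subRL; have := ltn_ord i; lia.
have p2 : cabs (\sum_(J1 <= i < J) (a i * (\sum_(j < J) b j) - a i * psum b (J - i)))
    <= (e / K) * (2 * B).
  apply: le_trans (cabs_sum _ _ _) _.
  have B2 : 0 <= 2 * B by rewrite mulr_ge0.
  apply: le_trans _ (ler_wpM2r B2 (h1 _ _ (leqnn _) J1J)).
  rewrite mulr_suml; apply: ler_sum => i _.
  rewrite -mulrBr cabsM ler_pM ?cabs_ge0 //.
  rewrite (le_trans (cabsB _ _)) // mulrDl !mul1r lerD //.
  by have := sb J; rewrite /psum.
apply: le_trans (cabsD _ _) (le_trans (lerD p1 p2) _).
rewrite mulrC -mulrDr -mulrA ler_piMr ?(ltW e0) // mulrC ler_pdivrMr // /K; lra.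
Qed.

End AbsoluteSeries.

(** * The square root of 1 - z on the closed unit disk *)

Section BinomialSeries.
Variable R : realType.
Implicit Types (z : R[i]) (J j n : nat).

(** Taylor coefficients of the square root of 1 - z at 0. *)
Fixpoint bcoef n : R :=
  if n is j.+1 then (j%:R - 2^-1) / j.+1%:R * bcoef j else 1.

Lemma bcoefS j : j.+1%:R * bcoef j.+1 = (j%:R - 2^-1) * bcoef j.
Proof. by rewrite /= mulrA mulrCA mulfV ?mulr1 // pnatr_eq0. Qed.

Lemma bcoef_le0 j : (0 < j)%N -> bcoef j <= 0.
Proof.
case: j => // j _; elim: j => [|j IH]; first by rewrite /=; lra.
rewrite [bcoef _]/= mulr_ge0_le0 // divr_ge0 // subr_ge0.
by rewrite (@le_trans _ _ 1) ?ler1n //; lra.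
Qed.

(** A closed form of the partial sums at 1; with the signs of the coefficients it
    gives absolute convergence up to the boundary of the disk. *)
Lemma sum_bcoef J : \sum_(j < J.+1) bcoef j = (1 - 2 * J%:R) * bcoef J.
Proof.
elim: J => [|J IH]; first by rewrite big_ord_recr big_ord0 /=; ring.
rewrite big_ord_recr IH.
have := bcoefS J; set x := bcoef J; set y := bcoef J.+1.
by rewrite -natr1 => h; rewrite /=; lra.
Qed.

Lemma sum_bcoef_ge0 J : 0 <= \sum_(j < J.+1) bcoef j.
Proof.
rewrite sum_bcoef; case: J => [|J]; first by rewrite /=; lra.
have J1 : 1 <= J.+1%:R :> R by rewrite ler1n.
by apply: mulr_le0; rewrite ?bcoef_le0 //; lra.
Qed.

Lemma sum_tail_bcoef J : \sum_(j < J) `|bcoef j.+1| <= 1.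
Proof.
have := sum_bcoef_ge0 J; rewrite big_ord_recl.
under eq_bigr => i _ do rewrite lift0.
rewrite [bcoef ord0]/= => h.
rewrite (eq_bigr (fun j : 'I_J => - bcoef j.+1)).
  by rewrite sumrN; lra.
by move=> j _; rewrite ler0_norm ?bcoef_le0.
Qed.

Lemma sum_norm_bcoef J : \sum_(j < J) `|bcoef j| <= 2.
Proof.
case: J => [|J]; first by rewrite big_ord0.
rewrite big_ord_recl [bcoef ord0]/= normr1.
under eq_bigr => i _ do rewrite lift0.
by have := sum_tail_bcoef J; lra.
Qed.

(** Differentiating the square of the series turns the recurrence for its
    coefficients into a recurrence for those of the square, which therefore
    stop after the linear term. *)
Lemma conv_bcoefS n :
  n.+1%:R * conv bcoef bcoef n.+1 = (n%:R - 1) * conv bcoef bcoef n.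
Proof.
have deg (f g : nat -> R) N : N%:R * conv f g N =
    conv (fun i => i%:R * f i) g N + conv f (fun i => i%:R * g i) N.
  rewrite /conv mulr_sumr -big_split; apply: eq_bigr => i _ /=.
  rewrite -{1}(subnKC (ltn_ord i : (i <= N)%N)) natrD; ring.
have half (f : nat -> R) N : N%:R * conv f f N =
    2 * conv (fun i => i%:R * f i) f N.
  by rewrite deg (convC f); ring.
rewrite half {1}/conv big_ord_recl mul0r mul0r add0r.
rewrite mulrBl mul1r half mulr_sumr /conv mulr_sumr -sumrB.
apply: eq_bigr => i _; rewrite lift0 subSS bcoefS.
by field.
Qed.

Lemma conv_bcoef n : conv bcoef bcoef n = (n == 0%N)%:R - (n == 1%N)%:R.
Proof.
have e0 : conv bcoef bcoef 0 = 1.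
  by rewrite /conv big_ord_recl big_ord0 /=; ring.
case: n => [|n]; first by rewrite e0 subr0.
have e1 : conv bcoef bcoef 1 = -1.
  by have := conv_bcoefS 0; rewrite e0; lra.
case: n => [|n]; first by rewrite e1 sub0r.
rewrite subrr; elim: n => [|n IH].
  by have := conv_bcoefS 1; rewrite e1; lra.
have := conv_bcoefS n.+2; rewrite IH mulr0 => /eqP.
by rewrite mulf_eq0 pnatr_eq0 /= => /eqP.
Qed.

Definition bterm z n : R[i] := (bcoef n)%:C * z ^+ n.
Definition sqrt1B z : R[i] := csum (bterm z).

Lemma bterm_dominated z : cabs z <= 1 ->
  dominated (fun j => `|bcoef j|) (bterm z).
Proof.
move=> z1 j; rewrite cabsM cabs_real cabsX ler_piMr //.
by rewrite exprn_ile1 ?cabs_ge0.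
Qed.

Lemma summable_bcoef : summable (fun j => `|bcoef j|).
Proof. by exists 2 => J; apply: sum_norm_bcoef. Qed.

Lemma sqr_sqrt1B z : cabs z <= 1 -> sqrt1B z ^+ 2 = 1 - z.
Proof.
move=> z1; have zd := bterm_dominated z1.
have h := csum_conv zd zd summable_bcoef summable_bcoef.
apply: (ccvg_unique h) => e e0; exists 2%N => J.
have cE n : conv (bterm z) (bterm z) n =
    ((n == 0%N)%:R - (n == 1%N)%:R) * z ^+ n.
  transitivity ((conv bcoef bcoef n)%:C * z ^+ n).
    rewrite /conv raddf_sum mulr_suml; apply: eq_bigr => i _ /=.
    have -> : z ^+ n = z ^+ i * z ^+ (n - i) by rewrite -exprD subnKC // -ltnS.
    by rewrite rmorphM /bterm; ring.
  by rewrite conv_bcoef rmorphB !rmorph_nat.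
case: J => [|[|J]] // _; rewrite /psum; under eq_bigr => i _ do rewrite cE.
rewrite 2!big_ord_recl big1 /= ?addr0; last first.
  by move=> i _; rewrite /bump /= subrr mul0r.
by rewrite (_ : _ - _ = 0) ?cabs0 ?ltW //; ring.
Qed.

(** The coefficients after the first are nonpositive, with sum at least -1, so
    the series stays within distance 1 of its first term. *)
Lemma Re_sqrt1B_ge0 z : cabs z <= 1 -> 0 <= complex.Re (sqrt1B z).
Proof.
move=> z1; have zd := bterm_dominated z1.
suff : cabs (sqrt1B z - 1) <= 1.
  move=> h; have := le_trans (Re_le_cabs _) h.
  by rewrite !ReImE /= ler_norml; lra.
have h := ccvgB (ccvgS (psum_ccvg zd summable_bcoef)) (ccvg_cst 1).
apply: (ccvg_le h) => J; rewrite /psum big_ord_recl /bterm /= mul1r expr0.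
rewrite [1 + _]addrC addrK (le_trans (cabs_sum _ _ _)) //.
apply: le_trans _ (sum_tail_bcoef J); apply: ler_sum => j _.
exact: (bterm_dominated z1).
Qed.

(** The square, 1 - z, has a nonnegative real part, which confines the root to a
    sector of half angle pi / 4; only z = 1 reaches the boundary. *)
Lemma Re_sqrt1B_gt z : cabs z <= 1 ->
  sqrt1B z = 0 \/ `|complex.Im (sqrt1B z)| < complex.Re (sqrt1B z).
Proof.
move=> z1; have := Re_sqrt1B_ge0 z1; have := sqr_sqrt1B z1.
set s := sqrt1B z => sE s0.
have zz : complex.Re z ^+ 2 + complex.Im z ^+ 2 <= 1.
  by rewrite -sqr_cabs exprn_ile1 ?cabs_ge0.
have hR : complex.Re s ^+ 2 - complex.Im s ^+ 2 = 1 - complex.Re z.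
  by have := congr1 (@complex.Re R) sE; rewrite expr2 !ReImE /=; lra.
have [h|h] := ltP (`|complex.Im s|) (complex.Re s); [by right|left].
have h2 : complex.Re s ^+ 2 <= complex.Im s ^+ 2.
  by rewrite -(real_normK (num_real (complex.Im s))) ler_sqr ?nnegrE.
have Re1 : complex.Re z = 1 by nra.
have Im0 : complex.Im z = 0 by apply/eqP; rewrite -sqrf_eq0; apply/eqP; nra.
have z_1 : z = 1 by apply: complex_eq.
by apply/eqP; rewrite -sqrf_eq0 sE z_1 subrr.
Qed.

End BinomialSeries.

(** * Uniformly differentiable functions on annuli *)

Section Annulus.
Variable R : realType.
Implicit Types (w : R[i]) (F G : R[i] -> R[i]) (r : R).

Definition annulus r1 r2 w := r1 <= cabs w <= r2.

(** Complex differentiability, uniform on the annulus, written with the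
    logarithmic derivative F1 = w F'. *)
Definition hol r1 r2 F F1 :=
  (exists K, forall w, annulus r1 r2 w -> cabs (F w) <= K /\ cabs (F1 w) <= K) /\
  (forall e, 0 < e -> exists2 d, 0 < d & forall w w',
     annulus r1 r2 w -> annulus r1 r2 w' -> cabs (w' - w) <= d ->
     cabs (F w' - F w - F1 w * (w' / w - 1)) <= e * cabs (w' - w)).

Lemma annulus_neq0 r1 r2 w : 1 <= r1 -> annulus r1 r2 w -> w != 0.
Proof. by move=> r11 /andP[h _]; rewrite -cabs_gt0; lra. Qed.

Lemma cabs_divB1 w w' : w != 0 -> cabs (w' / w - 1) = cabs (w' - w) / cabs w.
Proof. by move=> w0; rewrite -cabsV -cabsM mulrBl divff. Qed.

Lemma cabs_divB1_le w w' : 1 <= cabs w -> cabs (w' / w - 1) <= cabs (w' - w).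
Proof.
move=> w1; rewrite cabs_divB1; last by rewrite -cabs_gt0; lra.
by rewrite ler_pdivrMr; [rewrite ler_peMr ?cabs_ge0|lra].
Qed.

Lemma hol_sub r1 r2 r1' r2' F F1 : r1 <= r1' -> r2' <= r2 ->
  hol r1 r2 F F1 -> hol r1' r2' F F1.
Proof.
move=> h1 h2 [[K hK] h].
have sub w : annulus r1' r2' w -> annulus r1 r2 w.
  by move=> /andP[a b]; apply/andP; split; lra.
split; first by exists K => w /sub/hK.
by move=> e /h[d d0 hd]; exists d => // w w' /sub aw /sub aw'; apply: hd.
Qed.

Lemma eq_hol r1 r2 F F1 G G1 : F =1 G -> F1 =1 G1 -> hol r1 r2 F F1 ->
  hol r1 r2 G G1.
Proof. by move=> /funext -> /funext ->. Qed.

Lemma hol_lip r1 r2 F F1 : 1 <= r1 -> hol r1 r2 F F1 ->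
  exists2 K, 0 < K & exists2 d, 0 < d & forall w w',
    annulus r1 r2 w -> annulus r1 r2 w' -> cabs (w' - w) <= d ->
    cabs (F w' - F w) <= K * cabs (w' - w).
Proof.
move=> r11 [[K hK] /(_ 1 ltr01)[d d0 h]].
exists (`|K| + 1); first by rewrite ltr_wpDl.
exists d => // w w' aw aw' /(h _ _ aw aw') {h}.
have w1 : 1 <= cabs w by case/andP: aw; lra.
have [_ kw] := hK _ aw.
set T := F1 w * _ => h.
have hT : cabs T <= `|K| * cabs (w' - w).
  rewrite cabsM ler_pM ?cabs_ge0 ?cabs_divB1_le //.
  exact: le_trans kw (ler_norm _).
have := cabs_dist (F w' - F w) T; lra.
Qed.

Lemma hol_cst r1 r2 z : hol r1 r2 (fun=> z) (fun=> 0).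
Proof.
split; first by exists (cabs z) => w _; rewrite cabs0 cabs_ge0.
move=> e e0; exists 1 => // w w' _ _ _.
by rewrite subrr mul0r subr0 cabs0 mulr_ge0 ?cabs_ge0 ?ltW.
Qed.

Lemma hol_id r1 r2 : 1 <= r1 -> hol r1 r2 id id.
Proof.
move=> r11; split; first by exists r2 => w /andP[].
move=> e e0; exists 1 => // w w' aw _ _.
have w0 := annulus_neq0 r11 aw.
rewrite (_ : _ - _ = 0) ?cabs0 ?mulr_ge0 ?cabs_ge0 ?ltW //.
by field.
Qed.

Lemma holD r1 r2 F F1 G G1 : hol r1 r2 F F1 -> hol r1 r2 G G1 ->
  hol r1 r2 (fun w => F w + G w) (fun w => F1 w + G1 w).
Proof.
move=> [[K hK] h] [[L hL] k]; split.
  exists (K + L) => w aw; have [? ?] := hK _ aw; have [? ?] := hL _ aw.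
  by split; rewrite (le_trans (cabsD _ _)) // lerD.
move=> e e0; have e2 : 0 < e / 2 by lra.
have [d1 d10 h1] := h _ e2; have [d2 d20 h2] := k _ e2.
exists (Num.min d1 d2); first by rewrite lt_min d10.
move=> w w' aw aw'; rewrite le_min => /andP[/h1 k1 /h2 k2].
have := k1 aw aw'; have := k2 aw aw'.
set x := F w' - _ - _; set y := G w' - _ - _ => hy hx.
rewrite (_ : _ - _ = x + y); last by rewrite /x /y; ring.
by have := cabsD x y; lra.
Qed.

Lemma holM r1 r2 F F1 G G1 : 1 <= r1 -> hol r1 r2 F F1 -> hol r1 r2 G G1 ->
  hol r1 r2 (fun w => F w * G w) (fun w => F1 w * G w + F w * G1 w).
Proof.
move=> r11 hF hG; have [lF lF0 [dF dF0 lipF]] := hol_lip r11 hF.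
case: hF hG => [[K hK] h] [[L hL] k].
set M := `|K| + `|L| + 1.
have M1 : 1 <= M by rewrite /M; have := normr_ge0 K; have := normr_ge0 L; lra.
have KM : K <= M by rewrite /M; have := ler_norm K; have := normr_ge0 L; lra.
have LM : L <= M by rewrite /M; have := ler_norm L; have := normr_ge0 K; lra.
split.
  exists (2 * (M * M)) => w aw; have [? ?] := hK _ aw; have [? ?] := hL _ aw.
  have M0 : 0 <= M by lra.
  have MM : 0 <= M * M by rewrite mulr_ge0.
  have b (x y : R[i]) : cabs x <= M -> cabs y <= M -> cabs (x * y) <= M * M.
    by move=> ? ?; rewrite cabsM ler_pM ?cabs_ge0.
  have ? := b (F w) (G w); have ? := b (F1 w) (G w); have ? := b (F w) (G1 w).
  by split; [|rewrite (le_trans (cabsD _ _)) //]; lra.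
move=> e e0; have e3 : 0 < e / (3 * M) by rewrite divr_gt0 // mulr_gt0; lra.
have [d1 d10 h1] := h _ e3; have [d2 d20 h2] := k _ e3.
pose d3 := e / (3 * M) / lF.
have d30 : 0 < d3 by rewrite divr_gt0.
exists (Num.min (Num.min d1 d2) (Num.min dF d3)).
  by rewrite !lt_min d10 d20 dF0 d30.
move=> w w' aw aw'; rewrite !le_min => /andP[/andP[c1 c2] /andP[cF c3]].
have k1 := h1 _ _ aw aw' c1; have k2 := h2 _ _ aw aw' c2.
have kF := lipF _ _ aw aw' cF.
have [bFw _] := hK _ aw; have [bFw' _] := hK _ aw'.
have [bGw bG1w] := hL _ aw.
have w1 : 1 <= cabs w by case/andP: aw; lra.
have tle := cabs_divB1_le w' w1.
have D0 := cabs_ge0 (w' - w).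
move: k1 k2; set t := w' / w - 1; set x := F w' - _ - _; set y := G w' - _ - _.
move=> hx hy.
rewrite (_ : _ - _ = F w' * y + (F w' - F w) * (G1 w * t) + x * G w); last first.
  by rewrite /x /y; ring.
have eM : e = 3 * M * (e / (3 * M)).
  by rewrite mulrCA mulfV ?mulr1 //; apply: lt0r_neq0; rewrite mulr_gt0; lra.
have p1 : cabs (F w' * y) <= M * (e / (3 * M) * cabs (w' - w)).
  by rewrite cabsM ler_pM ?cabs_ge0 //; lra.
have p3 : cabs (x * G w) <= (e / (3 * M) * cabs (w' - w)) * M.
  by rewrite cabsM ler_pM ?cabs_ge0 //; lra.
have p2 : cabs ((F w' - F w) * (G1 w * t)) <= e / (3 * M) * (M * cabs (w' - w)).
  rewrite cabsM ler_pM ?cabs_ge0 //.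
    rewrite (le_trans kF) // mulrC -ler_pdivlMr //.
  by rewrite cabsM ler_pM ?cabs_ge0 //; lra.
have := cabsD (F w' * y + (F w' - F w) * (G1 w * t)) (x * G w).
have := cabsD (F w' * y) ((F w' - F w) * (G1 w * t)).
rewrite [in X in _ <= X * cabs (w' - w)]eM => ? ?.
move: (e / (3 * M)) p1 p2 p3 => E p1 p2 p3.
move: (cabs (w' - w)) p1 p2 p3 => D p1 p2 p3; lra.
Qed.

Lemma holZ r1 r2 F F1 z : 1 <= r1 -> hol r1 r2 F F1 ->
  hol r1 r2 (fun w => z * F w) (fun w => z * F1 w).
Proof.
move=> r11 hF; apply: eq_hol (holM r11 (hol_cst r1 r2 z) hF) => // w.
by rewrite mul0r add0r.
Qed.

Lemma holX r1 r2 F F1 n : 1 <= r1 -> hol r1 r2 F F1 ->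
  hol r1 r2 (fun w => F w ^+ n.+1) (fun w => n.+1%:R * F w ^+ n * F1 w).
Proof.
move=> r11 hF; elim: n => [|n IH].
  by apply: eq_hol hF => w; rewrite ?expr0 ?mul1r.
apply: eq_hol (holM r11 hF IH) => w; rewrite ?exprS //.
by rewrite -[n.+2%:R]natr1; ring.
Qed.

Lemma hol_inv r1 r2 : 1 <= r1 -> hol r1 r2 (fun w => w^-1) (fun w => - w^-1).
Proof.
move=> r11; split.
  exists 1 => w aw; have w0 := annulus_neq0 r11 aw; case/andP: aw => aw _.
  by rewrite cabsN cabsV; split; rewrite invf_le1 ?cabs_gt0 //; lra.
move=> e e0; exists e => // w w' aw aw' D.
have w0 := annulus_neq0 r11 aw; have w0' := annulus_neq0 r11 aw'.
rewrite (_ : _ - _ = (w' - w) * (w' - w) * (w^-1 * w^-1 * w'^-1)); last first.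
  by field; rewrite w0 w0'.
rewrite cabsM [cabs ((_ - _) * _)]cabsM.
have v1 u : annulus r1 r2 u -> cabs u^-1 <= 1.
  move=> au; have u0 := annulus_neq0 r11 au; case/andP: au => au _.
  by rewrite cabsV invf_le1 ?cabs_gt0 //; lra.
apply: (@le_trans _ _ (cabs (w' - w) * cabs (w' - w))); last first.
  by rewrite ler_wpM2r ?cabs_ge0.
rewrite ler_piMr ?mulr_ge0 ?cabs_ge0 // !cabsM.
rewrite mulr_ile1 ?mulr_ge0 ?cabs_ge0 ?v1 //.
by rewrite mulr_ile1 ?cabs_ge0 ?v1.
Qed.

End Annulus.

(** * Laurent series in odd powers *)

Section OddLaurentSeries.
Variable R : realType.
Implicit Types (w v : R[i]) (a : nat -> R[i]) (d : nat -> R) (r x : R).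

(** For w != 0 the terms are a j w ^ (1 - 2 j). *)
Definition lterm a w j : R[i] := a j * (w * w^-1 ^+ (2 * j)).
Definition lser a w : R[i] := csum (lterm a w).

Lemma natmul_expr_le x n : 0 <= x -> x <= 1 -> n%:R * x ^+ n * (1 - x) <= 1.
Proof.
move=> x0 x1; apply: (@le_trans _ _ (1 - x ^+ n)); last first.
  by rewrite gerBl exprn_ge0.
elim: n => [|n IH]; first by rewrite mul0r mul0r expr0 subrr.
have xn0 : 0 <= x ^+ n by rewrite exprn_ge0.
have xn1 : x ^+ n <= 1 by rewrite exprn_ile1.
have p : 0 <= x * x ^+ n by rewrite mulr_ge0.
have h1 := ler_wpM2l x0 IH.
have h2 : x * x ^+ n * (1 - x) <= 1 * (1 - x).
  by rewrite ler_wpM2r ?subr_ge0 // mulr_ile1.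
rewrite exprS -natr1; lra.
Qed.

Lemma expr_lip v v' x n : cabs v <= x -> cabs v' <= x ->
  cabs (v' ^+ n.+1 - v ^+ n.+1) <= n.+1%:R * x ^+ n * cabs (v' - v).
Proof.
move=> hv hv'; have x0 := le_trans (cabs_ge0 v) hv.
elim: n => [|n IH]; first by rewrite mul1r expr0 mul1r.
rewrite (_ : _ - _ = v' * (v' ^+ n.+1 - v ^+ n.+1) + v ^+ n.+1 * (v' - v));
  last by rewrite !(exprS _ n.+1); ring.
apply: le_trans (cabsD _ _) _; rewrite !cabsM cabsX.
have h1 := ler_pM (cabs_ge0 _) (cabs_ge0 _) hv' IH.
have h2 : cabs v ^+ n.+1 * cabs (v' - v) <= x ^+ n.+1 * cabs (v' - v).
  by rewrite ler_wpM2r ?cabs_ge0 // lerXn2r ?nnegrE ?cabs_ge0.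
apply: le_trans (lerD h1 h2) _.
by rewrite -[n.+2%:R]natr1 exprS le_eqVlt; apply/orP; left; apply/eqP; ring.
Qed.

Lemma expr_taylor v v' n : cabs v <= 1 -> cabs v' <= 1 ->
  cabs (v' ^+ n.+1 - v ^+ n.+1 - n.+1%:R * v ^+ n * (v' - v)) <=
  n%:R ^+ 2 * cabs (v' - v) ^+ 2.
Proof.
move=> hv hv'; elim: n => [|n IH].
  by rewrite expr0 !expr1 !mul1r subrr cabs0 mulr_ge0 ?exprn_ge0 ?cabs_ge0.
set D := v' - v; set E := (X in cabs X <= _) in IH.
rewrite (_ : _ - _ = n.+1%:R * v ^+ n * (D * D) + v' * E); last first.
  by rewrite /E /D -![n.+2%:R]natr1 !(exprS _ n.+1) (exprS v n); ring.
apply: le_trans (cabsD _ _) _; rewrite !cabsM cabsX cabs_nat.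
have c0 := cabs_ge0 D.
have h1 : n.+1%:R * cabs v ^+ n * (cabs D * cabs D) <= n.+1%:R * (cabs D * cabs D).
  rewrite -mulrA ler_wpM2l // ler_piMl ?mulr_ge0 //.
  by rewrite exprn_ile1 ?cabs_ge0.
have h2 : cabs v' * cabs E <= n%:R ^+ 2 * cabs D ^+ 2.
  by rewrite (le_trans _ IH) // ler_piMl ?cabs_ge0.
apply: le_trans (lerD h1 h2) _; rewrite -expr2 -mulrDl ler_wpM2r ?exprn_ge0 //.
have n0 : 0 <= n%:R :> R by [].
by rewrite -natr1; nra.
Qed.

Section Convergence.
Variables (a : nat -> R[i]) (d : nat -> R) (x : R).
Hypotheses (x0 : 0 < x) (x1 : x <= 1) (sd : summable d).
Hypothesis ad : forall j, cabs ((1 - 2 * j%:R) * a j) * x ^+ (2 * j) <= d j.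

Let d0 j : 0 <= d j.
Proof. by apply: le_trans _ (ad j); rewrite mulr_ge0 ?cabs_ge0 ?exprn_ge0 ?ltW. Qed.

Lemma cabs_odd_ge1 j : 1 <= cabs (1 - 2 * j%:R : R[i]).
Proof.
rewrite (_ : 1 - 2 * j%:R = (1 - 2 * j%:R)%:C); last first.
  by rewrite rmorphB rmorphM !rmorph_nat.
rewrite cabs_real; case: j => [|j]; first by rewrite mulr0 subr0 normr1.
rewrite -natr1 distrC ger0_norm; first by have := ler0n R j; lra.
by have := ler0n R j; lra.
Qed.

Let ad' j : cabs (a j) * x ^+ (2 * j) <= d j.
Proof.
apply: le_trans _ (ad j); rewrite ler_wpM2r ?exprn_ge0 ?(ltW x0) // cabsM.
by rewrite ler_peMl ?cabs_ge0 ?cabs_odd_ge1.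
Qed.

Let dscale_summable r : 0 <= r -> summable (fun j => r * d j).
Proof.
move=> r0; have [A hA] := sd; exists (r * A) => J.
by rewrite -mulr_sumr ler_wpM2l.
Qed.

Lemma lterm_dom_gen b w : (forall j, cabs (b j) * x ^+ (2 * j) <= d j) ->
  x^-1 <= cabs w -> dominated (fun j => cabs w * d j) (lterm b w).
Proof.
move=> bd xw j; rewrite /lterm !cabsM mulrCA ler_wpM2l ?cabs_ge0 //.
apply: le_trans _ (bd j); rewrite ler_wpM2l ?cabs_ge0 //.
rewrite cabsX cabsV lerXn2r ?nnegrE ?invr_ge0 ?cabs_ge0 ?(ltW x0) //.
have w0 : 0 < cabs w by apply: lt_le_trans xw; rewrite invr_gt0.
by rewrite -[leRHS]invrK lef_pV2 // posrE invr_gt0.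
Qed.

Lemma lser_ccvg w : x^-1 <= cabs w -> ccvg (psum (lterm a w)) (lser a w).
Proof.
move=> xw; apply: (psum_ccvg (lterm_dom_gen ad' xw)).
by apply: dscale_summable; apply: cabs_ge0.
Qed.

Lemma lser_deriv_ccvg w : x^-1 <= cabs w ->
  ccvg (psum (lterm (fun j => (1 - 2 * j%:R) * a j) w))
       (lser (fun j => (1 - 2 * j%:R) * a j) w).
Proof.
move=> xw; apply: (psum_ccvg (lterm_dom_gen ad xw)).
by apply: dscale_summable; apply: cabs_ge0.
Qed.

(** One majorant serves every w of a bounded annulus. *)
Lemma lser_unif r2 e : 0 < e -> exists J, forall w, x^-1 <= cabs w -> cabs w <= r2 ->
  cabs (lser a w - psum (lterm a w) J) <= e.
Proof.
move=> e0; have s0 : 0 <= `|r2| by [].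
have dd j : 0 <= `|r2| * d j by rewrite mulr_ge0.
have [J0 h] := csum_tail dd (dscale_summable s0) e0.
exists J0 => w xw wr; apply: h => // j.
apply: le_trans (lterm_dom_gen ad' xw j) _; rewrite ler_wpM2r //.
exact: le_trans wr (ler_norm _).
Qed.

(** The Taylor remainder of one term. Of its two bounds below, the linear one is
    summable and controls the tail of the series; the quadratic one, whose
    constants grow with j, is applied to finitely many terms. *)
Let T w w' j := lterm a w' j - lterm a w j
  - lterm (fun j => (1 - 2 * j%:R) * a j) w j * (w' / w - 1).

Let T0 w w' : w != 0 -> T w w' 0 = 0.
Proof. by move=> w0; rewrite /T /lterm !expr0; field. Qed.

Let TS w w' j : w != 0 -> w' != 0 -> T w w' j.+1 = a j.+1 *
  (w'^-1 ^+ (2 * j).+1 - w^-1 ^+ (2 * j).+1 +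
   (2 * j).+1%:R * w^-1 ^+ (2 * j).+1 * (w' / w - 1)).
Proof.
move=> w0 w0'; rewrite /T /lterm.
have E (u : R[i]) : u != 0 -> u * u^-1 ^+ (2 * j.+1) = u^-1 ^+ (2 * j).+1.
  by move=> u0; rewrite mulnS exprD [in RHS]exprS expr2 !mulrA mulfV // mul1r.
by rewrite !mulrA -!(mulrA _ _ (_ ^+ _)) !E // -!natr1 natrM; ring.
Qed.

Let T_lip w w' j : x^-1 <= cabs w -> x^-1 <= cabs w' ->
  cabs (T w w' j) <= 2 * d j * cabs (w' - w).
Proof.
move=> xw xw'.
have ix1 : 1 <= x^-1 by rewrite invf_ge1.
have w0 : w != 0 by rewrite -cabs_gt0; lra.
have w0' : w' != 0 by rewrite -cabs_gt0; lra.
case: j => [|j]; first by rewrite T0 // cabs0 !mulr_ge0 ?cabs_ge0.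
have ivx (u : R[i]) : x^-1 <= cabs u -> cabs u^-1 <= x.
  move=> xu; rewrite cabsV -[leRHS]invrK lef_pV2 // posrE ?invr_gt0 //.
  by apply: lt_le_trans xu; rewrite invr_gt0.
have D0 := cabs_ge0 (w' - w).
have vD : cabs (w'^-1 - w^-1) <= x ^+ 2 * cabs (w' - w).
  rewrite (_ : _ - _ = w'^-1 * w^-1 * (w - w')); last by field; rewrite w0 w0'.
  rewrite !cabsM [cabs (w - _)]cabs_distC ler_wpM2r //.
  by rewrite expr2 ler_pM ?cabs_ge0 ?ivx.
have tD : cabs (w' / w - 1) <= x * cabs (w' - w).
  by rewrite cabs_divB1 // mulrC ler_wpM2r // -cabsV ivx.
have x0' := ltW x0.
have n0 : 0 <= (2 * j).+1%:R * x ^+ (2 * j) by rewrite mulr_ge0 ?exprn_ge0.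
have h1 := le_trans (expr_lip (2 * j) (ivx _ xw) (ivx _ xw')) (ler_wpM2l n0 vD).
have h2 : cabs ((2 * j).+1%:R * w^-1 ^+ (2 * j).+1 * (w' / w - 1)) <=
    (2 * j).+1%:R * x ^+ (2 * j).+1 * (x * cabs (w' - w)).
  rewrite !cabsM cabs_nat cabsX ler_pM ?mulr_ge0 ?exprn_ge0 ?cabs_ge0 //.
  by rewrite ler_wpM2l // lerXn2r ?nnegrE ?cabs_ge0 ?ivx.
rewrite TS // cabsM.
have h := le_trans (cabsD _ _) (lerD h1 h2).
apply: le_trans (ler_wpM2l (cabs_ge0 _) h) _.
have := ad j.+1; rewrite cabsM mulnS.
rewrite (_ : 1 - 2 * j.+1%:R = - (2 * j).+1%:R :> R[i]); last first.
  by rewrite -!natr1 natrM; ring.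
rewrite cabsN cabs_nat => h3.
have := ler_wpM2r D0 h3; rewrite !(exprS x) /=; lra.
Qed.

Let T_quad w w' j : 1 <= cabs w -> 1 <= cabs w' ->
  cabs (T w w' j) <= cabs (a j) * (2 * j + (2 * j) ^ 2)%:R * cabs (w' - w) ^+ 2.
Proof.
move=> w1 w1'.
have w0 : w != 0 by rewrite -cabs_gt0; lra.
have w0' : w' != 0 by rewrite -cabs_gt0; lra.
case: j => [|j].
  by rewrite T0 // cabs0 !mulr_ge0 ?cabs_ge0 ?exprn_ge0.
have iv (u : R[i]) : 1 <= cabs u -> cabs u^-1 <= 1.
  by move=> u1; rewrite cabsV invf_le1 //; lra.
have D0 := cabs_ge0 (w' - w).
have vD : cabs (w'^-1 - w^-1) <= cabs (w' - w).
  rewrite (_ : _ - _ = w'^-1 * w^-1 * (w - w')); last by field; rewrite w0 w0'.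
  rewrite !cabsM [cabs (w - _)]cabs_distC ler_piMl //.
  by rewrite mulr_ile1 ?cabs_ge0 ?iv.
rewrite TS // cabsM -[leRHS]mulrA ler_wpM2l ?cabs_ge0 //.
have h1 := expr_taylor (2 * j) (iv _ w1) (iv _ w1').
set q := _ - _ in h1.
have n0 : 0 <= (2 * j)%:R :> R by [].
rewrite (_ : _ + _ = q + (2 * j).+1%:R * w^-1 ^+ (2 * j) *
    (w'^-1 * w^-1 * w^-1 * ((w' - w) * (w' - w)))); last first.
  rewrite /q !exprS; set p := w^-1 ^+ (2 * j); set p' := w'^-1 ^+ _.
  by field; rewrite w0 w0'.
have h2 : cabs ((2 * j).+1%:R * w^-1 ^+ (2 * j) *
    (w'^-1 * w^-1 * w^-1 * ((w' - w) * (w' - w)))) <=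
    (2 * j).+1%:R * cabs (w' - w) ^+ 2.
  have bp : cabs (w^-1 ^+ (2 * j)) <= 1.
    by rewrite cabsX exprn_ile1 ?cabs_ge0 ?iv.
  have bV : cabs (w'^-1 * w^-1 * w^-1) <= 1.
    rewrite !cabsM mulr_ile1 ?mulr_ge0 ?cabs_ge0 ?iv //.
    by rewrite mulr_ile1 ?cabs_ge0 ?iv.
  rewrite -mulrA cabsM cabs_nat ler_wpM2l // cabsM.
  rewrite [cabs (_ * (_ * _))]cabsM [cabs ((_ - _) * _)]cabsM -expr2 mulrA.
  rewrite ler_piMl ?exprn_ge0 // mulr_ile1 ?cabs_ge0 //.
have h3 : (2 * j)%:R ^+ 2 * cabs (w'^-1 - w^-1) ^+ 2 <=
    (2 * j)%:R ^+ 2 * cabs (w' - w) ^+ 2.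
  by rewrite ler_wpM2l ?exprn_ge0 // lerXn2r ?nnegrE ?cabs_ge0.
apply: le_trans (cabsD _ _) _.
apply: le_trans (lerD (le_trans h1 h3) h2) _.
rewrite -mulrDl ler_wpM2r ?exprn_ge0 // natrD natrX mulnS natrD -natr1.
by have := n0; nra.
Qed.

Let psumT w w' J : psum (T w w') J = psum (lterm a w') J - psum (lterm a w) J -
  psum (lterm (fun j => (1 - 2 * j%:R) * a j) w) J * (w' / w - 1).
Proof. by rewrite /psum mulr_suml -!sumrB. Qed.

Lemma lser_hol r1 r2 : x^-1 <= r1 ->
  hol r1 r2 (lser a) (lser (fun j => (1 - 2 * j%:R) * a j)).
Proof.
move=> xr1; have [A hA] := sd.
have ix1 : 1 <= x^-1 by rewrite invf_ge1.
have A0 : 0 <= A by have := hA 0%N; rewrite big_ord0.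
split.
  exists (`|r2| * A) => w /andP[r1w wr2].
  have xw : x^-1 <= cabs w by lra.
  have S J : \sum_(j < J) cabs w * d j <= `|r2| * A.
    rewrite -mulr_sumr ler_pM ?cabs_ge0 ?sumr_ge0 //.
    exact: le_trans wr2 (ler_norm _).
  by split; apply: csum_le_sum (lterm_dom_gen _ xw) S.
move=> e e0; have e4 : 0 < e / 4 by lra.
have [J hJ] := summable_tail d0 sd e4.
set K := \sum_(j < J) cabs (a j) * (2 * j + (2 * j) ^ 2)%:R.
have K0 : 0 <= K by apply: sumr_ge0 => *; rewrite mulr_ge0 ?cabs_ge0.
exists (e / 2 / (K + 1)); first by rewrite !divr_gt0 // ltr_wpDl.
move=> w w' /andP[r1w _] /andP[r1w' _] Dd.
have xw : x^-1 <= cabs w by lra.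
have xw' : x^-1 <= cabs w' by lra.
have w1 : 1 <= cabs w by lra.
have w1' : 1 <= cabs w' by lra.
have D0 := cabs_ge0 (w' - w).
have KD : K * cabs (w' - w) <= e / 2.
  have : cabs (w' - w) * (K + 1) <= e / 2 by rewrite -ler_pdivlMr // ltr_wpDl.
  by have := mulr_ge0 K0 D0; nra.
have cT : ccvg (psum (T w w')) (lser a w' - lser a w -
    lser (fun j => (1 - 2 * j%:R) * a j) w * (w' / w - 1)).
  have := ccvgB (ccvgB (lser_ccvg xw') (lser_ccvg xw))
    (ccvgZ (w' / w - 1) (lser_deriv_ccvg xw)).
  rewrite [_ * lser _ _]mulrC; apply: eq_ccvg => J'.
  by rewrite psumT; ring.
apply: (ccvg_le cT) => J'.
have head J1 : (J1 <= J)%N -> cabs (psum (T w w') J1) <= e / 2 * cabs (w' - w).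
  move=> J1J; apply: le_trans (cabs_sum _ _ _) _.
  apply: (@le_trans _ _ (K * cabs (w' - w) ^+ 2)); last first.
    by rewrite expr2 mulrA ler_wpM2r.
  apply: (@le_trans _ _ (\sum_(j < J1) cabs (a j) * (2 * j + (2 * j) ^ 2)%:R
     * cabs (w' - w) ^+ 2)).
    by apply: ler_sum => j _; apply: T_quad.
  rewrite -mulr_suml ler_wpM2r ?exprn_ge0 // /K.
  rewrite -(big_mkord xpredT (fun j => cabs (a j) * (2 * j + (2 * j) ^ 2)%:R)).
  rewrite -(big_mkord xpredT (fun j => cabs (a j) * (2 * j + (2 * j) ^ 2)%:R)).
  rewrite [leRHS](@big_cat_nat _ _ _ J1) //= lerDl sumr_ge0 // => *.
  by rewrite mulr_ge0 ?cabs_ge0.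
have [J'J|JJ'] := leqP J' J.
  by apply: le_trans (head _ J'J) _; rewrite ler_wpM2r //; lra.
have tl : cabs (psum (T w w') J' - psum (T w w') J) <= e / 2 * cabs (w' - w).
  have dm : dominated (fun j => 2 * d j * cabs (w' - w)) (T w w').
    by move=> j; apply: T_lip.
  apply: le_trans (psum_dist dm (ltnW JJ')) _.
  rewrite -mulr_suml -mulr_sumr ler_wpM2r //.
  by have := hJ J J' (leqnn _) (ltnW JJ'); lra.
have := cabs_dist (psum (T w w') J') (psum (T w w') J).
have := head J (leqnn _); lra.
Qed.

End Convergence.

Lemma lterm_conj a w j : (lterm a w j)^* = lterm (fun j => (a j)^*) w^* j.
Proof.
rewrite /lterm; have -> : w^*^-1 = w^-1^* by rewrite fmorphV.
by rewrite -rmorphXn -!rmorphM.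
Qed.

Lemma lterm_odd a w j : lterm a (- w) j = - lterm a w j.
Proof. by rewrite /lterm invrN !exprM sqrrN mulNr mulrN. Qed.

End OddLaurentSeries.

(** * The exterior map of a rectangle *)

Fact map_key : unit. Proof. exact: tt. Qed.

Section ExteriorMap.
Variables (R : realType) (m : R).
Hypotheses (m_gt0 : 0 < m) (m_lt1 : m < 1).
Implicit Types (w : R[i]) (r : R).

(** The point of the unit circle sent to the corner of the rectangle that lies
    in the first quadrant. *)
Definition corner : R[i] := Num.sqrt (1 - m) +i* Num.sqrt m.

(** Taylor coefficients of the product of the two square roots
    sqrt (1 - u z) sqrt (1 - v z), where u and v are the squares of the corner
    and of its conjugate. *)
Definition pcoef : nat -> R[i] :=
  conv (bterm (corner ^+ 2)) (bterm (corner^* ^+ 2)).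

(** Schwarz-Christoffel map for the exterior of a rectangle, and its
    logarithmic derivative; the constants of integration make Psi odd. Both are
    locked because unification must not unfold the series. *)
Definition Psi : R[i] -> R[i] :=
  locked_with map_key (lser (fun j => pcoef j / (1 - 2 * j%:R))).
Definition Psi1 : R[i] -> R[i] := locked_with map_key (lser pcoef).

Lemma PsiE : Psi = lser (fun j => pcoef j / (1 - 2 * j%:R)).
Proof. by rewrite /Psi unlock. Qed.

Lemma Psi1E : Psi1 = lser pcoef.
Proof. by rewrite /Psi1 unlock. Qed.

Lemma sqr_sqrt_m : Num.sqrt m ^+ 2 = m.
Proof. by rewrite sqr_sqrtr ?ltW. Qed.

Lemma sqr_sqrt_1m : Num.sqrt (1 - m) ^+ 2 = 1 - m.
Proof. by rewrite sqr_sqrtr // subr_ge0 ltW. Qed.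

Lemma cabs_corner : cabs corner = 1.
Proof.
apply/eqP; rewrite -sqrp_eq1 ?cabs_ge0 // sqr_cabs /=; apply/eqP.
by rewrite sqr_sqrt_m sqr_sqrt_1m; lra.
Qed.

Lemma corner_sqr_add : corner ^+ 2 + corner^* ^+ 2 = (2 * (1 - 2 * m))%:C.
Proof.
apply: complex_eq; rewrite !expr2 !ReImE /=; last by ring.
by have := sqr_sqrt_m; have := sqr_sqrt_1m; rewrite !expr2; lra.
Qed.

Lemma corner_conj : corner * corner^* = 1.
Proof. by rewrite mulrC -sqr_cabsE cabs_corner expr1n. Qed.

Let pmaj : nat -> R := conv (fun j => `|bcoef R j|) (fun j => `|bcoef R j|).

Let pmaj_sum J : \sum_(j < J) pmaj j <= 4.
Proof.
rewrite sum_conv; apply: (@le_trans _ _ (\sum_(i < J) `|bcoef R i| * 2)).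
  by apply: ler_sum => i _; rewrite ler_wpM2l // sum_norm_bcoef.
by rewrite -mulr_suml; have := sum_norm_bcoef R J; lra.
Qed.

Let pmaj_summable : summable pmaj.
Proof. by exists 4. Qed.

Let corner_sqr1 : cabs (corner ^+ 2) <= 1.
Proof. by rewrite cabsX cabs_corner expr1n. Qed.

Let corner_sqr1' : cabs (corner^* ^+ 2) <= 1.
Proof. by rewrite cabsX cabs_conj cabs_corner expr1n. Qed.

Lemma pcoef_le j : cabs (pcoef j) <= pmaj j.
Proof.
apply: le_trans (cabs_sum _ _ _) _; apply: ler_sum => i _; rewrite cabsM.
by rewrite ler_pM ?cabs_ge0 //; apply: bterm_dominated.
Qed.

Lemma pcoef0 : pcoef 0 = 1.
Proof. by rewrite /pcoef /conv big_ord_recl big_ord0 /bterm !expr0 /= mulr1 addr0 mul1r. Qed.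

Lemma bterm_conj (z : R[i]) n : (bterm z n)^* = bterm z^* n.
Proof. by rewrite /bterm rmorphM rmorphXn /= oppr0. Qed.

Lemma pcoef_conj j : (pcoef j)^* = pcoef j.
Proof.
rewrite /pcoef /conv rmorph_sum [RHS](reindex_inj rev_ord_inj) /=.
apply: eq_bigr => i _; have ij : (i <= j)%N by rewrite -ltnS.
rewrite subSS subKn // [LHS]rmorphM /= !bterm_conj mulrC.
congr (bterm _ _ * bterm _ _); rewrite expr2 [_ ^+ 2]expr2.
  by rewrite [LHS]rmorphM; congr (_ * _); apply: conjcK.
by rewrite [LHS]rmorphM.
Qed.

Lemma odd_neq0 j : (1 - 2 * j%:R : R[i]) != 0.
Proof. by rewrite -cabs_gt0; have := @cabs_odd_ge1 R j; lra. Qed.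

Let psi_coefE j : (1 - 2 * j%:R) * (pcoef j / (1 - 2 * j%:R)) = pcoef j.
Proof. by rewrite mulrC divfK ?odd_neq0. Qed.

Let psi_coef_dom j : cabs ((1 - 2 * j%:R) * (pcoef j / (1 - 2 * j%:R))) *
  1 ^+ (2 * j) <= pmaj j.
Proof. by rewrite psi_coefE expr1n mulr1 pcoef_le. Qed.

Lemma Psi_hol r2 : hol 1 r2 Psi Psi1.
Proof.
rewrite PsiE Psi1E.
have h := lser_hol ltr01 (lexx 1) pmaj_summable psi_coef_dom.
have i1 : 1^-1 <= 1 :> R by rewrite invr1.
apply: eq_hol (h 1 r2 i1) => // w.
by congr (lser _ w); apply/funext => j; rewrite psi_coefE.
Qed.

Lemma Psi1_hol r1 r2 : 1 < r1 -> exists F1, hol r1 r2 Psi1 F1.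
Proof.
rewrite Psi1E => r11; have r10 : 0 < r1 by lra.
set x := r1^-1; have x0 : 0 < x by rewrite invr_gt0.
have x1 : x < 1 by rewrite invf_lt1.
have y0 : 0 < 1 - x by lra.
pose d j := (1 - x)^-1 * pmaj j.
have sd : summable d.
  exists ((1 - x)^-1 * 4) => J; rewrite -mulr_sumr ler_wpM2l ?pmaj_sum //.
  by rewrite invr_ge0 ltW.
have dom j : cabs ((1 - 2 * j%:R) * pcoef j) * x ^+ (2 * j) <= d j.
  rewrite cabsM mulrAC ler_pM ?mulr_ge0 ?cabs_ge0 ?exprn_ge0 ?pcoef_le ?(ltW x0) //.
  rewrite -[leRHS]div1r ler_pdivlMr //.
  case: j => [|j].
    by rewrite mulr0 subr0 cabs1 muln0 expr0; lra.
  apply: le_trans _ (natmul_expr_le (2 * j.+1) (ltW x0) (ltW x1)).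
  rewrite !ler_wpM2r ?exprn_ge0 ?(ltW x0) ?(ltW y0) //.
  rewrite (_ : 1 - 2 * j.+1%:R = - (2 * j).+1%:R :> R[i]); last first.
    by rewrite -!natr1 natrM; ring.
  by rewrite cabsN cabs_nat ler_nat; lia.
have h := lser_hol x0 (ltW x1) sd dom.
exists (lser (fun j => (1 - 2 * j%:R) * pcoef j)); apply: h.
by rewrite /x invrK.
Qed.

Let asym (a : nat -> R[i]) w : (forall j, cabs (a j) <= pmaj j) -> a 0%N = 1 ->
  1 <= cabs w -> ccvg (psum (lterm a w)) (lser a w) -> cabs (lser a w - w) <= 4.
Proof.
move=> ad a0 w1 cv.
have h := ccvgB (ccvgS cv) (ccvg_cst w); apply: (ccvg_le h) => J.
rewrite /psum big_ord_recl {1}/lterm a0 mul1r muln0 expr0 mulr1.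
rewrite [w + _]addrC addrK (le_trans (cabs_sum _ _ _)) //.
have := pmaj_sum J.+1; rewrite big_ord_recl.
have p0 : 0 <= pmaj 0 by apply: le_trans (cabs_ge0 _) (ad 0%N).
suff : \sum_(i < J) cabs (lterm a w (lift ord0 i)) <=
       \sum_(i < J) pmaj (lift ord0 i).
  by move: p0; rewrite [nat_of_ord ord0]/=; lra.
apply: ler_sum => i _; rewrite lift0 /lterm cabsM.
apply: le_trans _ (ad i.+1); rewrite ler_piMr ?cabs_ge0 //.
have w0 : w != 0 by rewrite -cabs_gt0; lra.
rewrite mulnS exprD expr2 !mulrA mulfV // mul1r cabsM cabsX cabsV.
have v1 : (cabs w)^-1 <= 1 by rewrite invf_le1 //; lra.
have v0 : 0 <= (cabs w)^-1 by rewrite invr_ge0 cabs_ge0.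
by rewrite mulr_ile1 ?exprn_ge0 ?exprn_ile1.
Qed.

Lemma Psi1_ccvg w : 1 <= cabs w -> ccvg (psum (lterm pcoef w)) (Psi1 w).
Proof.
rewrite Psi1E.
move=> w1; have w1' : 1^-1 <= cabs w by rewrite invr1.
have h := lser_deriv_ccvg ltr01 pmaj_summable psi_coef_dom w1'.
move: h; rewrite (_ : (fun j : nat => _) = pcoef) //.
by apply/funext => j; rewrite psi_coefE.
Qed.

Lemma Psi_ccvg w : 1 <= cabs w ->
  ccvg (psum (lterm (fun j => pcoef j / (1 - 2 * j%:R)) w)) (Psi w).
Proof.
rewrite PsiE.
move=> w1; have w1' : 1^-1 <= cabs w by rewrite invr1.
exact: lser_ccvg ltr01 pmaj_summable psi_coef_dom _ w1'.
Qed.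

Lemma Psi_asym w : 1 <= cabs w -> cabs (Psi w - w) <= 4.
Proof.
move=> w1; have := Psi_ccvg w1; rewrite PsiE; apply: asym => //.
  move=> j; rewrite cabsM cabsV; apply: le_trans _ (pcoef_le j).
  rewrite ler_piMr ?cabs_ge0 // invf_le1 ?cabs_gt0 ?odd_neq0 //.
  exact: cabs_odd_ge1.
by rewrite pcoef0 mulr0 subr0 divr1.
Qed.

Lemma Psi1_asym w : 1 <= cabs w -> cabs (Psi1 w - w) <= 4.
Proof.
move=> w1; have := Psi1_ccvg w1; rewrite Psi1E.
by apply: asym => //; [apply: pcoef_le|apply: pcoef0].
Qed.

(** This is the Cauchy product that defines pcoef; for |w| >= 1 both arguments
    lie in the closed unit disk. *)
Lemma Psi1_factor w : 1 <= cabs w ->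
  Psi1 w = w * (sqrt1B (corner ^+ 2 * w^-1 ^+ 2) *
                sqrt1B (corner^* ^+ 2 * w^-1 ^+ 2)).
Proof.
move=> w1; set U := w^-1 ^+ 2.
have U1 : cabs U <= 1.
  by rewrite cabsX cabsV exprn_ile1 ?invr_ge0 ?cabs_ge0 // invf_le1; lra.
have z1 : cabs (corner ^+ 2 * U) <= 1.
  by rewrite cabsM mulr_ile1 ?cabs_ge0.
have z1' : cabs (corner^* ^+ 2 * U) <= 1.
  by rewrite cabsM mulr_ile1 ?cabs_ge0.
have h := csum_conv (bterm_dominated z1) (bterm_dominated z1')
  (summable_bcoef R) (summable_bcoef R).
apply: ccvg_unique (Psi1_ccvg w1) _.
apply: eq_ccvg (ccvgZ w h) => J; rewrite -psumZ; apply: eq_bigr => n _.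
rewrite /lterm [RHS]mulrCA; congr (w * _).
rewrite /pcoef /conv exprM -/U mulr_suml; apply: eq_bigr => i _.
have -> : U ^+ n = U ^+ i * U ^+ (n - i) by rewrite -exprD subnKC // -ltnS.
by rewrite /bterm ![(_ * U) ^+ _]exprMn; ring.
Qed.

(** Squaring removes the branches of the roots. The geometry of Psi below rests
    on this identity and on the signs that Psi1_factor provides. *)
Lemma sqr_Psi1 w : 1 <= cabs w ->
  Psi1 w ^+ 2 = w ^+ 2 + w^-1 ^+ 2 - (2 * (1 - 2 * m))%:C.
Proof.
move=> w1; rewrite Psi1_factor // !exprMn.
have w0 : w != 0 by rewrite -cabs_gt0; lra.
have U1 : cabs (w^-1 ^+ 2) <= 1.
  by rewrite cabsX cabsV exprn_ile1 ?invr_ge0 ?cabs_ge0 // invf_le1; lra.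
have z1 : cabs (corner ^+ 2 * w^-1 ^+ 2) <= 1.
  by rewrite cabsM mulr_ile1 ?cabs_ge0.
have z1' : cabs (corner^* ^+ 2 * w^-1 ^+ 2) <= 1.
  by rewrite cabsM mulr_ile1 ?cabs_ge0.
rewrite (sqr_sqrt1B z1) (sqr_sqrt1B z1') -corner_sqr_add.
have c2 : corner ^+ 2 * corner^* ^+ 2 = 1 by rewrite -exprMn corner_conj expr1n.
transitivity (w ^+ 2 - (corner ^+ 2 + corner^* ^+ 2) +
  corner ^+ 2 * corner^* ^+ 2 * w^-1 ^+ 2); last by rewrite c2; ring.
by field.
Qed.

Lemma Psi_conj w : 1 <= cabs w -> Psi w^* = (Psi w)^*.
Proof.
move=> w1; have w1' : 1 <= cabs w^* by rewrite cabs_conj.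
apply: ccvg_unique (Psi_ccvg w1') _.
apply: eq_ccvg (ccvg_conj (Psi_ccvg w1)) => J.
rewrite /psum rmorph_sum; apply: eq_bigr => j _.
rewrite -[LHS]/((lterm _ w j)^*) lterm_conj.
rewrite /lterm; congr (_ * _); rewrite fmorph_div /= pcoef_conj; congr (_ / _).
by rewrite rmorphB rmorphM rmorph1 !rmorph_nat.
Qed.

Lemma Psi1_conj w : 1 <= cabs w -> Psi1 w^* = (Psi1 w)^*.
Proof.
move=> w1; have w1' : 1 <= cabs w^* by rewrite cabs_conj.
apply: ccvg_unique (Psi1_ccvg w1') _.
apply: eq_ccvg (ccvg_conj (Psi1_ccvg w1)) => J.
rewrite /psum rmorph_sum; apply: eq_bigr => j _.
rewrite -[LHS]/((lterm _ w j)^*) lterm_conj.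
by rewrite /lterm pcoef_conj.
Qed.

Lemma Psi_odd w : 1 <= cabs w -> Psi (- w) = - Psi w.
Proof.
move=> w1; have w1' : 1 <= cabs (- w) by rewrite cabsN.
apply: ccvg_unique (Psi_ccvg w1') _; rewrite -[- Psi w]mulN1r.
apply: eq_ccvg (ccvgZ (-1) (Psi_ccvg w1)) => J.
by rewrite mulN1r /psum -sumrN; apply: eq_bigr => j _; rewrite lterm_odd.
Qed.

Lemma Psi1_odd w : 1 <= cabs w -> Psi1 (- w) = - Psi1 w.
Proof.
move=> w1; have w1' : 1 <= cabs (- w) by rewrite cabsN.
apply: ccvg_unique (Psi1_ccvg w1') _; rewrite -[- Psi1 w]mulN1r.
apply: eq_ccvg (ccvgZ (-1) (Psi1_ccvg w1)) => J.
by rewrite mulN1r /psum -sumrN; apply: eq_bigr => j _; rewrite lterm_odd.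
Qed.

(** Reduces Cauchy estimates for powers of Psi to Laurent polynomials, for which
    orthogonality of the powers of w suffices. *)
Lemma Psi_laurent r2 e : 0 < e -> exists D (Q : {poly R[i]}), forall w,
  annulus 1 r2 w -> cabs (Psi w - Q.[w] / w ^+ D) <= e.
Proof.
move=> e0.
have [J hJ] := lser_unif ltr01 pmaj_summable psi_coef_dom r2 e0.
exists (2 * J)%N.
exists (\sum_(j < J) (pcoef j / (1 - 2 * j%:R)) *: 'X^((2 * (J - j)).+1)).
move=> w /andP[w1 wr]; have w0 : w != 0 by rewrite -cabs_gt0; lra.
rewrite PsiE; have := hJ w; rewrite invr1 => /(_ w1 wr); congr (cabs (_ - _) <= _).
rewrite horner_sum mulr_suml; apply: eq_bigr => j _.
rewrite hornerZ hornerXn /lterm -[RHS]mulrA; congr (_ * _).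
have jJ : (2 * J = 2 * (J - j) + 2 * j)%N by rewrite -mulnDr subnK // ltnW.
rewrite jJ exprS exprD exprVn.
have A0 : w ^+ (2 * (J - j)) != 0 by rewrite expf_neq0.
have B0 : w ^+ (2 * j) != 0 by rewrite expf_neq0.
move: (w ^+ (2 * (J - j))) (w ^+ (2 * j)) A0 B0 => x y x0 y0.
by field; rewrite x0 y0.
Qed.

End ExteriorMap.

(** * Paths in an annulus *)

Section RealCalculus.
Variable R : realType.
Implicit Types (f g : R -> R) (a b t s : R).

(** Derivative with an explicit remainder, the form in which it composes with
    hol. *)
Definition diff_at f t L := forall e : R, 0 < e -> exists2 d : R, 0 < d &
  forall s, `|s - t| <= d -> `|f s - f t - (s - t) * L| <= e * `|s - t|.

Lemma is_derive_diff_at f t L : is_derive t 1 f L -> diff_at f t L.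
Proof.
move=> fL e e0.
have : (h^-1 *: ((f \o shift t) (h *: 1) - f t)) @[h --> 0^'] --> L.
  by rewrite -(@derive_val _ _ _ _ _ _ _ fL); apply: (@ex_derive _ _ _ _ _ _ _ fL).
move=> /cvgrPdist_le/(_ e e0); rewrite near_withinE.
move=> /nbhs_ballP[d /= d0 hd]; exists (d / 2); first by rewrite divr_gt0.
move=> s sd; have [->|st] := eqVneq s t.
  by rewrite !subrr mul0r subr0 normr0 mulr0.
have st0 : s - t != 0 by rewrite subr_eq0.
have := hd (s - t).
rewrite /ball /= sub0r normrN st0 => /(_ _ isT).
have -> : (s - t) *: 1 + t = s by rewrite /GRing.scale /= mulr1 subrK.
move=> h; have {h} : `|L - (s - t)^-1 * (f s - f t)| <= e by apply: h; lra.
have -> : f s - f t - (s - t) * L =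
  - ((L - (s - t)^-1 * (f s - f t)) * (s - t)) by field.
by rewrite normrN normrM => h; rewrite ler_wpM2r.
Qed.

Lemma diff_at_is_derive f t L : diff_at f t L -> is_derive t 1 f L.
Proof.
move=> h.
have c : (h^-1 *: ((f \o shift t) (h *: 1) - f t)) @[h --> 0^'] --> L.
  apply/cvgrPdist_le => e e0; have [d d0 hd] := h e e0.
  rewrite near_withinE; apply/nbhs_ballP; exists d => //= x.
  rewrite /ball /= sub0r normrN => xd x0.
  have := hd (x + t); rewrite addrK => /(_ (ltW xd)).
  have -> : x *: 1 = x by rewrite /GRing.scale /= mulr1.
  have -> : L - x^-1 *: (f (x + t) - f t) =
      - ((f (x + t) - f t - x * L) * x^-1).
    by rewrite /GRing.scale /=; field.
  by rewrite normrN normrM normfV ler_pdivrMr ?normr_gt0.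
split; first by apply/cvg_ex; exists L.
exact: (cvg_lim (@Rhausdorff R) c).
Qed.

Definition cont_in f a b := forall t, a <= t <= b -> forall e : R, 0 < e ->
  exists2 d : R, 0 < d & forall s, a <= s <= b -> `|s - t| <= d ->
  `|f s - f t| <= e.

Lemma cont_in_within f a b : cont_in f a b -> {within `[a, b], continuous f}.
Proof.
move=> h; apply/subspace_continuousP => t tab.
apply/cvgrPdist_le => e e0; rewrite near_withinE.
have tab' : a <= t <= b by move: tab; rewrite /= in_itv.
have [d d0 hd] := h t tab' e e0.
apply/nbhs_ballP; exists d => //= s; rewrite /ball /= => ts sab.
rewrite distrC; apply: hd; last by rewrite distrC ltW.
by move: sab; rewrite /= in_itv.
Qed.

Lemma continuous_cont_in f a b : continuous f -> cont_in f a b.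
Proof.
move=> fc t _ e e0; have /cvgrPdist_le/(_ e e0) := fc t.
move=> /nbhs_ballP[d /= d0 hd]; exists (d / 2); first by rewrite divr_gt0.
move=> s _ st; rewrite distrC; apply: hd; rewrite /ball /= distrC.
by apply: le_lt_trans st _; lra.
Qed.

Lemma cont_inB f g a b : cont_in f a b -> cont_in g a b ->
  cont_in (fun t => f t - g t) a b.
Proof.
move=> hf hg t tb e e0; have e2 : 0 < e / 2 by lra.
have [d1 d10 h] := hf t tb _ e2; have [d2 d20 h'] := hg t tb _ e2.
exists (Num.min d1 d2); first by rewrite lt_min d10.
move=> s sb; rewrite le_min => /andP[/(h _ sb) k1 /(h' _ sb) k2].
by move: k1 k2; rewrite !ler_norml; lra.
Qed.

Lemma diff_atB f g t x y : diff_at f t x -> diff_at g t y ->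
  diff_at (fun t => f t - g t) t (x - y).
Proof.
move=> hf hg e e0; have e2 : 0 < e / 2 by lra.
have [d1 d10 h] := hf _ e2; have [d2 d20 h'] := hg _ e2.
exists (Num.min d1 d2); first by rewrite lt_min d10.
move=> s; rewrite le_min => /andP[/h k1 /h' k2].
have -> : f s - g s - (f t - g t) - (s - t) * (x - y) =
  (f s - f t - (s - t) * x) - (g s - g t - (s - t) * y) by ring.
by apply: le_trans (ler_normB _ _) _; lra.
Qed.

Lemma diff_ndecr f a b : cont_in f a b ->
  (forall t, a < t < b -> exists2 L, 0 <= L & diff_at f t L) ->
  forall x y, a <= x -> x <= y -> y <= b -> f x <= f y.
Proof.
move=> fc fd; apply: ger0_derive1_ndecr; last exact: cont_in_within.
  move=> t; rewrite in_itv /= => /fd[L _ /diff_at_is_derive].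
  exact: (@ex_derive _ _ _ _ _ _ _).
move=> t; rewrite in_itv /= => /fd[L L0 /diff_at_is_derive fL].
by rewrite derive1E (@derive_val _ _ _ _ _ _ _ fL).
Qed.

Lemma diff0_eq f a b : a <= b -> cont_in f a b ->
  (forall t, a < t < b -> diff_at f t 0) -> f a = f b.
Proof.
move=> ab fc fd; apply/eqP; rewrite eq_le; apply/andP; split.
  apply: (diff_ndecr fc _ (lexx _) ab (lexx _)) => t /fd tf.
  by exists 0.
rewrite -lerN2.
apply: (@diff_ndecr (fun t => - f t) a b _ _ _ _ (lexx _) ab (lexx _)).
  move=> t tab e e0; have [d d0 hd] := fc t tab e e0.
  by exists d => // s sab sd; rewrite -opprD normrN; apply: hd.
move=> t /fd tf; exists 0 => // e /tf[d d0 hd]; exists d => // s /hd.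
by rewrite -normrN; congr (`|_| <= _); ring.
Qed.

Lemma diff_FTC f g a b : a < b -> {within `[a, b], continuous g} ->
  cont_in f a b -> (forall t, a < t < b -> diff_at f t (g t)) ->
  \int[@lebesgue_measure R]_(x in `[a, b]) g x = f b - f a.
Proof.
move=> ab gc /cont_in_within fc fd.
have [_ fa fb] := (continuous_within_itvP f ab).1 fc.
rewrite /Rintegral (@continuous_FTC2 _ g f) //.
  split=> // t; rewrite in_itv /= => /fd/diff_at_is_derive.
  exact: (@ex_derive _ _ _ _ _ _ _).
move=> t; rewrite in_itv /= => /fd/diff_at_is_derive fL.
by rewrite derive1E (@derive_val _ _ _ _ _ _ _ fL).
Qed.

Section Path.
Variables (r1 r2 : R) (F F1 : R[i] -> R[i]).
Hypotheses (r11 : 1 <= r1) (hF : hol r1 r2 F F1).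
Implicit Types (z : R[i]).

(** A real linear functional: z = 1 and z = - 'i give the two coordinates, and
    the conjugate of a normal vector gives the support function. *)
Definition rpart z (w : R[i]) : R := complex.Re (z * w).

Lemma rpart_le z w : `|rpart z w| <= cabs z * cabs w.
Proof. by rewrite -cabsM Re_le_cabs. Qed.

Lemma rpartB z w w' : rpart z (w - w') = rpart z w - rpart z w'.
Proof. by rewrite /rpart mulrBr ReD ReN. Qed.

Lemma rpartZ z w (c : R) : rpart z (c%:C * w) = c * rpart z w.
Proof. by rewrite /rpart !ReImE /=; ring. Qed.

Definition cpath (p1 p2 : R -> R) t : R[i] := p1 t +i* p2 t.

Lemma cpath_cont p1 p2 a b z : cont_in p1 a b -> cont_in p2 a b ->
  (forall t, a <= t <= b -> annulus r1 r2 (cpath p1 p2 t)) ->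
  cont_in (fun t => rpart z (F (cpath p1 p2 t))) a b.
Proof.
move=> c1 c2 ann t tab e e0.
have [K K0 [d d0 hd]] := hol_lip r11 hF.
pose e' := Num.min (d / 2) (e / (2 * K * (cabs z + 1))).
have z0 := cabs_ge0 z.
have e'0 : 0 < e'.
  by rewrite lt_min !divr_gt0 // !mulr_gt0 // ltr_wpDl.
have [d1 d10 h1] := c1 t tab e' e'0; have [d2 d20 h2] := c2 t tab e' e'0.
exists (Num.min d1 d2); first by rewrite lt_min d10.
move=> s sab; rewrite le_min => /andP[/(h1 _ sab) k1 /(h2 _ sab) k2].
have D : cabs (cpath p1 p2 s - cpath p1 p2 t) <= 2 * e'.
  by apply: le_trans (cabs_le _) _; rewrite !ReImE /=; lra.
have e'd : e' <= d / 2 by rewrite /e' ge_min lexx.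
have e'e : e' <= e / (2 * K * (cabs z + 1)) by rewrite /e' ge_min lexx orbT.
have Dd : cabs (cpath p1 p2 s - cpath p1 p2 t) <= d by lra.
have := hd _ _ (ann t tab) (ann s sab) Dd.
set X := cabs (F _ - F _) => hX.
rewrite -rpartB; apply: le_trans (rpart_le _ _) _; rewrite -/X.
have hX' : X <= K * (2 * e') by apply: le_trans hX _; rewrite ler_wpM2l // ltW.
have X0 : 0 <= X by apply: cabs_ge0.
have m0 : 0 < 2 * K * (cabs z + 1) by rewrite !mulr_gt0 // ltr_wpDl.
have : e' * (2 * K * (cabs z + 1)) <= e by rewrite -ler_pdivlMr.
have : (cabs z + 1) * X <= (cabs z + 1) * (K * (2 * e')).
  by rewrite ler_wpM2l // addr_ge0.
by lra.
Qed.

(** Chain rule; since F1 is a logarithmic derivative, the velocity of the path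
    enters divided by the position. *)
Lemma cpath_diff p1 p2 t z L1 L2 : diff_at p1 t L1 -> diff_at p2 t L2 ->
  (exists2 d, 0 < d & forall s, `|s - t| <= d -> annulus r1 r2 (cpath p1 p2 s)) ->
  diff_at (fun s => rpart z (F (cpath p1 p2 s))) t
    (rpart z (F1 (cpath p1 p2 t) * ((L1 +i* L2) / cpath p1 p2 t))).
Proof.
move=> D1 D2 [d3 d30 ann] e e0.
have annt : annulus r1 r2 (cpath p1 p2 t) by apply: ann; rewrite subrr normr0 ltW.
set w := cpath p1 p2 t; set L := L1 +i* L2.
have w1 : 1 <= cabs w by have /andP[h _] := annt; apply: le_trans r11 h.
have w0 : w != 0 by rewrite -cabs_gt0; lra.
pose B := cabs L + 1; have B1 : 1 <= B by rewrite /B; have := cabs_ge0 L; lra.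
pose Z := cabs z + 1; have Z1 : 1 <= Z by rewrite /Z; have := cabs_ge0 z; lra.
pose M := cabs (F1 w) + 1; have M1 : 1 <= M by rewrite /M; have := cabs_ge0 (F1 w); lra.
pose e1 := e / (2 * Z * B).
have e10 : 0 < e1 by rewrite divr_gt0 // !mulr_gt0 //; lra.
pose e2 := Num.min (2^-1) (e / (4 * Z * M)).
have e20 : 0 < e2 by rewrite lt_min invr_gt0 divr_gt0 // ?mulr_gt0 //; lra.
case: hF => _ /(_ e1 e10)[d0 d00 h0].
have [d1 d10 h1] := D1 e2 e20; have [d2 d20 h2] := D2 e2 e20.
exists (Num.min (Num.min d1 d2) (Num.min d3 (d0 / (2 * B)))).
  by rewrite !lt_min d10 d20 d30 divr_gt0 // mulr_gt0 //; lra.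
move=> s; rewrite !le_min => /andP[/andP[/h1 k1 /h2 k2] /andP[/ann anns sd]].
set w' := cpath p1 p2 s in anns *.
set x := `|s - t| in k1 k2 sd *; have x0 : 0 <= x by apply: normr_ge0.
have q : cabs (w' - w - (s - t)%:C * L) <= 2 * e2 * x.
  apply: le_trans (cabs_le _) _; rewrite !ReImE /=.
  rewrite !mul0r subr0 addr0; lra.
have e2h : e2 <= 2^-1 by rewrite /e2 ge_min lexx.
have ww : cabs (w' - w) <= B * x.
  have := cabs_dist (w' - w) ((s - t)%:C * L).
  rewrite cabsM cabs_real -/x /B => h.
  have : 2 * e2 * x <= 1 * x by rewrite ler_wpM2r //; lra.
  lra.
have wd : cabs (w' - w) <= d0.
  apply: le_trans ww _; have : x * (2 * B) <= d0.
    by rewrite -ler_pdivlMr // mulr_gt0 //; lra.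
  by have := mulr_ge0 (_ : 0 <= B) x0; lra.
have k := h0 _ _ annt anns wd; rewrite -/w -/w' in k.
have -> : rpart z (F w') - rpart z (F w) - (s - t) * rpart z (F1 w * (L / w)) =
  rpart z ((F w' - F w - F1 w * (w' / w - 1)) +
           F1 w * ((w' - w - (s - t)%:C * L) / w)).
  rewrite -rpartZ -!rpartB; congr (rpart z _); by field.
apply: le_trans (rpart_le _ _) _.
have b1 : cabs (F w' - F w - F1 w * (w' / w - 1)) <= e1 * (B * x).
  by apply: le_trans k _; rewrite ler_wpM2l // ltW.
have b2 : cabs (F1 w * ((w' - w - (s - t)%:C * L) / w)) <= M * (2 * e2 * x).
  rewrite !cabsM cabsV ler_pM ?cabs_ge0 ?mulr_ge0 ?invr_ge0 ?cabs_ge0 //.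
    by rewrite /M lerDl.
  apply: le_trans _ q; rewrite ler_piMr ?cabs_ge0 // invf_le1 //; lra.
have b := le_trans (cabsD _ _) (lerD b1 b2).
apply: (@le_trans _ _ (Z * (e1 * (B * x) + M * (2 * e2 * x)))).
  by rewrite ler_pM ?cabs_ge0 // /Z lerDl.
have E1 : e1 * (2 * Z * B) = e.
  by rewrite /e1 divfK //; apply: lt0r_neq0; rewrite !mulr_gt0 //; lra.
have E2 : e2 * (4 * Z * M) <= e.
  by rewrite -ler_pdivlMr ?ge_min ?lexx ?orbT // !mulr_gt0 //; lra.
have := ler_wpM2r x0 E2.
have -> : Z * (e1 * (B * x) + M * (2 * e2 * x)) =
  2^-1 * (e1 * (2 * Z * B) * x + e2 * (4 * Z * M) * x) by field.
rewrite E1.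
by lra.
Qed.

End Path.

End RealCalculus.

(** * Normals of the level curves *)

Section Normals.
Variables (R : realType) (m : R).
Hypotheses (m_gt0 : 0 < m) (m_lt1 : m < 1).
Implicit Types (w z : R[i]).

Definition quad1 z := 0 <= complex.Re z /\ 0 <= complex.Im z.

Lemma Re_inv z : complex.Re z^-1 = complex.Re z / cabs z ^+ 2.
Proof. by rewrite sqr_cabs; case: z. Qed.

Lemma Im_inv z : complex.Im z^-1 = - complex.Im z / cabs z ^+ 2.
Proof. by rewrite sqr_cabs; case: z => a b /=; rewrite mulNr. Qed.

Lemma sqr_Psi1_Re w : 1 <= cabs w -> complex.Re (Psi1 m w ^+ 2) =
  (complex.Re w ^+ 2 - complex.Im w ^+ 2) * (1 + (cabs w ^+ 4)^-1) - 2 * (1 - 2 * m).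
Proof.
move=> w1; rewrite sqr_Psi1 // !expr2 !ReImE /= Re_inv Im_inv.
have c0 : cabs w != 0 by apply: lt0r_neq0; lra.
by rewrite -[cabs w ^+ 4]/(cabs w ^+ (2 * 2)) exprM; field.
Qed.

Lemma sqr_Psi1_Im w : 1 <= cabs w -> complex.Im (Psi1 m w ^+ 2) =
  2 * complex.Re w * complex.Im w * (1 - (cabs w ^+ 4)^-1).
Proof.
move=> w1; rewrite sqr_Psi1 // !expr2 !ReImE /= Re_inv Im_inv.
have c0 : cabs w != 0 by apply: lt0r_neq0; lra.
by rewrite -[cabs w ^+ 4]/(cabs w ^+ (2 * 2)) exprM; field.
Qed.

Lemma inv_pow4_le1 w : 1 <= cabs w -> (cabs w ^+ 4)^-1 <= 1.
Proof.
move=> w1; rewrite invf_le1 ?exprn_ege1 // exprn_gt0 //; lra.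
Qed.

Let right_mul (x y : R[i]) : x = 0 \/ `|complex.Im x| < complex.Re x ->
  y = 0 \/ `|complex.Im y| < complex.Re y -> x * y = 0 \/ 0 < complex.Re (x * y).
Proof.
move=> [->|hx]; first by left; rewrite mul0r.
move=> [->|hy]; [by left; rewrite mulr0|right].
rewrite ReM subr_gt0; apply: le_lt_trans (ler_norm _) _.
by rewrite normrM; apply: ltr_pM.
Qed.

(** The square of Psi1 w lies in the upper half plane, which leaves two opposite
    quadrants; the factorization of Psi1 excludes one of them. *)
Lemma Psi1_quad1 w : 1 <= cabs w -> quad1 w -> quad1 (Psi1 m w).
Proof.
move=> w1 [x0 y0].
have c0 : 0 < cabs w by lra.
have U1 : cabs (w^-1 ^+ 2) <= 1.
  by rewrite cabsX cabsV exprn_ile1 ?invr_ge0 ?cabs_ge0 // invf_le1.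
have z1 u : cabs u = 1 -> cabs (u ^+ 2 * w^-1 ^+ 2) <= 1.
  by move=> u1; rewrite cabsM mulr_ile1 ?cabs_ge0 // cabsX u1 expr1n.
have k1 := cabs_corner m_gt0 m_lt1.
have k2 : cabs (corner m)^* = 1 by rewrite cabs_conj.
have := right_mul (Re_sqrt1B_gt (z1 _ k1)) (Re_sqrt1B_gt (z1 _ k2)).
have := Psi1_factor m_gt0 m_lt1 w1; set Q := _ * sqrt1B _ => NE [Q0|Q0].
  by rewrite NE Q0 mulr0.
clearbody Q.
have IM : 0 <= complex.Re (Psi1 m w) * complex.Im (Psi1 m w).
  have := sqr_Psi1_Im w1; rewrite expr2 ImM => h.
  have := inv_pow4_le1 w1; have := mulr_ge0 x0 y0.
  set t := _^-1 in h * => xy t1.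
  have : 0 <= 2 * (complex.Re w * complex.Im w) * (1 - t).
    by rewrite !mulr_ge0 //; lra.
  lra.
have QE : complex.Re Q * cabs w ^+ 2 =
    complex.Re (Psi1 m w) * complex.Re w + complex.Im (Psi1 m w) * complex.Im w.
  by rewrite NE sqr_cabs !ReImE; ring.
have : 0 < complex.Re Q * cabs w ^+ 2 by rewrite mulr_gt0 ?exprn_gt0.
rewrite QE /quad1; move: (complex.Re _) (complex.Im _) IM => X Y IM h.
have [Xn|Xp] := ltP X 0.
  have Y0 : Y <= 0 by move: IM; rewrite nmulr_rge0.
  by have := mulr_ge0 (_ : 0 <= - X) x0; have := mulr_ge0 (_ : 0 <= - Y) y0; lra.
have [Yn|//] := ltP Y 0.
have X0 : X <= 0 by move: IM; rewrite nmulr_lge0.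
by have := mulr_ge0 (_ : 0 <= - X) x0; have := mulr_ge0 (_ : 0 <= - Y) y0; lra.
Qed.

Lemma Psi1_neq0 w : 1 < cabs w -> Psi1 m w != 0.
Proof.
move=> w1; apply/eqP => N0.
have c0 : 0 < cabs w by lra.
have := sqr_Psi1_Im (ltW w1); have := sqr_Psi1_Re (ltW w1).
rewrite N0 expr0n /=.
have t0 : 0 < (cabs w ^+ 4)^-1 by rewrite invr_gt0 exprn_gt0.
have t1 : (cabs w ^+ 4)^-1 < 1.
  by rewrite invf_lt1 ?exprn_gt0 // exprn_egt1.
have tE : (cabs w ^+ 4)^-1 * cabs w ^+ 4 = 1 by rewrite mulVf // expf_neq0 // lt0r_neq0.
have := sqr_cabs w; have c2 : 1 < cabs w ^+ 2 by rewrite exprn_egt1.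
rewrite -[cabs w ^+ 4]/(cabs w ^+ (2 * 2)) exprM in t0 t1 tE *.
move: (cabs w ^+ 2) c2 tE t0 t1 => s s1 tE t0 t1 sE /esym hR /esym hI.
set t := (s ^+ 2)^-1 in tE t0 t1 hR hI.
clearbody t.
have xy : complex.Re w * complex.Im w = 0.
  apply/eqP; rewrite -(mulIr_eq0 _ (@mulIf _ (2 * (1 - t)) _)).
    by apply/eqP; lra.
  by apply: lt0r_neq0; lra.
have s0 : 0 < s by lra.
have us : s * t * s = 1 by rewrite mulrAC -expr2 mulrC.
have q : 2 < s + s * t.
  have u0 : 0 < s * t by rewrite mulr_gt0.
  have : 0 < (s - 1) * (s - 1) * (s * t) by rewrite !mulr_gt0 ?subr_gt0.
  have -> : (s - 1) * (s - 1) * (s * t) = s * (s * t * s) - 2 * (s * t * s) + s * t.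
    by ring.
  by rewrite us; lra.
move/eqP: xy; rewrite mulf_eq0 => /orP[] /eqP z0; rewrite z0 expr0n /= in sE hR.
  have y2 : complex.Im w ^+ 2 = s by lra.
  by rewrite y2 in hR; have := m_lt1; lra.
have x2 : complex.Re w ^+ 2 = s by lra.
by rewrite x2 in hR; have := m_gt0; lra.
Qed.

(** For a = Psi1 w, the identity for the square of Psi1 makes
    Re (conj a1 a2) Im (conj a1 a2) a nonnegative combination of products of
    coordinates times Im (conj w1 w2), and the real factor is nonnegative in the
    first quadrant. When it vanishes, a1 and a2 lie on different axes, and the
    order of w1 and w2 decides which. *)
Let arg_aux (x1 y1 x2 y2 a1 b1 a2 b2 s t : R) :
  0 <= x1 -> 0 <= y1 -> 0 <= x2 -> 0 <= y2 ->
  0 <= a1 -> 0 <= b1 -> 0 <= a2 -> 0 <= b2 ->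
  1 < s -> 0 < t -> t < 1 -> s * t * s = 1 ->
  x1 ^+ 2 + y1 ^+ 2 = s -> x2 ^+ 2 + y2 ^+ 2 = s ->
  a1 ^+ 2 - b1 ^+ 2 = (x1 ^+ 2 - y1 ^+ 2) * (1 + t) - 2 * (1 - 2 * m) ->
  a2 ^+ 2 - b2 ^+ 2 = (x2 ^+ 2 - y2 ^+ 2) * (1 + t) - 2 * (1 - 2 * m) ->
  2 * a1 * b1 = 2 * x1 * y1 * (1 - t) -> 2 * a2 * b2 = 2 * x2 * y2 * (1 - t) ->
  0 <= x1 * y2 - y1 * x2 -> 0 <= a1 * b2 - b1 * a2.
Proof.
move=> x10 y10 x20 y20 a10 b10 a20 b20 s1 t0 t1 sts S1 S2 R1 R2 I1 I2 D0.
have m0 := m_gt0; have m1 := m_lt1.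
have s0 : 0 < s by lra.
have st2 : 2 < s + s * t.
  have u0 : 0 < s * t by rewrite mulr_gt0.
  have : 0 < (s - 1) * (s - 1) * (s * t) by rewrite !(mulr_gt0, subr_gt0).
  have -> : (s - 1) * (s - 1) * (s * t) = s * (s * t * s) - 2 * (s * t * s) + s * t.
    by ring.
  by rewrite sts; lra.
have key : 0 <= (a1 * a2 + b1 * b2) * (a1 * b2 - b1 * a2).
  have p0 : 0 <= x1 * x2 by rewrite mulr_ge0.
  have q0 : 0 <= y1 * y2 by rewrite mulr_ge0.
  have br : 0 <= x1 * x2 * (s + s * t - 2 * (1 - 2 * m)) +
                 y1 * y2 * (s + s * t + 2 * (1 - 2 * m)).
    by rewrite addr_ge0 // mulr_ge0 //; lra.
  have t10 : 0 <= 1 - t by lra.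
  have := mulr_ge0 (mulr_ge0 t10 D0) br.
  have -> : (1 - t) * (x1 * y2 - y1 * x2) *
      (x1 * x2 * (s + s * t - 2 * (1 - 2 * m)) +
       y1 * y2 * (s + s * t + 2 * (1 - 2 * m))) =
      s * ((a1 * a2 + b1 * b2) * (a1 * b2 - b1 * a2)).
    transitivity (s / 2 * ((a1 ^+ 2 - b1 ^+ 2) * (2 * a2 * b2) -
                       (2 * a1 * b1) * (a2 ^+ 2 - b2 ^+ 2))); last by field.
    rewrite R1 R2 I1 I2.
    transitivity ((1 - t) * (s * (1 + t) * (x1 * x2 + y1 * y2) *
        (x1 * y2 - y1 * x2) - 2 * (1 - 2 * m) *
        (x2 * y2 * (x1 ^+ 2 + y1 ^+ 2) - x1 * y1 * (x2 ^+ 2 + y2 ^+ 2)))).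
      by ring.
    by rewrite S1 S2; field.
  by rewrite pmulr_rge0.
have ab : 0 <= a1 * b2 by rewrite mulr_ge0.
have p1 : 0 <= a1 * a2 by rewrite mulr_ge0.
have p2 : 0 <= b1 * b2 by rewrite mulr_ge0.
have [T0|T0] := ltP 0 (a1 * a2 + b1 * b2); first by rewrite pmulr_rge0 // in key.
have /eqP : a1 * a2 = 0 by lra.
have /eqP : b1 * b2 = 0 by lra.
rewrite !mulf_eq0.
case/orP => /eqP z1; first by rewrite z1 mul0r subr0.
case/orP => /eqP z2; last by rewrite z2 mulr0 subr0.
have [b1z|b1z] := eqVneq b1 0; first by rewrite b1z mul0r subr0.
have [a2z|a2z] := eqVneq a2 0; first by rewrite a2z mulr0 subr0.
exfalso; rewrite z1 z2 in R1 R2 I1.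
have b1p : 0 < b1 ^+ 2 by rewrite exprn_gt0 // lt_neqAle eq_sym b1z.
have a2p : 0 < a2 ^+ 2 by rewrite exprn_gt0 // lt_neqAle eq_sym a2z.
rewrite expr0n /= in R1 R2.
have : x1 * y1 * (1 - t) = 0 by lra.
move/eqP; rewrite mulf_eq0 (_ : (1 - t == 0) = false) ?orbF; last first.
  by apply/eqP; lra.
rewrite mulf_eq0 => /orP[] /eqP z; last first.
  have x2s : x1 ^+ 2 = s by rewrite z expr0n /= in S1; lra.
  by rewrite x2s z expr0n /= in R1; lra.
have y2s : y1 ^+ 2 = s by rewrite z expr0n /= in S1; lra.
have y1p : 0 < y1.
  rewrite lt_neqAle y10 andbT eq_sym; apply/eqP => y1z.
  by rewrite y1z expr0n /= in y2s; lra.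
have x2z : x2 = 0.
  apply/eqP; rewrite eq_le x20 andbT -(pmulr_rle0 _ y1p).
  by rewrite z mul0r in D0; lra.
have y22s : y2 ^+ 2 = s by rewrite x2z expr0n /= in S2; lra.
by rewrite y2s z expr0n /= in R1; rewrite y22s x2z expr0n /= in R2; lra.
Qed.

(** Psi1 is the direction of the normal of a level curve, so this is convexity
    of the level curves within a quadrant. *)
Lemma Psi1_arg w1 w2 : 1 < cabs w1 -> cabs w1 = cabs w2 -> quad1 w1 -> quad1 w2 ->
  0 <= complex.Im (w1^* * w2) -> 0 <= complex.Im ((Psi1 m w1)^* * Psi1 m w2).
Proof.
move=> g1 e12 q1 q2 hI.
have g2 : 1 < cabs w2 by rewrite -e12.
have [n1x n1y] := Psi1_quad1 (ltW g1) q1.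
have [n2x n2y] := Psi1_quad1 (ltW g2) q2.
have R1 := sqr_Psi1_Re (ltW g1); have I1 := sqr_Psi1_Im (ltW g1).
have R2 := sqr_Psi1_Re (ltW g2); have I2 := sqr_Psi1_Im (ltW g2).
have s1 := sqr_cabs w1; have s2 := sqr_cabs w2.
rewrite -e12 in R2 I2 s2.
case: q1 => x1 y1; case: q2 => x2 y2.
have c0 : 0 < cabs w1 by exact: lt_trans ltr01 g1.
have t0 : 0 < (cabs w1 ^+ 4)^-1 by rewrite invr_gt0 exprn_gt0.
have t1 : (cabs w1 ^+ 4)^-1 < 1.
  by rewrite invf_lt1 ?exprn_gt0 ?exprn_egt1.
have tE : cabs w1 ^+ 2 * (cabs w1 ^+ 4)^-1 * cabs w1 ^+ 2 = 1.
  by rewrite mulrAC -exprD mulfV // expf_neq0 // lt0r_neq0.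
have c2 : 1 < cabs w1 ^+ 2 by rewrite exprn_egt1.
rewrite expr2 ReM -!expr2 in R1; rewrite expr2 ReM -!expr2 in R2.
rewrite expr2 ImM in I1; rewrite expr2 ImM in I2.
rewrite Im_conjM; rewrite Im_conjM in hI.
apply: arg_aux x1 y1 x2 y2 n1x n1y n2x n2y c2 t0 t1 tE _ _ R1 R2 _ _ hI => //.
  by rewrite -I1; ring.
by rewrite -I2; ring.
Qed.

End Normals.

(** * The map sends circles around the rectangle *)

Section Support.
Variables (R : realType) (m : R).
Hypotheses (m_gt0 : 0 < m) (m_lt1 : m < 1).
Implicit Types (w z M h : R[i]) (r t : R).

Let m0 := m_gt0.
Let m1 := m_lt1.

Local Notation Psi := (Psi m).
Local Notation Psi1 := (Psi1 m).
Local Notation corner := (corner m).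

Definition circ r t : R[i] := cpath (fun t => r * cos t) (fun t => r * sin t) t.

Lemma cabs_circ r t : 0 <= r -> cabs (circ r t) = r.
Proof.
move=> r0; rewrite /cabs /= !exprMn -mulrDr cos2Dsin2 mulr1.
by rewrite sqrtr_sqr ger0_norm.
Qed.

Lemma circ_quad1 r t : 0 <= r -> 0 <= t <= pi / 2 -> quad1 (circ r t).
Proof.
move=> r0 /andP[t0 t1]; have p0 := pi_gt0 R; split; apply: mulr_ge0 => //.
  by apply: cos_ge0_pihalf; lra.
by apply: sin_ge0_pi; lra.
Qed.

Lemma quad1_polar w : quad1 w -> w != 0 ->
  exists2 t, 0 <= t <= pi / 2 & w = circ (cabs w) t.
Proof.
move=> [x0 y0] w0; have c0 : 0 < cabs w by rewrite cabs_gt0.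
have p0 := pi_gt0 R.
have sE := sqr_cabs w.
set y := complex.Im w / cabs w.
have y0' : 0 <= y by rewrite divr_ge0 // ltW.
have y1 : y <= 1.
  by rewrite ler_pdivrMr // mul1r; apply: le_trans (ler_norm _) (Im_le_cabs w).
have yb : -1 <= y <= 1 by lra.
have [/andP[a1 a2] aE] := asin_def yb.
exists (asin y).
  rewrite a2 andbT leNgt; apply/negP => aneg.
  have : 0 < sin (- asin y) by apply: sin_gt0_pi; lra.
  by rewrite sinN aE; lra.
apply: complex_eq => /=; last by rewrite aE /y mulrCA mulfV ?mulr1 // lt0r_neq0.
rewrite cos_asin //.
have -> : 1 - y ^+ 2 = (complex.Re w / cabs w) ^+ 2.
  rewrite /y !exprMn exprVn.
  have : cabs w ^+ 2 != 0 by rewrite expf_neq0 // lt0r_neq0.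
  by rewrite sE => s0; field.
rewrite sqrtr_sqr ger0_norm ?divr_ge0 ?(ltW c0) //.
by rewrite mulrCA mulfV ?mulr1 // lt0r_neq0.
Qed.

Lemma quad1_corner : quad1 corner.
Proof. by split; apply: sqrtr_ge0. Qed.

Lemma circ_diff_cos r t : diff_at (fun t => r * cos t) t (r * - sin t).
Proof. by apply: is_derive_diff_at; apply: is_deriveZ. Qed.

Lemma circ_diff_sin r t : diff_at (fun t => r * sin t) t (r * cos t).
Proof. by apply: is_derive_diff_at; apply: is_deriveZ. Qed.

Lemma circ_cont_cos r a b : cont_in (fun t => r * cos t) a b.
Proof.
apply: continuous_cont_in => t; apply: cvgM; first exact: cvg_cst.
exact: continuous_cos.
Qed.

Lemma circ_cont_sin r a b : cont_in (fun t => r * sin t) a b.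
Proof.
apply: continuous_cont_in => t; apply: cvgM; first exact: cvg_cst.
exact: continuous_sin.
Qed.

Lemma circ_annulus r t : 1 <= r -> annulus 1 r (circ r t).
Proof. by move=> r1; rewrite /annulus cabs_circ ?lexx ?r1 //; lra. Qed.

Lemma Psi_circ_diff r z t : 1 <= r ->
  diff_at (fun t => rpart z (Psi (circ r t))) t (- complex.Im (z * Psi1 (circ r t))).
Proof.
move=> r1; have hP := Psi_hol m0 m1 r.
have := cpath_diff (lexx 1) hP z (circ_diff_cos r t) (circ_diff_sin r t).
have c0 : circ r t != 0 by rewrite -cabs_gt0 cabs_circ; lra.
rewrite (_ : rpart z _ = - complex.Im (z * Psi1 (circ r t))).
  by apply; exists 1 => // s _; apply: circ_annulus.
rewrite -/(circ r t).
have -> : ((r * - sin t) +i* (r * cos t)) / circ r t = 'i.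
  have -> : (r * - sin t) +i* (r * cos t) = 'i * circ r t.
    by apply: complex_eq; rewrite /= ?mul0r ?mul1r; ring.
  by rewrite mulfK.
by rewrite /rpart mulrA !ReImE /=; ring.
Qed.

Lemma Psi_circ_cont r z a b : 1 <= r -> cont_in (fun t => rpart z (Psi (circ r t))) a b.
Proof.
move=> r1; apply: (cpath_cont (lexx 1) (Psi_hol m0 m1 r)).
- exact: circ_cont_cos.
- exact: circ_cont_sin.
- by move=> t _; apply: circ_annulus.
Qed.

Lemma rpart_conj z w : rpart z^* w =
  complex.Re z * complex.Re w + complex.Im z * complex.Im w.
Proof. exact: Re_conjM. Qed.

Lemma Im_conj_circ r s t : complex.Im ((circ r s)^* * circ r t) = r ^+ 2 * sin (t - s).
Proof. by rewrite sinB !ReImE /=; ring. Qed.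

Lemma Im_conjMC z w : complex.Im (z^* * w) = - complex.Im (w^* * z).
Proof. by rewrite !Im_conjM; ring. Qed.

Lemma diff_nincr (f : R -> R) a b : cont_in f a b ->
  (forall t, a < t < b -> exists2 L, L <= 0 & diff_at f t L) ->
  forall x y, a <= x -> x <= y -> y <= b -> f y <= f x.
Proof.
move=> fc fd x y ax xy yb; rewrite -lerN2.
apply: (@diff_ndecr R (fun t => - f t) a b) => //.
  move=> t tab e e0; have [d d0 hd] := fc t tab e e0.
  by exists d => // s sab sd; rewrite -opprD normrN; apply: hd.
move=> t /fd[L L0 hL]; exists (- L); first by rewrite oppr_ge0.
move=> e /hL[d d0 hd]; exists d => // s /hd.
by rewrite -normrN; congr (`|_| <= _); ring.
Qed.

(** The direction of Psi1 w supports the image of the arc of radius |w|: by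
    monotonicity of the argument the arc turns away on both sides. *)
Lemma support_arc r s t : 1 < r -> 0 <= s <= pi / 2 -> 0 <= t <= pi / 2 ->
  rpart (Psi1 (circ r s))^* (Psi (circ r t)) <=
  rpart (Psi1 (circ r s))^* (Psi (circ r s)).
Proof.
move=> r1 sb tb; have r10 := ltW r1; have p0 := pi_gt0 R.
have r0 : 0 <= r by lra.
have arg u v : 0 <= u -> u <= v -> v <= pi / 2 ->
    0 <= complex.Im ((Psi1 (circ r u))^* * Psi1 (circ r v)).
  move=> u0 uv v1; apply: Psi1_arg; rewrite ?cabs_circ //.
  - by apply: circ_quad1 => //; lra.
  - by apply: circ_quad1 => //; lra.
  - by rewrite Im_conj_circ mulr_ge0 ?exprn_ge0 //; apply: sin_ge0_pi; lra.
set M := Psi1 (circ r s).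
have [st|ts] := leP s t.
  apply: (@diff_nincr (fun t => rpart M^* (Psi (circ r t))) s t) => //.
    exact: Psi_circ_cont.
  move=> u su; exists (- complex.Im (M^* * Psi1 (circ r u))).
    by rewrite oppr_le0 /M arg //; lra.
  exact: Psi_circ_diff.
apply: (@diff_ndecr _ (fun t => rpart M^* (Psi (circ r t))) t s) => //; try lra.
  exact: Psi_circ_cont.
move=> u su; exists (- complex.Im (M^* * Psi1 (circ r u))).
  have h : 0 <= complex.Im ((Psi1 (circ r u))^* * M) by apply: arg; lra.
  by rewrite Im_conjMC opprK.
exact: Psi_circ_diff.
Qed.

Definition ray t : R[i] :=
  cpath (fun t => t * Num.sqrt (1 - m)) (fun t => t * Num.sqrt m) t.

Lemma rayE t : ray t = t%:C * corner.
Proof. by apply: complex_eq => /=; ring. Qed.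

Lemma cabs_ray t : 0 <= t -> cabs (ray t) = t.
Proof.
by move=> t0; rewrite rayE cabsM cabs_corner // mulr1 cabs_real ger0_norm.
Qed.

Lemma ray_quad1 t : 0 <= t -> quad1 (ray t).
Proof. by move=> t0; split; rewrite /= mulr_ge0 ?sqrtr_ge0. Qed.

Lemma lin_diff (c t : R) : diff_at (fun t => t * c) t c.
Proof.
move=> e e0; exists 1 => // s _.
rewrite (_ : s * c - t * c - (s - t) * c = 0); last by ring.
by rewrite normr0 mulr_ge0 // ltW.
Qed.

Lemma lin_cont (c a b : R) : cont_in (fun t => t * c) a b.
Proof.
apply: continuous_cont_in => t; apply: cvgM; first exact: cvg_id.
exact: cvg_cst.
Qed.

Lemma Psi_ray_diff z t : 1 < t ->
  diff_at (fun t => rpart z (Psi (ray t))) t (t^-1 * rpart z (Psi1 (ray t))).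
Proof.
move=> t1; have hP := Psi_hol m0 m1 (t + 1).
have := cpath_diff (lexx 1) hP z (lin_diff (Num.sqrt (1 - m)) t) (lin_diff (Num.sqrt m) t).
rewrite -/(ray t) (_ : rpart z _ = t^-1 * rpart z (Psi1 (ray t))).
  apply; exists (Num.min 1 (t - 1)); first by rewrite lt_min ltr01 subr_gt0.
  move=> s; rewrite le_min !ler_norml => h.
  by rewrite /annulus -/(ray s) cabs_ray; lra.
have c0 : corner != 0 by rewrite -cabs_gt0 cabs_corner.
have t0 : t%:C != 0 :> R[i] by rewrite -cabs_gt0 cabs_real gtr0_norm; lra.
rewrite -rpartZ; congr (rpart z _); rewrite {2}rayE -[_ +i* _]/corner.
rewrite fmorphV mulrC; congr (_ * _).
by rewrite invfM [corner * _]mulrCA mulfV ?mulr1.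
Qed.

Lemma Psi_ray_cont z a b : 1 <= a -> cont_in (fun t => rpart z (Psi (ray t))) a b.
Proof.
move=> a1; apply: (cpath_cont (lexx 1) (Psi_hol m0 m1 b)).
- exact: lin_cont.
- exact: lin_cont.
- by move=> t tab; rewrite /annulus -/(ray t) cabs_ray; lra.
Qed.

Lemma Psi_ray_ndecr M s t : quad1 M -> 1 <= s -> s <= t ->
  rpart M^* (Psi (ray s)) <= rpart M^* (Psi (ray t)).
Proof.
move=> [M1 M2] s1 st.
apply: (@diff_ndecr _ (fun t => rpart M^* (Psi (ray t))) s t) => //.
  exact: Psi_ray_cont.
move=> u /andP[su ut]; exists (u^-1 * rpart M^* (Psi1 (ray u))).
  have u1 : 1 <= cabs (ray u) by rewrite cabs_ray; lra.
  have u0 : 0 <= u by lra.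
  have [? ?] := Psi1_quad1 m0 m1 u1 (ray_quad1 u0).
  by rewrite mulr_ge0 ?invr_ge0 // rpart_conj addr_ge0 // mulr_ge0.
by apply: Psi_ray_diff; lra.
Qed.

(** Along the ray both components of the normal are bounded below, which makes
    the support inequality strict at every radius larger than 1. *)
Lemma Psi_ray_strict r1 : 1 < r1 -> exists2 nu, 0 < nu & forall M, quad1 M ->
  nu * cabs M <= rpart M^* (Psi (ray r1)) - rpart M^* (Psi corner).
Proof.
have aux (A B k x y : R) : B - x * k <= A - y * k -> k * (y - x) <= A - B by lra.
move=> r11; have r1p : 0 < r1 by lra.
have [r0 r01 rr] : exists2 r0, 1 < r0 & r0 < r1 by exists ((1 + r1) / 2); lra.
pose y0 := Num.sqrt (1 - m) * Num.sqrt m.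
have y00 : 0 < y0 by rewrite mulr_gt0 // sqrtr_gt0 ?subr_gt0.
pose k := 2 * y0 * (1 - (r0 ^+ 4)^-1) / (2 * (r1 + 4)).
have ri : (r0 ^+ 4)^-1 < 1.
  by rewrite invf_lt1 ?exprn_gt0 ?exprn_egt1 //; lra.
have r40 : 0 < 2 * (r1 + 4) by lra.
have k0 : 0 < k by rewrite divr_gt0 // mulr_gt0 ?subr_gt0 // mulr_gt0.
have comp u : r0 <= u -> u <= r1 -> k <= complex.Re (Psi1 (ray u)) /\
    k <= complex.Im (Psi1 (ray u)).
  move=> r0u ur1; have u1 : 1 <= cabs (ray u) by rewrite cabs_ray; lra.
  have u0 : 0 <= u by lra.
  have [n1 n2] := Psi1_quad1 m0 m1 u1 (ray_quad1 u0).
  have := sqr_Psi1_Im m0 m1 u1; rewrite cabs_ray // expr2 ImM /=.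
  have cN : cabs (Psi1 (ray u)) <= r1 + 4.
    have := cabs_dist (Psi1 (ray u)) (ray u); have := Psi1_asym m0 m1 u1.
    by rewrite cabs_ray //; lra.
  have b1 := le_trans (ler_norm _) (le_trans (Re_le_cabs _) cN).
  have b2 := le_trans (ler_norm _) (le_trans (Im_le_cabs _) cN).
  have : 2 * y0 * (1 - (r0 ^+ 4)^-1) <=
      2 * (u * Num.sqrt (1 - m)) * (u * Num.sqrt m) * (1 - (u ^+ 4)^-1).
    have -> : 2 * (u * Num.sqrt (1 - m)) * (u * Num.sqrt m) = u ^+ 2 * (2 * y0).
      by rewrite /y0; ring.
    have uu : (u ^+ 4)^-1 <= (r0 ^+ 4)^-1.
      by rewrite lef_pV2 ?posrE ?exprn_gt0 ?lerXn2r ?nnegrE //; lra.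
    apply: ler_pM; [lra|lra| |lra].
    by rewrite ler_peMl ?exprn_ege1 //; lra.
  rewrite -(ler_pM2r (x := (2 * (r1 + 4))^-1)) ?invr_gt0 //.
  rewrite -/k => hk E; rewrite -E in hk.
  move: hk; rewrite ler_pdivlMr //.
  move: (complex.Re _) (complex.Im _) n1 n2 b1 b2 => a b a0 b0 ar br hk.
  have := ler_wpM2l a0 br; have := ler_wpM2l b0 ar.
  by split; rewrite -(ler_pM2r r40); lra.
pose c := k / r1; have c0 : 0 < c by rewrite divr_gt0.
have cr : c * r1 = k by rewrite /c divfK // lt0r_neq0.
clearbody c k y0.
exists (c * (r1 - r0)); first by rewrite mulr_gt0 // subr_gt0.
move=> M qM; have [M1 M2] := qM.
have h1 : rpart M^* (Psi corner) <= rpart M^* (Psi (ray r0)).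
  have -> : corner = ray 1 by rewrite rayE mul1r.
  by apply: Psi_ray_ndecr => //; lra.
suff : c * cabs M * (r1 - r0) <=
    rpart M^* (Psi (ray r1)) - rpart M^* (Psi (ray r0)).
  by move=> h; rewrite mulrAC; apply: le_trans h _; rewrite lerD2l lerN2.
have := @diff_ndecr _ (fun t => rpart M^* (Psi (ray t)) - t * (c * cabs M)) r0 r1.
move=> /(_ _ _ r0 r1 (lexx _) (ltW rr) (lexx _)) H.
apply: aux; apply: H => [|t /andP[r0t tr1]].
  by apply: cont_inB; [apply: Psi_ray_cont (ltW r01)|apply: lin_cont].
have t1 : 1 < t by exact: lt_trans r01 r0t.
exists (t^-1 * rpart M^* (Psi1 (ray t)) - c * cabs M).
  rewrite subr_ge0.
  have [n1 n2] := comp t (ltW r0t) (ltW tr1).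
  have : k * cabs M <= rpart M^* (Psi1 (ray t)).
    rewrite rpart_conj; have := cabs_le M; rewrite !ger0_norm // => cM.
    apply: le_trans (ler_wpM2l (ltW k0) cM) _.
    by rewrite mulrDr lerD // mulrC ler_wpM2l.
  move=> hk; have t0 : 0 < t by exact: lt_trans ltr01 t1.
  rewrite [leRHS]mulrC (ler_pdivlMr _ _ t0); apply: le_trans hk.
  rewrite mulrAC -cr; apply: (ler_wpM2r (cabs_ge0 _)).
  exact: (ler_wpM2l (ltW c0) (ltW tr1)).
by apply: diff_atB; [apply: Psi_ray_diff|apply: lin_diff].
Qed.

(** The level curve through Psi w is supported at Psi w by its normal, the curve
    contains the image of a point of the ray through the corner, and along this
    ray the image moves outward from the corner of the rectangle. *)
Let support_quad1 r1 : 1 < r1 -> exists2 nu, 0 < nu & forall w h,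
  r1 <= cabs w -> quad1 w ->
  `|complex.Re h| <= complex.Re (Psi corner) ->
  `|complex.Im h| <= complex.Im (Psi corner) ->
  nu * cabs (Psi1 w) <= rpart (Psi1 w)^* (Psi w - h).
Proof.
move=> r11; have [nu nu0 hnu] := Psi_ray_strict r11; exists nu => // w h rw qw hx hy.
have w1 : 1 < cabs w by lra.
have w0 : w != 0 by rewrite -cabs_gt0; lra.
have qM := Psi1_quad1 m0 m1 (ltW w1) qw.
have [s sb wE] := quad1_polar qw w0.
have c0 : corner != 0 by rewrite -cabs_gt0 cabs_corner.
have [t tb cE] := quad1_polar quad1_corner c0.
rewrite cabs_corner // in cE.
have rE : circ (cabs w) t = ray (cabs w).
  by rewrite rayE cE; apply: complex_eq => /=; ring.
have a := support_arc w1 sb tb; rewrite -wE rE in a.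
have b := Psi_ray_ndecr qM (ltW r11) rw.
have d := hnu _ qM.
have e : rpart (Psi1 w)^* h <= rpart (Psi1 w)^* (Psi corner).
  case: qM => M1 M2; rewrite !rpart_conj.
  apply: lerD.
    exact: (ler_wpM2l M1 (le_trans (ler_norm _) hx)).
  exact: (ler_wpM2l M2 (le_trans (ler_norm _) hy)).
by rewrite rpartB; apply: le_trans d _; apply: lerB (le_trans b a) e.
Qed.

Lemma quad1_symm w : exists u, quad1 u /\ [\/ w = u, w = u^*, w = - u | w = - u^*].
Proof.
exists (`|complex.Re w| +i* `|complex.Im w|); split; first by split => /=.
case: w => x y /=.
case: (ger0P x) => _; case: (ger0P y) => _.
- by apply: Or41.
- by apply: Or42; apply: complex_eq; rewrite /= ?opprK.
- by apply: Or44; apply: complex_eq; rewrite /= ?opprK.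
- by apply: Or43; apply: complex_eq; rewrite /= ?opprK.
Qed.

(** Reflections in the axes reduce the claim to the first quadrant. *)
Lemma support r1 : 1 < r1 -> exists2 nu, 0 < nu & forall w h, r1 <= cabs w ->
  `|complex.Re h| <= complex.Re (Psi corner) ->
  `|complex.Im h| <= complex.Im (Psi corner) ->
  nu * cabs (Psi1 w) <= rpart (Psi1 w)^* (Psi w - h).
Proof.
move=> r11; have [nu nu0 hnu] := support_quad1 r11; exists nu => // w h rw hx hy.
have [u [qu wu]] := quad1_symm w.
have cu : cabs w = cabs u by case: wu => ->; rewrite ?cabsN ?cabs_conj.
rewrite cu in rw; have u1 : 1 <= cabs u by lra.
have u1' : 1 <= cabs u^* by rewrite cabs_conj.
have cj (a b c : R[i]) : rpart a^*^* (conjc b - c) = rpart a^* (b - conjc c).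
  by rewrite !rpart_conj !ReImE; ring.
have ng (a b c : R[i]) : rpart (- a)^* (- b - c) = rpart a^* (b - - c).
  by rewrite !rpart_conj !ReImE; ring.
have P1c : Psi1 u^* = (Psi1 u)^* by apply: Psi1_conj.
have Pc : Psi u^* = (Psi u)^* by apply: Psi_conj.
have hxN : `|complex.Re (- h)| <= complex.Re (Psi corner) by rewrite ReN normrN.
have hyN : `|complex.Im (- h)| <= complex.Im (Psi corner) by rewrite ImN normrN.
have hxc : `|complex.Re (conjc h)| <= complex.Re (Psi corner) by rewrite Re_conj.
have hyc : `|complex.Im (conjc h)| <= complex.Im (Psi corner).
  by rewrite Im_conj normrN.
have hxNc : `|complex.Re (conjc (- h))| <= complex.Re (Psi corner).
  by rewrite Re_conj.
have hyNc : `|complex.Im (conjc (- h))| <= complex.Im (Psi corner).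
  by rewrite Im_conj normrN.
case: wu => ->.
- exact: hnu rw qu hx hy.
- by rewrite P1c Pc cj cabs_conj; exact: hnu rw qu hxc hyc.
- rewrite (Psi1_odd m0 m1 u1) (Psi_odd m0 m1 u1) ng cabsN.
  exact: hnu rw qu hxN hyN.
- rewrite (Psi1_odd m0 m1 u1') (Psi_odd m0 m1 u1') ng P1c Pc cj cabsN cabs_conj.
  exact: hnu rw qu hxNc hyNc.
Qed.

(** Along a quarter of a circle the real part of Psi decreases, because its
    derivative is minus the imaginary part of Psi1. *)
Lemma Re_Psi_le w : 1 <= cabs w -> `|complex.Re (Psi w)| <= complex.Re (Psi (cabs w)%:C).
Proof.
have auxN (x : R) : - x = x -> x = 0 by lra.
move=> w1; have [u [qu wu]] := quad1_symm w.
have cu : cabs w = cabs u by case: wu => ->; rewrite ?cabsN ?cabs_conj.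
have u1 : 1 <= cabs u by rewrite -cu.
have u1' : 1 <= cabs u^* by rewrite cabs_conj.
have -> : `|complex.Re (Psi w)| = `|complex.Re (Psi u)|.
  by case: wu => ->; rewrite ?Psi_odd ?Psi_conj // !ReImE ?normrN.
rewrite cu; set r := cabs u; have r0 : 0 <= r by apply: cabs_ge0.
have p0 := pi_gt0 R.
have u0 : u != 0 by rewrite -cabs_gt0; lra.
have [s /andP[s0 s1] uE] := quad1_polar qu u0; rewrite -/r in uE.
have mono x y : 0 <= x -> x <= y -> y <= pi / 2 ->
    rpart 1 (Psi (circ r y)) <= rpart 1 (Psi (circ r x)).
  apply: (@diff_nincr (fun t => rpart 1 (Psi (circ r t))) 0 (pi / 2)).
    exact: Psi_circ_cont.
  move=> t tb; exists (- complex.Im (1 * Psi1 (circ r t))); last exact: Psi_circ_diff.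
  rewrite mul1r oppr_le0.
  have c1 : 1 <= cabs (circ r t) by rewrite cabs_circ.
  have qc : quad1 (circ r t) by apply: circ_quad1 => //; lra.
  by have [] := Psi1_quad1 m0 m1 c1 qc.
have E0 : circ r 0 = r%:C.
  by apply: complex_eq => /=; rewrite ?cos0 ?sin0 ?mulr1 ?mulr0.
have E1 : circ r (pi / 2) = 'i * r%:C.
  by apply: complex_eq => /=; rewrite ?cos_pihalf ?sin_pihalf; ring.
have h1 := mono 0 s (lexx _) s0 s1.
have h2 := mono s (pi / 2) s0 s1 (lexx _).
have z : complex.Re (Psi ('i * r%:C)) = 0.
  have ir1 : 1 <= cabs ('i * r%:C : R[i]) by rewrite -E1 cabs_circ.
  have := Psi_conj m0 m1 ir1.
  have -> : ('i * r%:C)^* = - ('i * r%:C) :> R[i].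
    by apply: complex_eq; rewrite !ReImE /=; ring.
  rewrite (Psi_odd m0 m1 ir1) => /(congr1 (@complex.Re R)).
  by rewrite Re_conj ReN; apply: auxN.
have one v : rpart 1 v = complex.Re v by rewrite /rpart mul1r.
rewrite -uE E0 !one in h1; rewrite -uE E1 !one z in h2.
rewrite (ger0_norm h2); exact: h1.
Qed.

End Support.

(** * Elliptic integrals as coordinates of the corner *)

Section Integrals.
Variable R : realType.
Implicit Types (m t q : R) (w : R[i]).

Lemma diff_at_eq (f : R -> R) t x y : x = y -> diff_at f t x -> diff_at f t y.
Proof. by move=> ->. Qed.

Lemma sin2_le1 t : sin t ^+ 2 <= 1 :> R.
Proof. by rewrite -(cos2Dsin2 t) lerDr sqr_ge0. Qed.

Lemma arg_gt0 m t : 0 < m -> m < 1 -> 0 < 1 - m * sin t ^+ 2.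
Proof.
move=> m0 m1; rewrite subr_gt0; apply: le_lt_trans m1.
by rewrite ler_piMr ?(ltW m0) ?sin2_le1.
Qed.

(** The unit circle from 1 to the corner, in the variable of the elliptic
    integrals. *)
Definition arc m t : R[i] :=
  cpath (fun t => Num.sqrt (1 - m * sin t ^+ 2)) (fun t => Num.sqrt m * sin t) t.

Lemma cabs_arc m t : 0 < m -> m < 1 -> cabs (arc m t) = 1.
Proof.
move=> m0 m1; apply/eqP; rewrite -sqrp_eq1 ?cabs_ge0 // sqr_cabs /=.
rewrite sqr_sqrtr ?ltW ?arg_gt0 // exprMn sqr_sqrtr ?ltW //.
by rewrite subrK.
Qed.

Lemma arc_diff1 m t : 0 < m -> m < 1 ->
  diff_at (fun t => Num.sqrt (1 - m * sin t ^+ 2)) t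
    (- (m * sin t * cos t / Num.sqrt (1 - m * sin t ^+ 2))).
Proof.
move=> m0 m1; have g0 := arg_gt0 t m0 m1.
have d1 : is_derive t 1 (fun t : R => 1 - m * sin t ^+ 2) (- (m * (2 * sin t * cos t))).
  have ds : is_derive t 1 (fun t : R => sin t ^+ 2) (2 * sin t * cos t).
    apply: is_derive_eq; rewrite /GRing.scale /=; ring.
  apply: is_derive_eq; rewrite /GRing.scale /=; ring.
have d2 := is_derive1_sqrt g0.
have h := @is_derive1_comp _ (@Num.sqrt R) (fun t : R => 1 - m * sin t ^+ 2) t _ _ d2 d1.
apply: diff_at_eq (is_derive_diff_at h).
have s0 : Num.sqrt (1 - m * sin t ^+ 2) != 0 by apply: lt0r_neq0; rewrite sqrtr_gt0.
by field.
Qed.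

Lemma modulus_continuous m : continuous (fun t : R => Num.sqrt (1 - m * sin t ^+ 2)).
Proof.
move=> t; apply: continuous_comp; last exact: sqrt_continuous.
apply: cvgB; first exact: cvg_cst.
apply: cvgM; first exact: cvg_cst.
by apply: cvgM; apply: continuous_sin.
Qed.

Lemma arc_cont1 m a b : cont_in (fun t => Num.sqrt (1 - m * sin t ^+ 2)) a b.
Proof. by apply: continuous_cont_in; apply: modulus_continuous. Qed.

Lemma arc_quad1 m t : 0 <= t <= pi / 2 -> quad1 (arc m t).
Proof.
move=> /andP[t0 t1]; have p0 := pi_gt0 R; split; rewrite /= ?sqrtr_ge0 //.
by rewrite mulr_ge0 ?sqrtr_ge0 //; apply: sin_ge0_pi; lra.
Qed.

(** Chooses the branch of the root when only the square of Psi1 is known. *)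
Lemma quad1_sqr_real (z : R[i]) (x : R) : quad1 z -> 0 <= x ->
  complex.Re (z ^+ 2) = x ^+ 2 -> complex.Im (z ^+ 2) = 0 -> z = x%:C.
Proof.
case: z => a b [/= a0 b0] x0 h1 h2.
have ab : a * b = 0 by lra.
have {h2 ab} b_0 : b = 0.
  move/eqP: ab; rewrite mulf_eq0 => /orP[/eqP a_0|/eqP //].
  move: h1; rewrite a_0 mul0r sub0r => h1.
  apply/eqP; rewrite -sqrf_eq0; have := sqr_ge0 b; have := sqr_ge0 x.
  by rewrite eq_le => ? ->; rewrite andbT expr2; lra.
move: h1; rewrite b_0 mul0r subr0 -expr2 => /eqP.
by rewrite eqrXn2 // => /eqP ->.
Qed.

(** Psi1 is real on the arc, so Psi moves along it parallel to the imaginary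
    axis: the arc is sent to half a vertical side of the rectangle. *)
Lemma Psi1_arc m t : 0 < m -> m < 1 -> 0 <= t <= pi / 2 ->
  Psi1 m (arc m t) = (2 * Num.sqrt m * cos t)%:C.
Proof.
move=> m0 m1 tb; have c1 := cabs_arc t m0 m1.
have c1' : 1 <= cabs (arc m t) by rewrite c1.
have p0 := pi_gt0 R.
have sE : Num.sqrt (1 - m * sin t ^+ 2) ^+ 2 = 1 - m * sin t ^+ 2.
  by rewrite sqr_sqrtr // ltW // arg_gt0.
have mE : Num.sqrt m ^+ 2 = m by rewrite sqr_sqrtr // ltW.
apply: quad1_sqr_real.
- by apply: Psi1_quad1 => //; apply: arc_quad1.
- rewrite !mulr_ge0 ?sqrtr_ge0 //; apply: cos_ge0_pihalf; lra.
- rewrite sqr_Psi1_Re // c1 expr1n invr1 /= sE !exprMn mE.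
  by have := cos2Dsin2 t; rewrite [cos t ^+ 2]expr2 => h; nra.
- by rewrite sqr_Psi1_Im // c1 expr1n invr1 subrr mulr0.
Qed.

Lemma Psi_arc_diff m z t : 0 < m -> m < 1 -> 0 <= t <= pi / 2 ->
  diff_at (fun t => rpart z (Psi m (arc m t))) t
    (rpart z 'i * (2 * (m * cos t ^+ 2 / Num.sqrt (1 - m * sin t ^+ 2)))).
Proof.
move=> m0 m1 tb.
have d2 : diff_at (fun t => Num.sqrt m * sin t) t (Num.sqrt m * cos t).
  exact: circ_diff_sin.
have := cpath_diff (lexx 1) (Psi_hol m0 m1 1) z (arc_diff1 t m0 m1) d2.
rewrite -/(arc m t) (Psi1_arc m0 m1 tb).
move=> h; apply: diff_at_eq (h _); last first.
  by exists 1 => // s _; rewrite /annulus -/(arc m s) cabs_arc // lexx.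
rewrite [RHS]mulrC -rpartZ; congr (rpart z _).
have mE : Num.sqrt m ^+ 2 = m by rewrite sqr_sqrtr // ltW.
have sE : Num.sqrt (1 - m * sin t ^+ 2) ^+ 2 = 1 - m * sin t ^+ 2.
  by rewrite sqr_sqrtr // ltW // arg_gt0.
have s0 : Num.sqrt (1 - m * sin t ^+ 2) != 0.
  by apply: lt0r_neq0; rewrite sqrtr_gt0 arg_gt0.
have a0 : arc m t != 0 by rewrite -cabs_gt0 cabs_arc.
rewrite mulrA; apply: (canLR (mulfK a0)).
rewrite /arc /cpath; move: (Num.sqrt (1 - m * sin t ^+ 2)) (Num.sqrt m) sE mE s0 => s r sE mE s0.
by apply: complex_eq; rewrite /= -mE; field; exact: s0.
Qed.

Lemma Psi_arc_cont m z : 0 < m -> m < 1 ->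
  cont_in (fun t => rpart z (Psi m (arc m t))) 0 (pi / 2).
Proof.
move=> m0 m1; apply: (cpath_cont (lexx 1) (Psi_hol m0 m1 1)).
- exact: arc_cont1.
- exact: circ_cont_sin.
- by move=> t _; rewrite /annulus -/(arc m t) cabs_arc // lexx.
Qed.

Lemma arc0 m : arc m 0 = 1.
Proof.
by apply: complex_eq; rewrite /= sin0 ?mulr0 // expr0n mulr0 subr0 sqrtr1.
Qed.

Lemma arc_pihalf m : arc m (pi / 2) = corner m.
Proof. by apply: complex_eq; rewrite /= sin_pihalf ?mulr1 // expr1n mulr1. Qed.

Lemma rpart1 w : rpart 1 w = complex.Re w.
Proof. by rewrite /rpart mul1r. Qed.

Lemma rpartNi w : rpart (- 'i) w = complex.Im w.
Proof. by rewrite /rpart !ReImE /=; ring. Qed.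

Lemma pihalf_gt0 : 0 < pi / 2 :> R.
Proof. by rewrite divr_gt0 ?pi_gt0. Qed.

Lemma Re_Psi_corner_one m : 0 < m -> m < 1 ->
  complex.Re (Psi m (corner m)) = complex.Re (Psi m 1).
Proof.
move=> m0 m1; have p0 := pihalf_gt0.
pose f t := rpart 1 (Psi m (arc m t)).
have h : f 0 = f (pi / 2).
  apply: diff0_eq (ltW p0) (Psi_arc_cont _ m0 m1) _ => t /andP[t0 t1].
  have tb : 0 <= t <= pi / 2 by rewrite !ltW.
  apply: diff_at_eq (Psi_arc_diff 1 m0 m1 tb).
  by rewrite rpart1 mul0r.
have E0 : f 0 = complex.Re (Psi m 1) by rewrite /f arc0 rpart1.
have E1 : f (pi / 2) = complex.Re (Psi m (corner m)).
  by rewrite /f rpart1; congr (complex.Re (Psi m _)); rewrite arc_pihalf.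
exact: etrans (esym E1) (etrans (esym h) E0).
Qed.

Lemma arc_integrand_cont m a b : 0 < m -> m < 1 ->
  {within `[a, b], continuous (fun t : R => m * cos t ^+ 2 / Num.sqrt (1 - m * sin t ^+ 2))}.
Proof.
move=> m0 m1; apply: continuous_subspaceT => t.
apply: cvgM.
  apply: cvgM; first exact: cvg_cst.
  by apply: cvgM; apply: continuous_cos.
apply: cvgV; last exact: modulus_continuous.
  by apply: lt0r_neq0; rewrite sqrtr_gt0 arg_gt0.
Qed.

Lemma itv_integrable (f : R -> R) a b : {within `[a, b], continuous f} ->
  (@lebesgue_measure R).-integrable `[a, b] (EFin \o f).
Proof. by move=> fc; apply: continuous_compact_integrable => //; apply: segment_compact. Qed.

Lemma arc_integral m : 0 < m -> m < 1 ->
  \int[@lebesgue_measure R]_(t in `[0, pi / 2])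
    (m * cos t ^+ 2 / Num.sqrt (1 - m * sin t ^+ 2)) =
  ellipticE m - (1 - m) * ellipticK m.
Proof.
move=> m0 m1.
have cE : {within `[0, pi / 2 : R], continuous (fun t : R => Num.sqrt (1 - m * sin t ^+ 2))}.
  by apply: continuous_subspaceT; apply: modulus_continuous.
have s0 t : Num.sqrt (1 - m * sin t ^+ 2) != 0.
  by apply: lt0r_neq0; rewrite sqrtr_gt0 arg_gt0.
have cK : {within `[0, pi / 2 : R], continuous (fun t : R => (Num.sqrt (1 - m * sin t ^+ 2))^-1)}.
  apply: continuous_subspaceT => t; apply: cvgV; last exact: modulus_continuous.
  exact: s0.
rewrite /ellipticE /ellipticK -RintegralZl //; last exact: itv_integrable.
rewrite -RintegralB //; [|exact: itv_integrable|].
  apply: eq_Rintegral => t _; have := s0 t.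
  have : Num.sqrt (1 - m * sin t ^+ 2) ^+ 2 = 1 - m * sin t ^+ 2.
    by rewrite sqr_sqrtr // ltW // arg_gt0.
  have := cos2Dsin2 t.
  move: (Num.sqrt _) => s cs sE sn0; apply: (mulIf sn0).
  rewrite divfK // mulrBl divfK //.
  by rewrite -expr2 sE; rewrite (_ : cos t ^+ 2 = 1 - sin t ^+ 2); [ring|rewrite -cs addrK].
apply: itv_integrable; apply: continuous_subspaceT => t.
apply: cvgM; first exact: cvg_cst.
by apply: cvgV; [exact: s0|exact: modulus_continuous].
Qed.

Lemma Im_Psi_one m : 0 < m -> m < 1 -> complex.Im (Psi m 1) = 0.
Proof.
move=> m0 m1; have c1 : 1 <= cabs (1 : R[i]) by rewrite cabs1.
have auxN (x : R) : - x = x -> x = 0 by lra.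
have := Psi_conj m0 m1 c1; rewrite conjc1 => /(congr1 (@complex.Im R)).
by rewrite Im_conj => /esym; apply: auxN.
Qed.

(** The vertical side, integrated in the variable of the arc. *)
Lemma Im_Psi_corner m : 0 < m -> m < 1 ->
  complex.Im (Psi m (corner m)) = 2 * (ellipticE m - (1 - m) * ellipticK m).
Proof.
move=> m0 m1; rewrite -arc_integral // -RintegralZl //; last first.
  by apply: itv_integrable; apply: arc_integrand_cont.
have iE : rpart (- 'i) 'i = 1 :> R by rewrite /rpart !ReImE /=; ring.
pose f t := rpart (- 'i) (Psi m (arc m t)).
have E0 : f 0 = 0 by rewrite /f arc0 rpartNi Im_Psi_one.
have E1 : f (pi / 2) = complex.Im (Psi m (corner m)).
  by rewrite /f rpartNi; congr (complex.Im (Psi m _)); rewrite arc_pihalf.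
apply: etrans (esym (etrans (congr2 (fun x y => x - y) E1 E0) (subr0 _))) _.
apply/esym; apply: diff_FTC.
- exact: pihalf_gt0.
- apply: continuous_subspaceT => t; apply: cvgM; first exact: cvg_cst.
  apply: cvgM.
    apply: cvgM; first exact: cvg_cst.
    by apply: cvgM; apply: continuous_cos.
  apply: cvgV; last exact: modulus_continuous.
  by apply: lt0r_neq0; rewrite sqrtr_gt0 arg_gt0.
- exact: Psi_arc_cont.
- move=> t /andP[t0 t1]; have tb : 0 <= t <= pi / 2 by rewrite !ltW.
  by apply: diff_at_eq (Psi_arc_diff (- 'i) m0 m1 tb); rewrite iE mul1r.
Qed.

(** The speed along the vertical side is nonnegative, and positive at 1. *)
Lemma Im_Psi_corner_gt0 m : 0 < m -> m < 1 -> 0 < complex.Im (Psi m (corner m)).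
Proof.
move=> m0 m1; have p0 := pihalf_gt0.
have iE : rpart (- 'i) 'i = 1 :> R by rewrite /rpart !ReImE /=; ring.
pose f t := rpart (- 'i) (Psi m (arc m t)).
pose g t := 2 * (m * cos t ^+ 2 / Num.sqrt (1 - m * sin t ^+ 2)).
have fd t : 0 <= t <= pi / 2 -> diff_at f t (g t).
  by move=> tb; apply: diff_at_eq (Psi_arc_diff (- 'i) m0 m1 tb); rewrite iE mul1r.
have g0 t : 0 <= g t.
  apply: mulr_ge0 => //; apply: mulr_ge0; last by rewrite invr_ge0 sqrtr_ge0.
  by apply: mulr_ge0; [apply: ltW|apply: sqr_ge0].
have mono x y : 0 <= x -> x <= y -> y <= pi / 2 -> f x <= f y.
  move=> x0 xy y1; apply: (@diff_ndecr _ f 0 (pi / 2)) x0 xy y1.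
    exact: Psi_arc_cont.
  move=> t /andP[t0 t1]; exists (g t); first exact: g0.
  by apply: fd; rewrite !ltW.
have f0 : f 0 = 0 by rewrite /f arc0 rpartNi Im_Psi_one.
have f1 : f (pi / 2) = complex.Im (Psi m (corner m)).
  by rewrite /f rpartNi; congr (complex.Im (Psi m _)); rewrite arc_pihalf.
have g4 : 0 < g 0.
  rewrite /g cos0 expr1n mulr1 mulr_gt0 // mulr_gt0 // invr_gt0 sqrtr_gt0 arg_gt0 //.
clearbody f g.
rewrite -f1 lt_neqAle -[in X in _ && X]f0 mono ?(ltW p0) // andbT.
apply/eqP => fz.
have fc t : 0 <= t -> t <= pi / 2 -> f t = 0.
  move=> t0 t1; have := mono _ _ (lexx 0) t0 t1; rewrite f0 => h2.
  have := mono _ _ t0 t1 (lexx _); rewrite -fz => h1.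
  by apply/eqP; rewrite eq_le h1 h2.
have e0 : 0 < g 0 / 2 by rewrite divr_gt0.
have b0 : 0 <= (0 : R) <= pi / 2 by rewrite lexx ltW.
have [d d0 hd] := fd 0 b0 _ e0.
have dm0 : 0 < Num.min d (pi / 2) by rewrite lt_min d0.
have := hd (Num.min d (pi / 2)).
have dd : Num.min d (pi / 2) <= d by rewrite ge_min lexx.
have dp : Num.min d (pi / 2) <= pi / 2 by rewrite ge_min lexx orbT.
rewrite subr0 (ger0_norm (ltW dm0)) => /(_ dd).
rewrite (fc _ (ltW dm0) dp) f0 subr0 sub0r normrN normrM (ger0_norm (ltW dm0)).
rewrite (ger0_norm (g0 _)) [leRHS]mulrC ler_pM2l //.
by move: (g 0) g4 => x x0; lra.
Qed.

End Integrals.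

(** * The width of the rectangle and the image of the real axis *)

Section Complement.
Variable R : realType.
Implicit Types (m t q : R) (w : R[i]).

Lemma corner_compl m : corner (1 - m) = 'i * conjc (corner m).
Proof.
have -> : corner (1 - m) = Num.sqrt m +i* Num.sqrt (1 - m).
  by rewrite /corner (_ : 1 - (1 - m) = m) //; ring.
by apply: complex_eq; rewrite !ReImE /=; ring.
Qed.

Lemma sqr_imag : 'i ^+ 2 = -1 :> R[i].
Proof. exact: sqr_i. Qed.

Lemma btermN (z : R[i]) n : bterm (- z) n = (-1) ^+ n * bterm z n.
Proof. by rewrite /bterm (exprNn z) mulrCA. Qed.

Lemma pcoef_compl m n : pcoef (1 - m) n = (-1) ^+ n * pcoef m n.
Proof.
have cc : conjc (corner (1 - m)) = - 'i * corner m.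
  by rewrite corner_compl; apply: complex_eq; rewrite !ReImE /=; ring.
rewrite /pcoef.
have -> : corner (1 - m) ^+ 2 = - conjc (corner m) ^+ 2.
  by rewrite corner_compl exprMn sqr_imag mulN1r.
have -> : conjc (corner (1 - m)) ^+ 2 = - corner m ^+ 2.
  by rewrite cc exprMn sqrrN sqr_imag mulN1r.
rewrite convC /conv mulr_sumr; apply: eq_bigr => i _; rewrite !btermN.
have -> : (-1) ^+ n = (-1) ^+ i * (-1) ^+ (n - i) :> R[i].
  by rewrite -exprD subnKC // -ltnS.
by rewrite mulrACA.
Qed.

(** Turning the rectangle by a right angle exchanges m and 1 - m. *)
Lemma Psi_compl m w : 0 < m -> m < 1 -> 1 <= cabs w ->
  Psi (1 - m) ('i * conjc w) = 'i * conjc (Psi m w).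
Proof.
move=> m0 m1 w1; have m0' : 0 < 1 - m by rewrite subr_gt0.
have m1' : 1 - m < 1 by rewrite gtrBl.
have i1 : cabs 'i = 1 :> R by rewrite /cabs /= expr0n expr1n add0r sqrtr1.
have w1' : 1 <= cabs ('i * conjc w) by rewrite cabsM i1 mul1r cabs_conj.
have w0 : w != 0 by rewrite -cabs_gt0; lra.
have w0' : conjc w != 0 by rewrite -cabs_gt0 cabs_conj; lra.
apply: ccvg_unique (Psi_ccvg m0' m1' w1') _.
apply: eq_ccvg (ccvgZ 'i (ccvg_conj (Psi_ccvg m0 m1 w1))) => J.
rewrite /psum rmorph_sum mulr_sumr; apply: eq_bigr => j _.
rewrite -[X in _ * X]/(conjc (lterm _ w j)) lterm_conj /lterm.
have -> : conjc (pcoef m j / (1 - 2 * j%:R)) = pcoef m j / (1 - 2 * j%:R).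
  rewrite -[LHS]/((pcoef m j / (1 - 2 * j%:R))^*) rmorphM fmorphV /=.
  rewrite pcoef_conj; congr (_ / _).
  by rewrite rmorphB rmorphM rmorph1 !rmorph_nat.
have iv2 : 'i^-1 ^+ 2 = -1 :> R[i] by rewrite exprVn sqr_imag invrN invr1.
rewrite pcoef_compl invfM exprMn ['i^-1 ^+ _]exprM iv2.
have s1 : (-1) ^+ j * (-1) ^+ j = 1 :> R[i] by rewrite -exprMn mulrNN mulr1 expr1n.
move: ((-1) ^+ j : R[i]) s1 => s s1.
transitivity (s * s * ('i * (pcoef m j / (1 - 2 * j%:R) * (conjc w * (conjc w)^-1 ^+ (2 * j))))).
  by rewrite s1 mul1r.
by ring.
Qed.

(** The quarter turn reduces the horizontal side to the vertical one. *)
Lemma Re_Psi_corner m : 0 < m -> m < 1 ->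
  complex.Re (Psi m (corner m)) = 2 * (ellipticE (1 - m) - m * ellipticK (1 - m)).
Proof.
move=> m0 m1; have m0' : 0 < 1 - m by rewrite subr_gt0.
have m1' : 1 - m < 1 by rewrite gtrBl.
have c1 : 1 <= cabs (corner m) by rewrite cabs_corner.
have mm : 1 - (1 - m) = m by ring.
have := Im_Psi_corner m0' m1'; rewrite mm => <-.
have E : Psi (1 - m) (corner (1 - m)) = 'i * conjc (Psi m (corner m)).
  by rewrite corner_compl Psi_compl.
by rewrite E ImM Re_conj /= mul0r add0r mul1r.
Qed.

(** The real numbers w >= 1 in the variable s = (w - 1 / w) / 2 of the
    integral. *)
Definition real_path t : R[i] := cpath (fun t => t + Num.sqrt (1 + t ^+ 2)) (fun=> 0) t.

Lemma sqrt1D_ge1 t : 1 <= Num.sqrt (1 + t ^+ 2).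
Proof. by rewrite -[leLHS]sqrtr1 ler_wsqrtr // lerDl sqr_ge0. Qed.

Lemma sqrt1D_neq0 t : Num.sqrt (1 + t ^+ 2) != 0.
Proof. by apply: lt0r_neq0; apply: lt_le_trans (sqrt1D_ge1 t). Qed.

Lemma sqr_sqrt1D t : Num.sqrt (1 + t ^+ 2) ^+ 2 = 1 + t ^+ 2.
Proof. by rewrite sqr_sqrtr // addr_ge0 ?sqr_ge0. Qed.

Lemma real_pathE t : real_path t = (t + Num.sqrt (1 + t ^+ 2))%:C.
Proof. by []. Qed.

Lemma cabs_real_path t : 0 <= t -> cabs (real_path t) = t + Num.sqrt (1 + t ^+ 2).
Proof.
by move=> t0; rewrite real_pathE cabs_real ger0_norm // addr_ge0 ?sqrtr_ge0.
Qed.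

Lemma sqrt1D_cont : continuous (fun t : R => Num.sqrt (1 + t ^+ 2)).
Proof.
move=> t; apply: continuous_comp; last exact: sqrt_continuous.
apply: cvgD; first exact: cvg_cst.
by apply: cvgM; apply: cvg_id.
Qed.

Lemma sqrtmD_cont m : continuous (fun t : R => Num.sqrt (m + t ^+ 2)).
Proof.
move=> t; apply: continuous_comp; last exact: sqrt_continuous.
apply: cvgD; first exact: cvg_cst.
by apply: cvgM; apply: cvg_id.
Qed.

Lemma real_path_diff t : diff_at (fun t => t + Num.sqrt (1 + t ^+ 2)) t
  (1 + t / Num.sqrt (1 + t ^+ 2)).
Proof.
have g0 : 0 < 1 + t ^+ 2 by rewrite ltr_pwDl ?sqr_ge0.
have d1 : is_derive t 1 (fun t : R => 1 + t ^+ 2) (2 * t).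
  by apply: is_derive_eq; rewrite /GRing.scale /=; ring.
have d2 := is_derive1_sqrt g0.
have h := @is_derive1_comp _ (@Num.sqrt R) (fun t : R => 1 + t ^+ 2) t _ _ d2 d1.
have h' := is_deriveD (is_derive_id t 1) h.
apply: diff_at_eq (is_derive_diff_at h').
have s0 : Num.sqrt (1 + t ^+ 2) != 0 by apply: lt0r_neq0; rewrite sqrtr_gt0.
by field.
Qed.

Lemma Psi1_real_path m t : 0 < m -> m < 1 -> 0 <= t ->
  Psi1 m (real_path t) = (2 * Num.sqrt (m + t ^+ 2))%:C.
Proof.
move=> m0 m1 t0; have s1 := sqrt1D_ge1 t.
have c1 : 1 <= cabs (real_path t) by rewrite cabs_real_path //; lra.
have mt : 0 <= m + t ^+ 2 by rewrite addr_ge0 ?sqr_ge0 // ltW.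
have r0 : 0 <= t + Num.sqrt (1 + t ^+ 2) by lra.
apply: quad1_sqr_real.
- by apply: Psi1_quad1 => //; split.
- by rewrite mulr_ge0 ?sqrtr_ge0.
- rewrite sqr_Psi1_Re // exprMn sqr_sqrtr // cabs_real_path //.
  rewrite -[_ ^+ 4]/(_ ^+ (2 * 2)) exprM /= expr0n subr0.
  have := sqr_sqrt1D t; move: (Num.sqrt _) s1 r0 {c1} => s s1 r0 sE.
  have rs : (t + s) * (s - t) = 1.
    by transitivity (s ^+ 2 - t ^+ 2); [ring|rewrite sE; ring].
  have rn0 : t + s != 0 by apply: lt0r_neq0; lra.
  have iv : (t + s)^-1 = s - t by apply: (mulfI rn0); rewrite mulfV // rs.
  have -> : (t + s) ^+ 2 * (1 + ((t + s) ^+ 2 ^+ 2)^-1) =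
      (t + s) ^+ 2 + (s - t) ^+ 2 by rewrite -iv; field.
  transitivity (2 * s ^+ 2 + 2 * t ^+ 2 - 2 * (1 - 2 * m)); first by ring.
  by rewrite sE; ring.
- by rewrite sqr_Psi1_Im // /= mulr0 mul0r.
Qed.

Lemma Psi_real_path_diff m t : 0 < m -> m < 1 -> 0 < t ->
  diff_at (fun t => rpart 1 (Psi m (real_path t))) t
    (2 * (Num.sqrt (m + t ^+ 2) / Num.sqrt (1 + t ^+ 2))).
Proof.
move=> m0 m1 t0; have d2 : diff_at (fun=> 0 : R) t 0.
  move=> e e0; exists 1 => // s _.
  by rewrite mulr0 !subr0 normr0 mulr_ge0 // ltW.
have s1 := sqrt1D_ge1 t.
set r2 := t + t + 1 + Num.sqrt (1 + (t + t) ^+ 2).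
have := cpath_diff (lexx 1) (Psi_hol m0 m1 r2) 1 (real_path_diff t) d2.
rewrite -/(real_path t) (Psi1_real_path m0 m1 (ltW t0)).
move=> h; apply: diff_at_eq (h _); last first.
  exists t => // s; rewrite ler_norml => st; have s0 : 0 <= s by lra.
  rewrite /annulus -/(real_path s) cabs_real_path // /r2.
  have ss := sqrt1D_ge1 s; apply/andP; split; first by lra.
  apply: lerD; first by lra.
  by rewrite ler_wsqrtr // lerD2l lerXn2r ?nnegrE; lra.
rewrite rpart1 {h}.
have sn0 : Num.sqrt (1 + t ^+ 2) != 0 by apply: lt0r_neq0; lra.
have rn0 : t + Num.sqrt (1 + t ^+ 2) != 0 by apply: lt0r_neq0; lra.
have -> : (1 + t / Num.sqrt (1 + t ^+ 2)) +i* 0 =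
    ((t + Num.sqrt (1 + t ^+ 2)) / Num.sqrt (1 + t ^+ 2))%:C.
  by apply: complex_eq => //=; field.
rewrite real_pathE -fmorphV -!rmorphM /=.
by field; rewrite sn0 rn0.
Qed.

Lemma Psi_real_integral m q : 0 < m -> m < 1 -> 0 < q -> q < 1 ->
  complex.Re (Psi m (q^-1)%:C) = complex.Re (Psi m 1) + 2 *
  \int[@lebesgue_measure R]_(s in `[0, 2^-1 * (q^-1 - q)])
        (Num.sqrt (m + s ^+ 2) / Num.sqrt (1 + s ^+ 2)).
Proof.
move=> m0 m1 q0 q1; set S := 2^-1 * (q^-1 - q).
have q11 : 1 < q^-1 by rewrite invf_gt1.
have S0 : 0 < S by rewrite /S; lra.
have cg : {within `[0, S], continuous (fun s : R => Num.sqrt (m + s ^+ 2) / Num.sqrt (1 + s ^+ 2))}.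
  apply: continuous_subspaceT => t; apply: cvgM; first exact: sqrtmD_cont.
  apply: cvgV; last exact: sqrt1D_cont.
  exact: sqrt1D_neq0.
rewrite -RintegralZl //; last exact: itv_integrable.
pose f t := rpart 1 (Psi m (real_path t)).
have E0 : f 0 = complex.Re (Psi m 1).
  rewrite /f rpart1; congr (complex.Re (Psi m _)).
  by rewrite real_pathE expr0n addr0 sqrtr1 add0r.
have E1 : f S = complex.Re (Psi m (q^-1)%:C).
  rewrite /f rpart1; congr (complex.Re (Psi m _)).
  rewrite real_pathE; congr (_%:C).
  have -> : 1 + S ^+ 2 = (2^-1 * (q^-1 + q)) ^+ 2.
    by rewrite /S; field; exact: lt0r_neq0.
  rewrite sqrtr_sqr ger0_norm; last by rewrite mulr_ge0 // addr_ge0 // ltW //; lra.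
  by rewrite /S; field; exact: lt0r_neq0.
have h : \int[@lebesgue_measure R]_(s in `[0, S])
    (2 * (Num.sqrt (m + s ^+ 2) / Num.sqrt (1 + s ^+ 2))) = f S - f 0.
  apply: diff_FTC => //.
  - apply: continuous_subspaceT => t; apply: cvgM; first exact: cvg_cst.
    apply: cvgM; first exact: sqrtmD_cont.
    apply: cvgV; last exact: sqrt1D_cont.
    exact: sqrt1D_neq0.
  - apply: (cpath_cont (lexx 1) (Psi_hol m0 m1 (S + Num.sqrt (1 + S ^+ 2)))).
    + by apply: continuous_cont_in => t; apply: cvgD; [apply: cvg_id|apply: sqrt1D_cont].
    + by apply: continuous_cont_in => t; apply: cvg_cst.
    + move=> t /andP[t0 tS]; rewrite /annulus -/(real_path t) cabs_real_path //.
      have ss := sqrt1D_ge1 t; apply/andP; split.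
        by apply: le_trans ss _; rewrite lerDr.
      apply: (lerD tS); rewrite ler_wsqrtr // lerD2l.
      by apply: (lerXn2r _ _ _ tS); rewrite nnegrE //; apply: ltW.
  - by move=> t /andP[t0 _]; apply: Psi_real_path_diff.
rewrite h; clearbody f; apply: (etrans (esym E1)).
apply: (etrans _ (congr1 (fun x => x + (f S - f 0)) E0)).
by rewrite addrC subrK.
Qed.

End Complement.

(** * Cauchy's theorem by averages over roots of unity *)

Section Means.
Variable R : realType.
Implicit Types (w z : R[i]) (F G : R[i] -> R[i]) (r : R) (N : nat).

Definition node N r (j : nat) : R[i] := circ r (2 * pi * j%:R / N%:R).
Definition root1 N : R[i] := circ 1 (2 * pi / N%:R).
(** Averages over scaled roots of unity play the part of the contour integrals
    of F w / w over the circle of radius r, divided by 2 pi 'i. *)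
Definition mean F r N : R[i] := N%:R^-1 * \sum_(j < N) F (node N r j).
Definition mlim F r z := ccvg (mean F r) z.

Lemma cabs_node N r j : 0 <= r -> cabs (node N r j) = r.
Proof. exact: cabs_circ. Qed.

Lemma node_scale N r (c : R) j : node N (c * r) j = c%:C * node N r j.
Proof. by apply: complex_eq; rewrite !ReImE /=; ring. Qed.

Lemma circD r s t : circ r (s + t) = circ r s * circ 1 t.
Proof. by apply: complex_eq; rewrite !ReImE /= ?cosD ?sinD; ring. Qed.

Lemma nodeS N r j : node N r j.+1 = node N r j * root1 N.
Proof.
by rewrite -circD; congr circ; rewrite -natr1; ring.
Qed.

Lemma node_period N r : (0 < N)%N -> node N r N = node N r 0.
Proof.
move=> N0; have N0' : N%:R != 0 :> R by rewrite pnatr_eq0 -lt0n.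
rewrite /node mulr0 mul0r mulfK //.
have p2 : 2 * pi = pi + pi :> R by ring.
apply: complex_eq; rewrite /= p2; first by rewrite cosDpi cospi cos0 opprK.
by rewrite sinDpi sinpi sin0 oppr0.
Qed.

Lemma root1_neq1 N : (2 < N)%N -> root1 N != 1.
Proof.
move=> N2; have p0 := pi_gt0 R; apply/eqP => /(congr1 (@complex.Im R)) /=.
have N0 : 0 < N%:R :> R by rewrite ltr0n; lia.
rewrite mul1r => s0; have : 0 < sin (2 * pi / N%:R : R).
  apply: sin_gt0_pi; rewrite divr_gt0 ?mulr_gt0 // ltr_pdivrMr //.
  by rewrite mulrC ltr_pM2l // (ltr_nat R 2 N).
by rewrite s0 ltxx.
Qed.

Lemma root1_cvg : ccvg root1 1.
Proof.
have p0 := pi_gt0 R.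
have cc (f : R -> R) : continuous f -> forall e : R, 0 < e -> exists J0, forall J,
    (J0 <= J)%N -> `|f (2 * pi / J%:R) - f 0| <= e.
  move=> fc e e0.
  have /cvgrPdist_le/(_ e e0)/nbhs_ballP[d' /= d'0 hd'] := fc 0.
  exists (Num.truncn (2 * pi / d')).+1 => J hJ.
  have J0 : 0 < J%:R :> R by rewrite ltr0n; lia.
  rewrite distrC; apply: hd'; rewrite /ball /= sub0r normrN ger0_norm; last first.
    by rewrite divr_ge0 ?mulr_ge0 // ltW.
  rewrite ltr_pdivrMr // [ltRHS]mulrC -ltr_pdivrMr //.
  by apply: (lt_le_trans (truncnS_gt _)); rewrite ler_nat.
move=> e e0; have e2 : 0 < e / 2 by lra.
have [J1 h1] := cc _ (@continuous_cos R) _ e2.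
have [J2 h2] := cc _ (@continuous_sin R) _ e2.
exists (maxn J1 J2) => J; rewrite geq_max => /andP[/h1 k1 /h2 k2].
apply: le_trans (cabs_le _) _; rewrite !ReImE /= !mul1r.
by move: k1 k2; rewrite cos0 sin0; lra.
Qed.

Lemma mean_le F r (M : R) N : 0 <= r -> 0 <= M ->
  (forall w, cabs w = r -> cabs (F w) <= M) -> cabs (mean F r N) <= M.
Proof.
move=> r0 M0 hF; case: N => [|N].
  by rewrite /mean big_ord0 mulr0 cabs0.
rewrite cabsM cabsV cabs_nat mulrC ler_pdivrMr ?ltr0Sn //.
apply: le_trans (cabs_sum _ _ _) _.
apply: (@le_trans _ _ (\sum_(j < N.+1) M)).
  by apply: ler_sum => j _; apply: hF; apply: cabs_node.
by rewrite sumr_const card_ord -[leLHS]mulr_natr.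
Qed.

Lemma meanD F G r N : mean (fun w => F w + G w) r N = mean F r N + mean G r N.
Proof. by rewrite /mean big_split mulrDr. Qed.

Lemma meanB F G r N : mean (fun w => F w - G w) r N = mean F r N - mean G r N.
Proof. by rewrite /mean sumrB mulrBr. Qed.

Lemma meanZ F r z N : mean (fun w => z * F w) r N = z * mean F r N.
Proof. by rewrite /mean -mulr_sumr mulrCA. Qed.

Lemma mean_conj F r N : mean (fun w => conjc (F w)) r N = conjc (mean F r N).
Proof.
rewrite /mean; have -> : conjc (N%:R^-1 * \sum_(j < N) F (node N r j)) =
    conjc N%:R^-1 * conjc (\sum_(j < N) F (node N r j)) by exact: rmorphM.
have -> : conjc (N%:R^-1 : R[i]) = N%:R^-1.
  by rewrite -[LHS]/((N%:R^-1 : R[i])^*) fmorphV rmorph_nat.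
by congr (_ * _); rewrite -[RHS]/((\sum_(j < N) F (node N r j))^*) rmorph_sum.
Qed.

Lemma eq_mean F G r N : 0 <= r -> (forall w, cabs w = r -> F w = G w) ->
  mean F r N = mean G r N.
Proof.
move=> r0 h; congr (_ * _); apply: eq_bigr => j _; apply: h.
exact: cabs_node.
Qed.

Lemma mean_cst z r N : (0 < N)%N -> mean (fun=> z) r N = z.
Proof.
move=> N0; rewrite /mean sumr_const card_ord -[z *+ N]mulr_natl mulKf //.
by rewrite pnatr_eq0 -lt0n.
Qed.

Lemma eq_mlim F G r z : 0 <= r -> (forall w, cabs w = r -> F w = G w) ->
  mlim F r z -> mlim G r z.
Proof. by move=> r0 h; apply: eq_ccvg => N; apply: eq_mean. Qed.

Lemma mlimD F G r x y : mlim F r x -> mlim G r y ->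
  mlim (fun w => F w + G w) r (x + y).
Proof. by move=> hF hG; apply: eq_ccvg (ccvgD hF hG) => N; rewrite meanD. Qed.

Lemma mlimZ F r x z : mlim F r x -> mlim (fun w => z * F w) r (z * x).
Proof. by move=> hF; apply: eq_ccvg (ccvgZ z hF) => N; rewrite meanZ. Qed.

Lemma mlim_conj F r x : mlim F r x -> mlim (fun w => conjc (F w)) r (conjc x).
Proof. by move=> hF; apply: eq_ccvg (ccvg_conj hF) => N; rewrite mean_conj. Qed.

Lemma mlim_cst z r : mlim (fun=> z) r z.
Proof.
move=> e e0; exists 1%N => N N0.
by rewrite mean_cst // subrr cabs0 ltW.
Qed.

Lemma mlim_sum I (s : seq I) (F : I -> R[i] -> R[i]) r (x : I -> R[i]) :
  (forall i, mlim (F i) r (x i)) ->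
  mlim (fun w => \sum_(i <- s) F i w) r (\sum_(i <- s) x i).
Proof.
move=> h; elim: s => [|i s IH].
  rewrite big_nil; apply: eq_ccvg (mlim_cst 0 r) => N.
  by congr (_ * _); apply: eq_bigr => j _; rewrite big_nil.
rewrite big_cons; apply: eq_ccvg (mlimD (h i) IH) => N.
by congr (_ * _); apply: eq_bigr => j _; rewrite big_cons.
Qed.

Lemma mlim_le F r x (M : R) : 0 <= r -> 0 <= M ->
  (forall w, cabs w = r -> cabs (F w) <= M) -> mlim F r x -> cabs x <= M.
Proof. by move=> r0 M0 h hF; apply: (ccvg_le hF) => N; apply: mean_le. Qed.

(** The averages of a logarithmic derivative are Riemann sums of a closed
    loop integral. *)
Lemma mean_deriv_small r1 r2 F F1 e : 1 <= r1 -> hol r1 r2 F F1 -> 0 < e ->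
  exists N0, forall N r, (N0 <= N)%N -> r1 <= r -> r <= r2 ->
    cabs (mean F1 r N) <= e.
Proof.
move=> r11 [_ hF] e0; have s0 : 0 < `|r2| + 1 by rewrite ltr_wpDl.
have e1 : 0 < e / (`|r2| + 1) by rewrite divr_gt0.
have [d d0 hd] := hF _ e1.
have d1 : 0 < d / (`|r2| + 1) by rewrite divr_gt0.
have [J hJ] := root1_cvg d1.
exists (maxn 3 J) => N r; rewrite geq_max => /andP[N3 /hJ zN] r1r rr2.
have r0 : 0 < r by lra.
have r2r : r <= `|r2| + 1 by have := ler_norm r2; lra.
have N0 : (0 < N)%N by exact: leq_trans N3.
set z := root1 N in zN *; have z1 : z - 1 != 0 by rewrite subr_eq0 root1_neq1.
have tele : \sum_(j < N) (F (node N r j.+1) - F (node N r j)) = 0.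
  rewrite -(big_mkord xpredT (fun j => F (node N r j.+1) - F (node N r j))).
  by rewrite telescope_sumr // node_period // subrr.
have ann j : annulus r1 r2 (node N r j).
  by rewrite /annulus cabs_node ?r1r ?rr2 // ltW.
have stp j : cabs (F (node N r j.+1) - F (node N r j) - F1 (node N r j) * (z - 1))
    <= e / (`|r2| + 1) * (r * cabs (z - 1)).
  have w0 : node N r j != 0 by rewrite -cabs_gt0 cabs_node // ltW.
  have E : node N r j.+1 - node N r j = node N r j * (z - 1).
    by rewrite nodeS -/z; ring.
  have cE : cabs (node N r j.+1 - node N r j) = r * cabs (z - 1).
    by rewrite E cabsM cabs_node // ltW.
  have := hd _ _ (ann j) (ann j.+1); rewrite cE.
  have -> : node N r j.+1 / node N r j = z by rewrite nodeS mulrAC mulfV // mul1r.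
  apply; have c0 := cabs_ge0 (z - 1).
  have : cabs (z - 1) * (`|r2| + 1) <= d by rewrite -ler_pdivlMr.
  apply: le_trans; rewrite mulrC; exact: ler_wpM2l.
have : cabs (\sum_(j < N) F1 (node N r j) * (z - 1)) <=
    \sum_(j < N) e / (`|r2| + 1) * (r * cabs (z - 1)).
  have -> : \sum_(j < N) F1 (node N r j) * (z - 1) =
    - \sum_(j < N) (F (node N r j.+1) - F (node N r j) - F1 (node N r j) * (z - 1)).
    by rewrite [in RHS]sumrB tele sub0r opprK.
  rewrite cabsN.
  by apply: le_trans (cabs_sum _ _ _) _; apply: ler_sum => j _; apply: stp.
rewrite -mulr_suml cabsM sumr_const card_ord -[leRHS]mulr_natr.
have c0 : 0 < cabs (z - 1) by rewrite cabs_gt0.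
have -> : e / (`|r2| + 1) * (r * cabs (z - 1)) * N%:R =
  e / (`|r2| + 1) * r * N%:R * cabs (z - 1) by ring.
rewrite ler_pM2r // => h.
have N0' : 0 < N%:R :> R by rewrite ltr0n.
rewrite /mean cabsM cabsV cabs_nat mulrC ler_pdivrMr //.
apply: le_trans h _; rewrite ler_pM2r // -mulrA ler_piMr ?ltW //.
rewrite mulrC ltr_pdivrMr // mul1r; apply: le_lt_trans rr2 _.
by apply: le_lt_trans (ler_norm _) _; rewrite ltrDl.
Qed.

Lemma mlim_deriv r F F1 : 1 <= r -> hol r r F F1 -> mlim F1 r 0.
Proof.
move=> r1 hF e e0; have [N0 h] := mean_deriv_small r1 hF e0.
by exists N0 => N N0N; rewrite subr0; apply: h.
Qed.

(** The average over a circle changes with the radius at the rate of an average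
    of F1, which is small by mean_deriv_small. *)
Lemma mean_homotopy r1 r2 F F1 e : 1 <= r1 -> r1 <= r2 -> hol r1 r2 F F1 -> 0 < e ->
  exists N0, forall N, (N0 <= N)%N -> cabs (mean F r2 N - mean F r1 N) <= e.
Proof.
move=> r11 r12 hF e0; set D := r2 - r1.
have D0 : 0 <= D by rewrite subr_ge0.
have e1 : 0 < e / (2 * (D + 1)) by rewrite divr_gt0 // mulr_gt0 // ltr_wpDl.
have [N1 h1] := mean_deriv_small r11 hF e1.
case: hF => _ /(_ _ e1)[d d0 hd].
exists (maxn N1 (Num.truncn (D / d)).+1) => N; rewrite geq_max => /andP[N1N dN].
have N0 : (0 < N)%N by exact: leq_trans dN.
have N0' : 0 < N%:R :> R by rewrite ltr0n.
pose rho (i : nat) := r1 + i%:R * (D / N%:R).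
have DN0 : 0 <= D / N%:R by rewrite divr_ge0.
have DNd : D / N%:R <= d.
  rewrite ler_pdivrMr // mulrC -ler_pdivrMr // ltW //.
  by apply: (lt_le_trans (truncnS_gt _)); rewrite ler_nat.
have rho0 : rho 0%N = r1 by rewrite /rho mul0r addr0.
have rhoN : rho N = r2 by rewrite /rho mulrC divfK ?lt0r_neq0 // addrC subrK.
have rhoS i : rho i.+1 = rho i + D / N%:R by rewrite /rho -natr1; ring.
have rho1 i : r1 <= rho i by rewrite lerDl mulr_ge0.
have rho2 i : (i <= N)%N -> rho i <= r2.
  move=> iN; rewrite -rhoN lerD2l ler_wpM2r // ler_nat //.
have stp i : (i < N)%N -> cabs (mean F (rho i.+1) N - mean F (rho i) N) <=
    e / (D + 1) * (D / N%:R).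
  move=> iN; have ri := rho1 i; have ri' := rho2 i (ltnW iN).
  have rS := rho1 i.+1; have rS' := rho2 i.+1 iN.
  have rp : 1 <= rho i by apply: le_trans ri.
  have rp0 : 0 <= rho i by apply: le_trans rp.
  have rn0 : rho i != 0 by apply: lt0r_neq0; apply: lt_le_trans rp.
  set t := (rho i.+1 / rho i - 1)%:C : R[i].
  have ndE j : node N (rho i.+1) j = (rho i.+1 / rho i)%:C * node N (rho i) j.
    by rewrite -node_scale divfK.
  have split_mean : mean F (rho i.+1) N - mean F (rho i) N =
      N%:R^-1 * \sum_(j < N) (F (node N (rho i.+1) j) - F (node N (rho i) j)
         - F1 (node N (rho i) j) * t) + mean F1 (rho i) N * t.
    rewrite /mean -mulrA -mulrDr mulr_suml -big_split /= -mulrBr -sumrB.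
    by congr (_ * _); apply: eq_bigr => j _; rewrite subrK.
  have tE : cabs t <= D / N%:R.
    have rgt : 0 < rho i by apply: lt_le_trans rp.
    have -> : t = (D / N%:R / rho i)%:C.
      by congr (_%:C); rewrite rhoS mulrDl divff // addrAC subrr add0r.
    rewrite cabs_real ger0_norm ?divr_ge0 // ler_pdivrMr //.
    by rewrite ler_peMr.
  rewrite split_mean; apply: le_trans (cabsD _ _) _.
  have p1 : cabs (N%:R^-1 * \sum_(j < N) (F (node N (rho i.+1) j) -
      F (node N (rho i) j) - F1 (node N (rho i) j) * t)) <=
      e / (2 * (D + 1)) * (D / N%:R).
    rewrite cabsM cabsV cabs_nat mulrC ler_pdivrMr //.
    apply: le_trans (cabs_sum _ _ _) _.
    apply: (@le_trans _ _ (\sum_(j < N) e / (2 * (D + 1)) * (D / N%:R))).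
      apply: ler_sum => j _.
      have a1 : annulus r1 r2 (node N (rho i) j).
        by rewrite /annulus cabs_node // ri ri'.
      have a2 : annulus r1 r2 (node N (rho i.+1) j).
        by rewrite /annulus cabs_node ?rS ?rS' //; apply: le_trans rS; lra.
      have w0 := annulus_neq0 r11 a1.
      have dE : cabs (node N (rho i.+1) j - node N (rho i) j) = D / N%:R.
        rewrite ndE -{2}[node N (rho i) j]mul1r -mulrBl cabsM cabs_node //.
        have -> : (rho i.+1 / rho i)%:C - 1 = ((D / N%:R) / rho i)%:C :> R[i].
          rewrite -(rmorph1 (real_complex R)) -rmorphB /=; congr (_%:C).
          by rewrite rhoS mulrDl divff // addrAC subrr add0r.
        by rewrite cabs_real ger0_norm ?divr_ge0 // divfK.
      have := hd _ _ a1 a2; rewrite dE => /(_ DNd).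
      have -> // : node N (rho i.+1) j / node N (rho i) j - 1 = t.
      rewrite ndE mulfK // /t -(rmorph1 (real_complex R)) -rmorphB //.
    by rewrite sumr_const card_ord -[leLHS]mulr_natr.
  have p2 : cabs (mean F1 (rho i) N * t) <= e / (2 * (D + 1)) * (D / N%:R).
    by rewrite cabsM ler_pM ?cabs_ge0 // h1.
  apply: le_trans (lerD p1 p2) _; rewrite -mulrDl ler_wpM2r //.
  by rewrite le_eqVlt; apply/orP; left; apply/eqP; field; apply: lt0r_neq0; rewrite ltr_wpDl.
have -> : mean F r2 N - mean F r1 N =
    \sum_(i < N) (mean F (rho i.+1) N - mean F (rho i) N).
  rewrite -(big_mkord xpredT (fun i => mean F (rho i.+1) N - mean F (rho i) N)).
  by rewrite telescope_sumr // rho0 rhoN.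
apply: le_trans (cabs_sum _ _ _) _.
apply: (@le_trans _ _ (\sum_(i < N) e / (D + 1) * (D / N%:R))).
  by apply: ler_sum => i _; apply: stp.
rewrite sumr_const card_ord -[leLHS]mulr_natr -mulrA divfK ?lt0r_neq0 //.
by rewrite mulrAC ler_pdivrMr ?ltr_wpDl // ler_wpM2l ?ltW //; lra.
Qed.

(** Letting the outer radius grow leaves only the value at infinity. *)
Lemma mlim_infty r1 F z : 1 <= r1 ->
  (forall r2, exists F1, hol r1 r2 F F1) ->
  (forall e : R, 0 < e -> exists2 r2, r1 <= r2 & forall w, cabs w = r2 ->
    cabs (F w - z) <= e) ->
  mlim F r1 z.
Proof.
move=> r11 hF hz e e0; have e2 : 0 < e / 2 by lra.
have [r2 r12 h2] := hz _ e2; have [F1 h1] := hF r2.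
have [N0 hN] := mean_homotopy r11 r12 h1 e2.
exists (maxn 1 N0) => N; rewrite geq_max => /andP[N1 /hN k1].
have k2 : cabs (mean F r2 N - z) <= e / 2.
  have r20 : 0 <= r2 by lra.
  rewrite -{1}(mean_cst z r2 N1) -meanB; apply: mean_le => //; exact: ltW.
have := cabs_dist (mean F r1 N - z) (mean F r2 N - z).
have -> : mean F r1 N - z - (mean F r2 N - z) = - (mean F r2 N - mean F r1 N) by ring.
by rewrite cabsN; lra.
Qed.

End Means.

(** * Hermitian inner product and operator norm *)

Section InnerProduct.
Variable R : realType.
Implicit Types (m n : nat) (z : R[i]).

Lemma conjCE z : Num.conj z = conjc z.
Proof. by []. Qed.

Lemma cdotE n (x y : 'cV[R[i]]_n) : cdot x y = \sum_i conjc (x i 0) * y i 0.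
Proof. by rewrite /cdot mxE; apply: eq_bigr => i _; rewrite !mxE. Qed.

Lemma cdotDr n (x y y' : 'cV[R[i]]_n) : cdot x (y + y') = cdot x y + cdot x y'.
Proof. by rewrite /cdot mulmxDr mxE. Qed.

Lemma cdotZr n (x y : 'cV[R[i]]_n) z : cdot x (z *: y) = z * cdot x y.
Proof. by rewrite /cdot -scalemxAr mxE. Qed.

Lemma cdotNr n (x y : 'cV[R[i]]_n) : cdot x (- y) = - cdot x y.
Proof. by rewrite -scaleN1r cdotZr mulN1r. Qed.

Lemma cdotBr n (x y y' : 'cV[R[i]]_n) : cdot x (y - y') = cdot x y - cdot x y'.
Proof. by rewrite cdotDr cdotNr. Qed.

Lemma cdot0r n (x : 'cV[R[i]]_n) : cdot x 0 = 0.
Proof. by rewrite /cdot mulmx0 mxE. Qed.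

Lemma cdot_conj n (x y : 'cV[R[i]]_n) : conjc (cdot x y) = cdot y x.
Proof.
rewrite !cdotE -[LHS]/((\sum_i conjc (x i 0) * y i 0)^*) rmorph_sum.
apply: eq_bigr => i _; rewrite rmorphM /= conjcK mulrC //.
Qed.

Lemma cdotDl n (x x' y : 'cV[R[i]]_n) : cdot (x + x') y = cdot x y + cdot x' y.
Proof.
rewrite -[LHS]conjcK cdot_conj cdotDr.
by rewrite -[LHS]/((cdot y x + cdot y x')^*) rmorphD /= !cdot_conj.
Qed.

Lemma cdotZl n (x y : 'cV[R[i]]_n) z : cdot (z *: x) y = conjc z * cdot x y.
Proof.
rewrite -[LHS]conjcK cdot_conj cdotZr.
by rewrite -[LHS]/((z * cdot y x)^*) rmorphM /= cdot_conj.
Qed.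

Lemma cdotNl n (x y : 'cV[R[i]]_n) : cdot (- x) y = - cdot x y.
Proof.
rewrite -scaleN1r cdotZl.
have -> : conjc (-1 : R[i]) = -1.
  by apply: complex_eq; rewrite /= ?opprK ?oppr0.
by rewrite mulN1r.
Qed.

Lemma cdotBl n (x x' y : 'cV[R[i]]_n) : cdot (x - x') y = cdot x y - cdot x' y.
Proof. by rewrite cdotDl cdotNl. Qed.

Lemma cdot_suml n I (s : seq I) (F : I -> 'cV[R[i]]_n) y :
  cdot (\sum_(i <- s) F i) y = \sum_(i <- s) cdot (F i) y.
Proof.
elim/big_rec2: _ => [|i a b _ <-]; last by rewrite cdotDl.
by rewrite /cdot trmx0 map_mx0 mul0mx mxE.
Qed.

Lemma cdot_sumr n I (s : seq I) x (F : I -> 'cV[R[i]]_n) :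
  cdot x (\sum_(i <- s) F i) = \sum_(i <- s) cdot x (F i).
Proof. by elim/big_rec2: _ => [|i a b _ <-]; rewrite ?cdot0r ?cdotDr. Qed.

Lemma enorm_ge0 n (x : 'cV[R[i]]_n) : 0 <= enorm x.
Proof. exact: sqrtr_ge0. Qed.

Lemma sqr_enorm n (x : 'cV[R[i]]_n) : enorm x ^+ 2 = \sum_i cabs (x i 0) ^+ 2.
Proof.
rewrite sqr_sqrtr; first by apply: eq_bigr => i _; rewrite cabsE.
by apply: sumr_ge0 => i _; apply: sqr_ge0.
Qed.

Lemma cdot_self n (x : 'cV[R[i]]_n) : cdot x x = (enorm x ^+ 2)%:C.
Proof.
rewrite cdotE sqr_enorm raddf_sum; apply: eq_bigr => i _ /=.
by rewrite -[LHS]sqr_cabsE.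
Qed.

Lemma enorm_eq0 n (x : 'cV[R[i]]_n) : enorm x = 0 -> x = 0.
Proof.
move=> x0; apply/colP => i; rewrite mxE; apply: cabs_eq0.
have := sqr_enorm x; rewrite x0 expr0n /= => /esym/eqP.
rewrite psumr_eq0 => [|j _]; last exact: sqr_ge0.
by move=> /allP/(_ i); rewrite mem_index_enum => /(_ isT); rewrite sqrf_eq0 => /eqP.
Qed.

Lemma enorm0 n : enorm (0 : 'cV[R[i]]_n) = 0.
Proof.
apply/eqP; rewrite -sqrf_eq0 sqr_enorm big1 // => i _.
by rewrite mxE cabs0 expr0n.
Qed.

Lemma enormZ n (x : 'cV[R[i]]_n) z : enorm (z *: x) = cabs z * enorm x.
Proof.
apply/eqP; rewrite -(@eqrXn2 _ 2) ?mulr_ge0 ?cabs_ge0 ?enorm_ge0 //.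
rewrite exprMn !sqr_enorm mulr_sumr; apply/eqP; apply: eq_bigr => i _.
by rewrite mxE cabsM exprMn.
Qed.

Lemma enormN n (x : 'cV[R[i]]_n) : enorm (- x) = enorm x.
Proof. by rewrite -scaleN1r enormZ cabsN cabs1 mul1r. Qed.

Lemma cdot_le n (x y : 'cV[R[i]]_n) : cabs (cdot x y) <= enorm x * enorm y.
Proof.
have [y0|yn0] := eqVneq (enorm y) 0.
  by rewrite (enorm_eq0 y0) cdot0r cabs0 mulr_ge0 ?enorm_ge0.
have yp : 0 < enorm y by rewrite lt_neqAle eq_sym yn0 enorm_ge0.
have [x0 y0] := (enorm_ge0 x, enorm_ge0 y).
set t := cdot y x.
have ct : cabs (cdot x y) = cabs t by rewrite -cabs_conj -[_^*]/(conjc _) cdot_conj.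
pose u := (enorm y ^+ 2)%:C *: x - t *: y.
have uE : enorm u ^+ 2 = enorm y ^+ 2 * (enorm y ^+ 2 * enorm x ^+ 2 - cabs t ^+ 2).
  apply: complexI; rewrite -[LHS]cdot_self /u.
  rewrite !(cdotBl, cdotBr, cdotZl, cdotZr) !cdot_self.
  rewrite -/t -(cdot_conj y x) -/t.
  rewrite -[conjc _%:C]/(_%:C^*) conjc_real.
  have tt : conjc t * t = (cabs t ^+ 2)%:C by rewrite -[LHS]sqr_cabsE.
  rewrite !rmorphM rmorphB rmorphM /= -tt; ring.
have := sqr_ge0 (enorm u); rewrite uE pmulr_rge0 ?exprn_gt0 // subr_ge0 ct.
rewrite -exprMn [enorm y * _]mulrC => h.
by rewrite -(@ler_pXn2r _ 2) ?nnegrE ?mulr_ge0 ?cabs_ge0.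
Qed.

Lemma enormD n (x y : 'cV[R[i]]_n) : enorm (x + y) <= enorm x + enorm y.
Proof.
have [x0 y0] := (enorm_ge0 x, enorm_ge0 y).
rewrite -(@ler_pXn2r _ 2) ?nnegrE ?addr_ge0 ?enorm_ge0 //.
have : complex.Re (cdot (x + y) (x + y)) = enorm x ^+ 2 + enorm y ^+ 2 +
    2 * complex.Re (cdot x y).
  rewrite !(cdotDl, cdotDr) !cdot_self -(cdot_conj x y) !ReImE /=; ring.
rewrite cdot_self /= => ->.
have := le_trans (ler_norm _) (le_trans (Re_le_cabs _) (cdot_le x y)).
rewrite sqrrD; lra.
Qed.

Lemma enormB n (x y : 'cV[R[i]]_n) : enorm (x - y) <= enorm x + enorm y.
Proof. by rewrite -(enormN y) enormD. Qed.

Lemma enorm_sum n I (s : seq I) (F : I -> 'cV[R[i]]_n) :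
  enorm (\sum_(i <- s) F i) <= \sum_(i <- s) enorm (F i).
Proof.
elim/big_rec2: _ => [|i a b _ h]; first by rewrite enorm0.
by apply: le_trans (enormD _ _) _; rewrite lerD2l.
Qed.

Lemma entry_le_enorm n (x : 'cV[R[i]]_n) i : cabs (x i 0) <= enorm x.
Proof.
rewrite -(@ler_pXn2r _ 2) ?nnegrE ?enorm_ge0 ?cabs_ge0 //.
rewrite sqr_enorm (bigD1 i) //= lerDl sumr_ge0 // => j _; exact: sqr_ge0.
Qed.

Lemma enorm_le_sum n (x : 'cV[R[i]]_n) : enorm x <= \sum_i cabs (x i 0).
Proof.
rewrite -(@ler_pXn2r _ 2) ?nnegrE ?enorm_ge0 ?sumr_ge0 // => [|*]; last exact: cabs_ge0.
rewrite sqr_enorm expr2 mulr_suml; apply: ler_sum => i _.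
rewrite expr2 ler_wpM2l ?cabs_ge0 // (bigD1 i) //= lerDl sumr_ge0 // => j _.
exact: cabs_ge0.
Qed.

Lemma mulmx_bounded m n (M : 'M[R[i]]_(m, n)) :
  exists2 L, 0 <= L & forall x : 'cV_n, enorm (M *m x) <= L * enorm x.
Proof.
exists (\sum_i \sum_j cabs (M i j)).
  by apply: sumr_ge0 => i _; apply: sumr_ge0 => j _; apply: cabs_ge0.
move=> x; apply: le_trans (enorm_le_sum _) _.
rewrite mulr_suml; apply: ler_sum => i _; rewrite mxE.
apply: le_trans (cabs_sum _ _ _) _; rewrite mulr_suml; apply: ler_sum => j _.
by rewrite cabsM ler_wpM2l ?cabs_ge0 ?entry_le_enorm.
Qed.

Lemma mulmx_pow_bounded n (H : 'M[R[i]]_n) L l u : 0 <= L -> (forall u, enorm (H *m u) <= L * enorm u) ->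
  enorm (H ^+ l *m u) <= L ^+ l * enorm u.
Proof.
move=> L0 hL; elim: l u => [|l IH] u; first by rewrite !expr0 mul1mx mul1r.
rewrite exprSr -mulmxE -mulmxA; apply: le_trans (IH _) _.
by rewrite exprSr -mulrA ler_wpM2l ?exprn_ge0.
Qed.

Lemma enorm_opnorm m n (M : 'M[R[i]]_(m, n)) (x : 'cV_n) :
  enorm (M *m x) <= opnorm M * enorm x.
Proof.
have [x0|xn0] := eqVneq (enorm x) 0.
  by rewrite (enorm_eq0 x0) mulmx0 !enorm0 mulr0.
have xp : 0 < enorm x by rewrite lt_neqAle eq_sym xn0 enorm_ge0.
have [L L0 hL] := mulmx_bounded M.
pose u := ((enorm x)^-1)%:C *: x.
have u1 : enorm u = 1.
  by rewrite enormZ cabs_real ger0_norm ?invr_ge0 ?ltW // mulVf.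
rewrite -ler_pdivrMr //.
have -> : enorm (M *m x) / enorm x = enorm (M *m u).
  rewrite -scalemxAr enormZ cabs_real ger0_norm ?invr_ge0 ?ltW //.
  by rewrite mulrC.
apply: ub_le_sup; last by exists u.
exists L => _ [y /= y1 <-].
by apply: le_trans (hL y) _; rewrite y1 mulr1.
Qed.

Lemma opnorm_ge0 n (M : 'M[R[i]]_n) (x : 'cV[R[i]]_n) : enorm x = 1 -> 0 <= opnorm M.
Proof.
move=> x1; have := enorm_opnorm M x; rewrite x1 mulr1.
exact: le_trans (enorm_ge0 _).
Qed.

End InnerProduct.

(** * The resolvent on the level curves *)

Fact resolv_key : unit. Proof. exact: tt. Qed.

Section Resolvent.
Variables (R : realType) (m : R) (d : nat) (H : 'M[R[i]]_d).
Hypotheses (m_gt0 : 0 < m) (m_lt1 : m < 1).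
Implicit Types (u x y : 'cV[R[i]]_d) (w : R[i]) (r : R).

Let m0 := m_gt0.
Let m1 := m_lt1.

(** A condition on the numerical range, homogeneous in u so that no vector needs
    to be normalized. *)
Definition in_rectangle := forall u,
  `|complex.Re (cdot u (H *m u))| <= complex.Re (Psi m (corner m)) * enorm u ^+ 2 /\
  `|complex.Im (cdot u (H *m u))| <= complex.Im (Psi m (corner m)) * enorm u ^+ 2.

Hypothesis Hrect : in_rectangle.

Definition pencil w : 'M[R[i]]_d := (Psi m w)%:M - H.
Definition resolv : R[i] -> 'M[R[i]]_d :=
  locked_with resolv_key (fun w => invmx (pencil w)).

Lemma pencilE w u : pencil w *m u = Psi m w *: u - H *m u.
Proof. by rewrite mulmxBl mul_scalar_mx. Qed.

Lemma enorm_sqr_gt0 u : u != 0 -> 0 < enorm u ^+ 2.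
Proof.
move=> u0; rewrite exprn_gt0 // lt_neqAle enorm_ge0 andbT eq_sym.
by apply/eqP => /enorm_eq0 uz; rewrite uz eqxx in u0.
Qed.

(** A value of the quadratic form on a unit vector is Psi w - h with h in the
    rectangle, to which the support inequality applies. *)
Lemma pencil_normal r1 : 1 < r1 -> exists2 nu, 0 < nu & forall w u, r1 <= cabs w ->
  nu * cabs (Psi1 m w) * enorm u ^+ 2 <=
  rpart (conjc (Psi1 m w)) (cdot u (pencil w *m u)).
Proof.
move=> r11; have [nu nu0 hnu] := support m0 m1 r11; exists nu => // w u rw.
have [->|u0] := eqVneq u 0.
  by rewrite enorm0 expr0n /= mulr0 mulmx0 cdot0r /rpart mulr0.
have n0 := enorm_sqr_gt0 u0.
have nn0 : enorm u ^+ 2 != 0 by apply: lt0r_neq0.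
set h := ((enorm u ^+ 2)^-1)%:C * cdot u (H *m u).
have [hx hy] := Hrect u.
have hx' : `|complex.Re h| <= complex.Re (Psi m (corner m)).
  rewrite /h ReM /= mul0r subr0 normrM ger0_norm ?invr_ge0 ?(ltW n0) //.
  by rewrite mulrC ler_pdivrMr.
have hy' : `|complex.Im h| <= complex.Im (Psi m (corner m)).
  rewrite /h ImM /= mul0r addr0 normrM ger0_norm ?invr_ge0 ?(ltW n0) //.
  by rewrite mulrC ler_pdivrMr.
have E : cdot u (pencil w *m u) = (enorm u ^+ 2)%:C * (Psi m w - h).
  rewrite pencilE cdotBr cdotZr cdot_self mulrBr [_ * Psi m w]mulrC; congr (_ - _).
  by rewrite /h mulrA -rmorphM mulfV //= mul1r.
rewrite E rpartZ mulrC; apply: (ler_wpM2l (ltW n0)).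
exact: hnu rw hx' hy'.
Qed.

Lemma pencil_bounded_below r1 : 1 < r1 -> exists2 nu, 0 < nu & forall w u,
  r1 <= cabs w -> nu * enorm u <= enorm (pencil w *m u).
Proof.
move=> r11; have [nu nu0 hnu] := pencil_normal r11; exists nu => // w u rw.
have w1 : 1 < cabs w by lra.
have N0 : 0 < cabs (Psi1 m w) by rewrite cabs_gt0 Psi1_neq0.
have [u0|un0] := eqVneq (enorm u) 0.
  by rewrite u0 mulr0 enorm_ge0.
have up : 0 < enorm u by rewrite lt_neqAle eq_sym un0 enorm_ge0.
have h := hnu w u rw.
have h2 : rpart (conjc (Psi1 m w)) (cdot u (pencil w *m u)) <=
    cabs (Psi1 m w) * (enorm u * enorm (pencil w *m u)).
  apply: le_trans (ler_norm _) (le_trans (rpart_le _ _) _).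
  by rewrite cabs_conj ler_wpM2l ?cabs_ge0 // cdot_le.
have := le_trans h h2.
have -> : nu * cabs (Psi1 m w) * enorm u ^+ 2 =
  cabs (Psi1 m w) * (enorm u * (nu * enorm u)) by ring.
by rewrite !ler_pM2l.
Qed.

Lemma inj_unitmx (A : 'M[R[i]]_d) : (forall u, A *m u = 0 -> u = 0) -> A \in unitmx.
Proof.
move=> h; rewrite -unitmx_tr -row_free_unit -kermx_eq0; apply/eqP/row_matrixP => i.
rewrite row0; apply: trmx_inj; rewrite trmx0; apply: h.
have : row i (kermx A^T) *m A^T = 0 by rewrite -row_mul mulmx_ker row0.
by move=> /(congr1 trmx); rewrite trmx_mul trmxK trmx0.
Qed.

Lemma pencil_unit w : 1 < cabs w -> pencil w \in unitmx.
Proof.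
move=> w1; have [nu nu0 h] := pencil_bounded_below w1.
apply: inj_unitmx => u u0; apply: enorm_eq0; apply/eqP.
have := h w u (lexx _); rewrite u0 enorm0 pmulr_rle0 // => k.
by rewrite eq_le k enorm_ge0.
Qed.

Lemma pencilK w x : 1 < cabs w -> pencil w *m (resolv w *m x) = x.
Proof. by move=> /pencil_unit wu; rewrite /resolv unlock mulmxA mulmxV // mul1mx. Qed.

Lemma resolvK w x : 1 < cabs w -> resolv w *m (pencil w *m x) = x.
Proof. by move=> /pencil_unit wu; rewrite /resolv unlock mulmxA mulVmx // mul1mx. Qed.

Lemma Psi_resolv w x : 1 < cabs w ->
  Psi m w *: (resolv w *m x) = x + H *m (resolv w *m x).
Proof. by move=> w1; rewrite -{2}(pencilK x w1) pencilE subrK. Qed.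

Lemma H_pencil w x : H *m (pencil w *m x) = pencil w *m (H *m x).
Proof. by rewrite !pencilE mulmxBr -scalemxAr. Qed.

Lemma H_resolv w x : 1 < cabs w -> H *m (resolv w *m x) = resolv w *m (H *m x).
Proof.
move=> w1; rewrite -[LHS](resolvK _ w1); congr (_ *m _).
by rewrite -H_pencil pencilK.
Qed.

Lemma resolv_bound r1 : 1 < r1 -> exists2 K, 0 < K & forall w x, r1 <= cabs w ->
  enorm (resolv w *m x) <= K * enorm x.
Proof.
move=> r11; have [nu nu0 h] := pencil_bounded_below r11.
exists nu^-1; first by rewrite invr_gt0.
move=> w x rw; have w1 : 1 < cabs w by lra.
have := h w (resolv w *m x) rw; rewrite pencilK // => k.
by rewrite mulrC ler_pdivlMr // mulrC.
Qed.

Let resolvB_aux w w' (v : 'cV[R[i]]_d) : 1 < cabs w' ->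
  resolv w' *m (pencil w *m v) - v = - (Psi m w' - Psi m w) *: (resolv w' *m v).
Proof.
move=> w1'; rewrite -[X in _ - X](resolvK v w1') -mulmxBr scalemxAr.
apply: (congr1 (mulmx (resolv w'))).
have -> : pencil w *m v = Psi m w *: v - H *m v by apply: pencilE.
have -> : pencil w' *m v = Psi m w' *: v - H *m v by apply: pencilE.
by rewrite opprB addrA subrK -scalerBl opprB.
Qed.

Lemma resolvB w w' x : 1 < cabs w -> 1 < cabs w' ->
  resolv w' *m x - resolv w *m x =
  - (Psi m w' - Psi m w) *: (resolv w' *m (resolv w *m x)).
Proof.
move=> w1 w1'; have := resolvB_aux w (resolv w *m x) w1'.
by rewrite pencilK.
Qed.

Lemma resolv_hol r1 r2 x y : 1 < r1 ->
  hol r1 r2 (fun w => cdot y (resolv w *m x))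
    (fun w => - (Psi1 m w * cdot y (resolv w *m (resolv w *m x)))).
Proof.
move=> r11; have [K K0 hK] := resolv_bound r11.
have hP : hol r1 r2 (Psi m) (Psi1 m) := hol_sub (ltW r11) (lexx _) (Psi_hol m0 m1 r2).
have [lP lP0 [dP dP0 lipP]] := hol_lip (ltW r11) hP.
case: hP => [[KP hKP] hP].
set X := enorm y * (K * (K * (K * enorm x))) + enorm y * (K * (K * enorm x)) + 1.
have ex := enorm_ge0 x; have ey := enorm_ge0 y; have K0' := ltW K0.
have X2 : 0 <= enorm y * (K * (K * enorm x)) by rewrite !mulr_ge0.
have X3 : 0 <= enorm y * (K * (K * (K * enorm x))) by rewrite !mulr_ge0.
have X0 : 0 < X by rewrite /X; lra.
have X2X : enorm y * (K * (K * enorm x)) <= X by rewrite /X; lra.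
have r1w w : annulus r1 r2 w -> r1 <= cabs w by case/andP.
have b1 w v : r1 <= cabs w -> cabs (cdot y (resolv w *m v)) <= enorm y * (K * enorm v).
  move=> rw; apply: le_trans (cdot_le _ _) _.
  by apply: (ler_wpM2l ey); apply: hK.
have b2 w w' v : r1 <= cabs w -> r1 <= cabs w' ->
    cabs (cdot y (resolv w' *m (resolv w *m v))) <= enorm y * (K * (K * enorm v)).
  move=> rw rw'; apply: le_trans (b1 _ _ rw') _.
  by apply: (ler_wpM2l ey); apply: (ler_wpM2l K0'); apply: hK.
split.
  exists (`|KP| * X + enorm y * (K * enorm x)) => w aw.
  have rw := r1w _ aw; have [_ kp] := hKP _ aw.
  have Y0 : 0 <= enorm y * (K * enorm x) by rewrite !mulr_ge0.
  have Z0 : 0 <= `|KP| * X by rewrite mulr_ge0 // ltW.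
  split.
    by apply: le_trans (b1 _ _ rw) _; rewrite lerDr.
  rewrite cabsN cabsM; apply: (@le_trans _ _ (`|KP| * X)); last by rewrite lerDl.
  apply: ler_pM; rewrite ?cabs_ge0 //; first exact: le_trans kp (ler_norm _).
  exact: le_trans (b2 _ _ _ rw rw) X2X.
move=> e e0; have e2 : 0 < e / (2 * X) by rewrite divr_gt0 // mulr_gt0.
have [d1 d10 h1] := hP _ e2.
have d20 : 0 < e / (2 * X) / lP ^+ 2 by rewrite divr_gt0 // exprn_gt0.
exists (Num.min (Num.min d1 dP) (e / (2 * X) / lP ^+ 2)).
  by rewrite !lt_min d10 dP0 d20.
move=> w w' aw aw'; rewrite !le_min => /andP[/andP[D1 DP] D2].
have rw := r1w _ aw; have rw' := r1w _ aw'.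
have w1 : 1 < cabs w by lra.
have w1' : 1 < cabs w' by lra.
have k1 := h1 _ _ aw aw' D1; have kP := lipP _ _ aw aw' DP.
set v := resolv w *m x.
set t := w' / w - 1 in k1 *; set D := Psi m w' - Psi m w in k1 kP *.
have E : cdot y (resolv w' *m x) - cdot y v - - (Psi1 m w * cdot y (resolv w *m v)) * t
  = - (D - Psi1 m w * t) * cdot y (resolv w *m v)
    + D * D * cdot y (resolv w' *m (resolv w *m v)).
  rewrite -cdotBr (resolvB x w1 w1') -/D -/v cdotZr.
  have -> : resolv w' *m v = resolv w *m v - D *: (resolv w' *m (resolv w *m v)).
    by rewrite -[LHS](subrK (resolv w *m v)) (resolvB v w1 w1') addrC scaleNr.
  by rewrite cdotBr cdotZr; ring.
rewrite E; apply: le_trans (cabsD _ _) _; rewrite !cabsM cabsN.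
have D0 := cabs_ge0 (w' - w).
have p1 : cabs (D - Psi1 m w * t) * cabs (cdot y (resolv w *m v)) <=
    e / (2 * X) * cabs (w' - w) * (enorm y * (K * (K * enorm x))).
  by apply: ler_pM; rewrite ?cabs_ge0 //; apply: b2.
have p2 : cabs D * cabs D * cabs (cdot y (resolv w' *m (resolv w *m v))) <=
    e / (2 * X) * cabs (w' - w) * (enorm y * (K * (K * (K * enorm x)))).
  apply: ler_pM; rewrite ?mulr_ge0 ?cabs_ge0 //; last first.
    apply: le_trans (b2 _ _ _ rw rw') _.
    by apply: (ler_wpM2l ey); do 2![apply: (ler_wpM2l K0')]; apply: hK.
  apply: (@le_trans _ _ ((lP * cabs (w' - w)) * (lP * cabs (w' - w)))).
    by apply: ler_pM; rewrite ?cabs_ge0.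
  have -> : lP * cabs (w' - w) * (lP * cabs (w' - w)) =
    cabs (w' - w) * lP ^+ 2 * cabs (w' - w) by ring.
  by rewrite ler_wpM2r // -ler_pdivlMr // exprn_gt0.
apply: le_trans (lerD p1 p2) _; rewrite -mulrDr.
have XX : enorm y * (K * (K * enorm x)) + enorm y * (K * (K * (K * enorm x))) <= X.
  by rewrite /X; lra.
have q0 : 0 <= e / (2 * X) * cabs (w' - w) by rewrite mulr_ge0 // ltW.
apply: le_trans (ler_wpM2l q0 XX) _.
have -> : e / (2 * X) * cabs (w' - w) * X = e * cabs (w' - w) / 2.
  by field; apply: lt0r_neq0.
rewrite ler_pdivrMr // mulr_natr mulr2n lerDl.
by apply: mulr_ge0 => //; apply: ltW.
Qed.

(** Scalar components of the positive real operator function that generates the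
    Faber polynomials of the rectangle. *)
Definition gfun y x w : R[i] := Psi1 m w * cdot y (resolv w *m x).

Lemma gfun_hol r1 r2 x y : 1 < r1 -> exists F1, hol r1 r2 (gfun y x) F1.
Proof.
move=> r11; have [F1 h1] := Psi1_hol m0 m1 r2 r11.
by eexists; apply: holM (ltW r11) h1 (resolv_hol r2 x y r11).
Qed.

Lemma gfunDr y x x' w : gfun y (x + x') w = gfun y x w + gfun y x' w.
Proof. by rewrite /gfun mulmxDr cdotDr mulrDr. Qed.

Lemma gfunDl y y' x w : gfun (y + y') x w = gfun y x w + gfun y' x w.
Proof. by rewrite /gfun cdotDl mulrDr. Qed.

Lemma gfunZr y x z w : gfun y (z *: x) w = z * gfun y x w.
Proof. by rewrite /gfun -scalemxAr cdotZr mulrCA. Qed.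

Lemma gfunZl y x z w : gfun (z *: y) x w = conjc z * gfun y x w.
Proof. by rewrite /gfun cdotZl mulrCA. Qed.

Lemma Re_gfun_ge0 x w : 1 < cabs w -> 0 <= complex.Re (gfun x x w).
Proof.
move=> w1; have [nu nu0 h] := pencil_normal w1.
set u := resolv w *m x.
have := h w u (lexx _).
have -> : rpart (conjc (Psi1 m w)) (cdot u (pencil w *m u)) = complex.Re (gfun x x w).
  rewrite /rpart /gfun -/u /u (pencilK x w1) -/u -(cdot_conj x u).
  rewrite -[LHS]Re_conj; congr complex.Re.
  rewrite -[LHS]/((conjc (Psi1 m w) * conjc (cdot x u))^*) rmorphM.
  by congr (_ * _); apply: conjcK.
apply: le_trans; rewrite !mulr_ge0 ?cabs_ge0 ?exprn_ge0 ?enorm_ge0 //.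
exact: ltW.
Qed.

(** Cauchy-Schwarz for the real part of the operator function. *)
Lemma gfun_cross x y w : 1 < cabs w ->
  cabs (gfun y x w + conjc (gfun x y w)) <=
  complex.Re (gfun x x w + gfun y y w).
Proof.
move=> w1; set P := _ + conjc _.
have [P0|P0] := eqVneq P 0.
  by rewrite P0 cabs0 ReD addr_ge0 ?Re_gfun_ge0.
have Pp : 0 < cabs P by rewrite cabs_gt0.
(* the phase that turns P into - |P| *)
pose th : R[i] := - P / (cabs P)%:C.
have := Re_gfun_ge0 (x + th *: y) w1.
rewrite gfunDr !gfunDl !gfunZr !gfunZl.
have thP : complex.Re (conjc th * P) = - cabs P.
  have -> : conjc th * P = - (cabs P)%:C.
    have -> : conjc th = - conjc P / (cabs P)%:C.
      rewrite -[LHS]/((- P / (cabs P)%:C)^*) rmorphM fmorphV rmorphN.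
      by congr (_ / _); apply: conjc_real.
    rewrite mulrAC mulNr -[conjc P * P]sqr_cabsE expr2 rmorphM /= -mulNr mulfK //.
    by rewrite -cabs_gt0 cabs_real gtr0_norm.
  by rewrite ReN.
have thn : conjc th * th = 1.
  rewrite -[LHS]sqr_cabsE /th cabsM cabsN cabsV cabs_real (gtr0_norm Pp).
  by rewrite mulfV ?expr1n // lt0r_neq0.
have thE : complex.Re (conjc th * P) =
    complex.Re (conjc th * gfun y x w) + complex.Re (th * gfun x y w).
  have cc (a b : R[i]) : complex.Re (conjc a * conjc b) = complex.Re (a * b).
    by rewrite !ReImE; ring.
  by rewrite /P mulrDr ReD cc.
rewrite mulrA [th * conjc th]mulrC thn mul1r; rewrite thP in thE.
rewrite !ReD; move: thE.
move: (complex.Re (conjc th * _)) (complex.Re (th * _)) => a b E h.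
move: h; rewrite -[X in _ <= X -> _]addrA.
move: (complex.Re (gfun x x w)) (complex.Re (gfun y y w)) E => X Y E h; lra.
Qed.

Lemma resolv_far : exists2 W, 1 < W & forall w x, W <= cabs w ->
  enorm (resolv w *m x) <= 2 / cabs w * enorm x /\ cabs w / 2 <= cabs (Psi m w).
Proof.
have [L L0 hL] := mulmx_bounded H.
exists (2 * (4 + L)); first by lra.
move=> w x hw; have w1 : 1 < cabs w by lra.
have hP := Psi_asym m0 m1 (ltW w1).
have P2 : cabs w / 2 + L <= cabs (Psi m w).
  have := cabs_dist w (Psi m w); rewrite cabs_distC; lra.
split; last by lra.
set u := resolv w *m x.
have := Psi_resolv x w1; rewrite -/u => E.
have h1 : cabs (Psi m w) * enorm u <= enorm x + L * enorm u.
  rewrite -enormZ E; apply: le_trans (enormD _ _) _.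
  by rewrite lerD2l.
have u0 := enorm_ge0 u.
have := ler_wpM2r u0 P2 => h2.
have h3 : cabs w / 2 * enorm u <= enorm x by lra.
have wp : 0 < cabs w by lra.
have -> : 2 / cabs w * enorm x = enorm x / (cabs w / 2) by field; apply: lt0r_neq0.
by rewrite ler_pdivlMr ?divr_gt0 // mulrC.
Qed.

(** The residue at infinity of the resolvent component. *)
Lemma gfun_far x y : exists2 K, 0 <= K & exists2 W, 1 < W & forall w, W <= cabs w ->
  cabs (gfun y x w - cdot y x) <= K / cabs w.
Proof.
have [L L0 hL] := mulmx_bounded H; have [W W1 hW] := resolv_far.
have ex := enorm_ge0 x; have ey := enorm_ge0 y.
exists (enorm y * (8 + L) * (2 * enorm x)).
  by rewrite !mulr_ge0 // addr_ge0.
exists W => // w hw; have w1 : 1 < cabs w by lra.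
have [hR _] := hW w x hw.
have -> : gfun y x w - cdot y x = (Psi1 m w - Psi m w) * cdot y (resolv w *m x) +
    cdot y (H *m (resolv w *m x)).
  have := congr1 (cdot y) (Psi_resolv x w1); rewrite cdotZr cdotDr /gfun => E.
  by rewrite mulrBl E; ring.
have NP : cabs (Psi1 m w - Psi m w) <= 8.
  have -> : Psi1 m w - Psi m w = (Psi1 m w - w) - (Psi m w - w) by ring.
  apply: le_trans (cabsB _ _) _.
  have := Psi_asym m0 m1 (ltW w1); have := Psi1_asym m0 m1 (ltW w1); lra.
apply: le_trans (cabsD _ _) _; rewrite cabsM.
have q1 : cabs (Psi1 m w - Psi m w) * cabs (cdot y (resolv w *m x)) <=
    8 * (enorm y * (2 / cabs w * enorm x)).
  apply: ler_pM; rewrite ?cabs_ge0 //; apply: le_trans (cdot_le _ _) _.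
  exact: (ler_wpM2l ey).
have q2 : cabs (cdot y (H *m (resolv w *m x))) <= enorm y * (L * (2 / cabs w * enorm x)).
  apply: le_trans (cdot_le _ _) _; apply: (ler_wpM2l ey).
  by apply: le_trans (hL _) _; apply: (ler_wpM2l L0).
apply: le_trans (lerD q1 q2) _.
by rewrite le_eqVlt; apply/orP; left; apply/eqP; ring.
Qed.

Lemma H_pow_resolv w x y l : 1 < cabs w ->
  (forall i, (i < l)%N -> cdot y (H ^+ i *m x) = 0) ->
  Psi m w ^+ l * cdot y (resolv w *m x) = cdot y (H ^+ l *m (resolv w *m x)).
Proof.
move=> w1; elim: l => [|l IH] hl; first by rewrite expr0 mul1r expr0 mul1mx.
rewrite exprSr -mulrA mulrCA IH => [|i il]; last by apply: hl; apply: ltnW.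
rewrite -cdotZr scalemxAr Psi_resolv // mulmxDr cdotDr hl // add0r.
by rewrite exprSr -mulmxE !mulmxA.
Qed.

(** Vanishing moments let Psi w ^ l act on the resolvent component without
    leaving a polynomial part, as in the Neumann series. *)
Lemma gfun_decay x y l : (forall i, (i < l)%N -> cdot y (H ^+ i *m x) = 0) ->
  exists2 K, 0 <= K & exists2 W, 1 < W & forall w, W <= cabs w ->
  cabs w ^+ l * cabs (gfun y x w) <= K.
Proof.
move=> hl; have [L L0 hL] := mulmx_bounded H; have [W W1 hW] := resolv_far.
have ex := enorm_ge0 x; have ey := enorm_ge0 y.
exists (2 ^+ l * (5 * (enorm y * (L ^+ l * (2 * enorm x))))).
  by rewrite !(mulr_ge0, exprn_ge0).
exists W => // w hw; have w1 : 1 < cabs w by lra.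
have wp : 0 < cabs w by lra.
have [hR hP] := hW w x hw.
rewrite /gfun cabsM mulrCA.
have N5 : cabs (Psi1 m w) <= 5 * cabs w.
  have := cabs_dist (Psi1 m w) w; have := Psi1_asym m0 m1 (ltW w1); lra.
have P0 : 0 <= cabs w / 2 by lra.
have s1 : cabs w ^+ l <= 2 ^+ l * cabs (Psi m w) ^+ l.
  by rewrite -exprMn lerXn2r ?nnegrE ?mulr_ge0 ?cabs_ge0 //; lra.
have s2 : cabs (Psi m w) ^+ l * cabs (cdot y (resolv w *m x)) <=
    enorm y * (L ^+ l * (2 / cabs w * enorm x)).
  rewrite -cabsX -cabsM H_pow_resolv //; apply: le_trans (cdot_le _ _) _.
  apply: (ler_wpM2l ey); apply: le_trans (mulmx_pow_bounded _ _ L0 hL) _.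
  by rewrite ler_wpM2l ?exprn_ge0.
have s3 : cabs w ^+ l * cabs (cdot y (resolv w *m x)) <=
    2 ^+ l * (enorm y * (L ^+ l * (2 / cabs w * enorm x))).
  apply: le_trans (ler_wpM2r (cabs_ge0 _) s1) _.
  by rewrite -[leLHS]mulrA; apply: ler_wpM2l s2; rewrite exprn_ge0.
have t0 : 0 <= cabs w ^+ l * cabs (cdot y (resolv w *m x)).
  by rewrite mulr_ge0 ?exprn_ge0 ?cabs_ge0.
apply: le_trans (ler_pM (cabs_ge0 _) t0 N5 s3) _.
rewrite le_eqVlt; apply/orP; left; apply/eqP; field; exact: lt0r_neq0.
Qed.

End Resolvent.

(** * Polynomials of a matrix with vanishing moments *)

Section MeanBounds.
Variable R : realType.
Implicit Types (F G : R[i] -> R[i]) (r M : R).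

(** A bound that does not presuppose convergence of the averages. *)
Definition mean_bound F r M := forall e : R, 0 < e ->
  exists N0, forall N, (N0 <= N)%N -> cabs (mean F r N) <= M + e.

Lemma mlim_mean_bound F r z M : cabs z <= M -> mlim F r z -> mean_bound F r M.
Proof.
move=> zM h e /h[N0 hN]; exists N0 => N /hN k.
by have := cabs_dist (mean F r N) z; lra.
Qed.

Lemma mean_bound_mlim F r z M : mlim F r z -> mean_bound F r M -> cabs z <= M.
Proof.
move=> h hM; apply/ler_addgt0Pr => e e0; have e2 : 0 < e / 2 by lra.
have [N1 h1] := h _ e2; have [N2 h2] := hM _ e2.
have k1 := h1 _ (leq_maxl N1 N2); have k2 := h2 _ (leq_maxr N1 N2).
move: k1; rewrite cabs_distC => k1.
by have := cabs_dist z (mean F r (maxn N1 N2)); lra.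
Qed.

Lemma mean_boundD F G r M M' : mean_bound F r M -> mean_bound G r M' ->
  mean_bound (fun w => F w + G w) r (M + M').
Proof.
move=> hF hG e e0; have e2 : 0 < e / 2 by lra.
have [N1 h1] := hF _ e2; have [N2 h2] := hG _ e2.
exists (maxn N1 N2) => N; rewrite geq_max => /andP[/h1 k1 /h2 k2].
by rewrite meanD; have := cabsD (mean F r N) (mean G r N); lra.
Qed.

Lemma mean_boundZ F r M z : mean_bound F r M ->
  mean_bound (fun w => z * F w) r (cabs z * M).
Proof.
move=> hF e e0; have z0 := cabs_ge0 z.
have e1 : 0 < e / (cabs z + 1) by rewrite divr_gt0 // ltr_wpDl.
have [N0 h] := hF _ e1; exists N0 => N /h k.
rewrite meanZ cabsM; apply: le_trans (ler_wpM2l z0 k) _.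
rewrite mulrDr lerD2l mulrCA ler_piMr ?(ltW e0) //.
by rewrite ler_pdivrMr ?ltr_wpDl // mul1r lerDl.
Qed.

Lemma mean_bound_sum n (F : 'I_n -> R[i] -> R[i]) r (M : 'I_n -> R) :
  (forall i, mean_bound (F i) r (M i)) ->
  mean_bound (fun w => \sum_i F i w) r (\sum_i M i).
Proof.
elim: n F M => [|n IH] F M h.
  move=> e e0; exists 0%N => N _; rewrite big_ord0 add0r.
  rewrite /mean big1 ?mulr0 ?cabs0 ?(ltW e0) // => j _; exact: big_ord0.
have := mean_boundD (h ord0) (IH _ _ (fun i => h (lift ord0 i))).
rewrite big_ord_recl; congr (mean_bound _ _ _).
by apply/funext => w; rewrite big_ord_recl.
Qed.

Lemma eq_mean_bound F G r M M' : 0 <= r -> (forall w, cabs w = r -> F w = G w) ->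
  M <= M' -> mean_bound F r M -> mean_bound G r M'.
Proof.
move=> r0 FG MM h e /h[N0 hN]; exists N0 => N /hN k.
by rewrite -(eq_mean N r0 FG); apply: le_trans k _; rewrite lerD2r.
Qed.

Lemma cst_mean_bound F r M : 0 <= r -> 0 <= M ->
  (forall w, cabs w = r -> cabs (F w) <= M) -> mean_bound F r M.
Proof.
move=> r0 M0 h e e0; exists 0%N => N _.
by apply: le_trans (mean_le _ r0 M0 h) _; rewrite lerDl ltW.
Qed.

(** Domination by the real part of a function whose averages converge. *)
Lemma Re_mean_bound F G r z (c : R) : 0 <= r -> 0 <= c ->
  (forall w, cabs w = r -> cabs (F w) <= c * complex.Re (G w)) -> mlim G r z ->
  mean_bound F r (c * complex.Re z).
Proof.
move=> r0 c0 h hG e e0; have e1 : 0 < e / (c + 1) by rewrite divr_gt0 // ltr_wpDl.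
have [N0 hN] := hG _ e1; exists N0 => N /hN k.
have b : cabs (mean F r N) <= c * complex.Re (mean G r N).
  have -> : complex.Re (mean G r N) = N%:R^-1 * \sum_(j < N) complex.Re (G (node N r j)).
    rewrite /mean; have -> : (N%:R^-1 : R[i]) = (N%:R^-1)%:C.
      by rewrite fmorphV rmorph_nat.
    rewrite ReM /= mul0r subr0; congr (_ * _).
    by elim/big_rec2: _ => [//|i a b _ <-]; rewrite ReD.
  rewrite cabsM cabsV cabs_nat mulrCA ler_wpM2l ?invr_ge0 //.
  apply: le_trans (cabs_sum _ _ _) _; rewrite mulr_sumr; apply: ler_sum => j _.
  by apply: h; apply: cabs_node.
apply: le_trans b _.
have := le_trans (ler_norm _) (le_trans (Re_le_cabs _) k); rewrite ReD ReN => k'.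
have k2 : complex.Re (mean G r N) <= complex.Re z + e / (c + 1) by lra.
apply: le_trans (ler_wpM2l c0 k2) _.
rewrite mulrDr lerD2l mulrCA ler_piMr ?(ltW e0) //.
by rewrite ler_pdivrMr ?ltr_wpDl // mul1r lerDl.
Qed.

Lemma mlim_wpow r n : 1 <= r -> mlim (fun w : R[i] => w ^+ n.+1) r 0.
Proof.
move=> r1; have := mlim_deriv r1 (holX n r1 (hol_id r r1)).
move=> /(mlimZ (n.+1%:R^-1)); rewrite mulr0; apply: eq_mlim; first by lra.
move=> w _; rewrite -mulrA mulKf ?pnatr_eq0 //.
by rewrite exprSr.
Qed.

Lemma mlim_winv r n : 1 <= r -> mlim (fun w : R[i] => w^-1 ^+ n.+1) r 0.
Proof.
move=> r1; have := mlim_deriv r1 (holX n r1 (hol_inv r r1)).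
move=> /(mlimZ (- n.+1%:R^-1)); rewrite mulr0; apply: eq_mlim; first by lra.
move=> w _; rewrite mulrN mulrNN -mulrA mulKf ?pnatr_eq0 //.
by rewrite exprSr.
Qed.

Lemma wpow_split (w : R[i]) n D : w != 0 ->
  w ^+ n * w^-1 ^+ D = if (D <= n)%N then w ^+ (n - D) else w^-1 ^+ (D - n).
Proof.
move=> w0; have wn k : w ^+ k != 0 by rewrite expf_neq0.
case: leqP => h.
  by rewrite -{1}(subnK h) exprD exprVn -mulrA mulfV ?mulr1.
by rewrite -{1}(subnK (ltnW h)) exprD mulrCA !exprVn mulfV ?mulr1.
Qed.

(** Cauchy's estimate for the coefficients of a Laurent polynomial. *)
Lemma laurent_coef_le (S : {poly R[i]}) D rho B n : 1 <= rho -> 0 <= B ->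
  (forall w, cabs w = rho -> cabs (S.[w] * w^-1 ^+ D) <= B) ->
  (n < size S)%N -> cabs S`_n * rho ^+ n <= B * rho ^+ D.
Proof.
move=> rho1 B0 h nS; have rho0 : 0 < rho by lra.
have L : mlim (fun w => (S.[w] * w^-1 ^+ D) * (w ^+ D * w^-1 ^+ n)) rho S`_n.
  have LL (i : 'I_(size S)) : mlim (fun w => S`_i * (w ^+ i * w^-1 ^+ n)) rho
      (if i == n :> nat then S`_i else 0).
    have [-> |ni] := eqVneq (i : nat) n.
      rewrite -[X in mlim _ _ X]mulr1; apply: mlimZ.
      apply: eq_mlim (mlim_cst 1 rho); first exact: ltW.
      move=> w wr; have w0 : w != 0 by rewrite -cabs_gt0 wr.
      by rewrite wpow_split // leqnn subnn expr0.
    rewrite -[X in mlim _ _ X](mulr0 S`_i); apply: mlimZ.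
    have E w : cabs w = rho -> (if (n <= i)%N then w ^+ (i - n) else w^-1 ^+ (n - i))
        = w ^+ i * w^-1 ^+ n.
      by move=> wr; rewrite wpow_split // -cabs_gt0 wr.
    apply: (eq_mlim (ltW rho0) E); case: leqP => hn.
      have -> : (i - n)%N = (i - n).-1.+1 by rewrite prednK // subn_gt0 ltn_neqAle eq_sym ni.
      exact: mlim_wpow.
    have -> : (n - i)%N = (n - i).-1.+1 by rewrite prednK // subn_gt0.
    exact: mlim_winv.
  have := mlim_sum (index_enum _) LL.
  have -> : \sum_(i < size S) (if i == n :> nat then S`_i else 0) = S`_n.
    rewrite (bigD1 (Ordinal nS)) //= eqxx big1 ?addr0 // => i ni.
    by rewrite -val_eqE /= in ni; rewrite (negbTE ni).
  apply: eq_mlim; first exact: ltW.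
  move=> w wr; have w0 : w != 0 by rewrite -cabs_gt0 wr.
  have wD : w^-1 ^+ D * w ^+ D = 1 by rewrite -exprMn mulVf // expr1n.
  rewrite mulrA -[S.[w] * _ * _]mulrA wD mulr1 horner_coef mulr_suml.
  by apply: eq_bigr => i _; rewrite mulrA.
have rn0 : 0 < rho ^+ n by rewrite exprn_gt0.
rewrite -ler_pdivlMr //.
apply: (mlim_le (ltW rho0) _ _ L); first by rewrite !mulr_ge0 ?invr_ge0 ?exprn_ge0 // ltW.
move=> w wr; rewrite cabsM -mulrA; apply: ler_pM; rewrite ?cabs_ge0 ?h //.
by rewrite cabsM !cabsX cabsV wr exprVn.
Qed.

End MeanBounds.

Section FaberEstimate.
Variables (R : realType) (m : R) (d : nat) (H : 'M[R[i]]_d).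
Hypotheses (m_gt0 : 0 < m) (m_lt1 : m < 1) (Hrect : in_rectangle m H).
Variables (x y : 'cV[R[i]]_d) (l : nat).
Hypotheses (x1 : enorm x = 1) (y1 : enorm y = 1).
Hypothesis moments : forall i, (i < l)%N -> cdot y (H ^+ i *m x) = 0.
Implicit Types (w : R[i]) (r : R).

Let m0 := m_gt0.
Let m1 := m_lt1.

Local Notation g := (gfun m H).

Lemma mlim_gfun (u v : 'cV[R[i]]_d) r : 1 < r -> mlim (g v u) r (cdot v u).
Proof.
move=> r1; apply: mlim_infty (ltW r1) _ _ => [r2|e e0].
  by have [F1 h] := gfun_hol m0 m1 Hrect r2 u v r1; exists F1.
have [K K0 [W W1 h]] := gfun_far m0 m1 Hrect u v.
pose r2 := Num.max (Num.max r W) (K / e).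
have rr2 : r <= r2 by rewrite !le_max lexx.
exists r2 => // w wr.
have Ww : W <= cabs w by rewrite wr !le_max lexx orbT.
have Kw : K / e <= cabs w by rewrite wr !le_max lexx orbT.
apply: le_trans (h w Ww) _; rewrite ler_pdivrMr; last by lra.
by rewrite mulrC -ler_pdivrMr.
Qed.

Lemma mlim_gfun_neg (u v : 'cV[R[i]]_d) r n : 1 < r ->
  mlim (fun w => w^-1 ^+ n.+1 * g v u w) r 0.
Proof.
move=> r1; apply: mlim_infty (ltW r1) _ _ => [r2|e e0].
  have [F1 h] := gfun_hol m0 m1 Hrect r2 u v r1.
  by eexists; apply: holM (ltW r1) (holX n (ltW r1) (hol_inv r2 (ltW r1))) h.
have [K K0 [W W1 h]] := gfun_far m0 m1 Hrect u v.
have c0 := cabs_ge0 (cdot v u).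
pose M := cabs (cdot v u) + K.
have M0 : 0 <= M by rewrite addr_ge0.
pose r2 := Num.max (Num.max r W) (M / e).
have rr2 : r <= r2 by rewrite !le_max lexx.
exists r2 => // w wr.
have Ww : W <= cabs w by rewrite wr !le_max lexx orbT.
have Mw : M / e <= cabs w by rewrite wr !le_max lexx orbT.
have w1 : 1 < cabs w by lra.
have wp : 0 < cabs w by lra.
have gM : cabs (g v u w) <= M.
  have := cabs_dist (g v u w) (cdot v u); have := h w Ww.
  have : K / cabs w <= K by rewrite ler_pdivrMr // ler_peMr // ltW.
  by rewrite /M; lra.
rewrite subr0 cabsM cabsX cabsV.
have i1 : (cabs w)^-1 ^+ n.+1 <= (cabs w)^-1.
  rewrite exprS ler_piMr ?invr_ge0 ?(ltW wp) // exprn_ile1 ?invr_ge0 ?(ltW wp) //.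
  by rewrite invf_le1 // ltW.
have j0 : 0 <= (cabs w)^-1 ^+ n.+1 by rewrite exprn_ge0 // invr_ge0 ltW.
apply: le_trans (ler_pM j0 (cabs_ge0 _) i1 gM) _.
by rewrite mulrC ler_pdivrMr // mulrC -ler_pdivrMr.
Qed.

Lemma mlim_gfun_low r n : 1 < r -> (n < l)%N -> mlim (fun w => w ^+ n * g y x w) r 0.
Proof.
move=> r1 nl; apply: mlim_infty (ltW r1) _ _ => [r2|e e0].
  have [F1 h] := gfun_hol m0 m1 Hrect r2 x y r1.
  case: n nl => [|n] _.
    by exists F1; apply: eq_hol h => w //; rewrite expr0 mul1r.
  by eexists; apply: holM (ltW r1) (holX n (ltW r1) (hol_id r2 (ltW r1))) h.
have [K K0 [W W1 h]] := gfun_decay m0 m1 Hrect moments.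
pose r2 := Num.max (Num.max r W) (K / e).
have rr2 : r <= r2 by rewrite !le_max lexx.
exists r2 => // w wr.
have Ww : W <= cabs w by rewrite wr !le_max lexx orbT.
have Kw : K / e <= cabs w by rewrite wr !le_max lexx orbT.
have w1 : 1 < cabs w by lra.
have wp : 0 < cabs w by lra.
rewrite subr0 cabsM cabsX -(ler_pM2l wp) mulrA -exprS.
apply: (@le_trans _ _ K); last by rewrite -ler_pdivrMr.
apply: le_trans (h w Ww); rewrite ler_wpM2r ?cabs_ge0 //.
by rewrite ler_eXn2l.
Qed.

(** Caratheodory's coefficient bound: the sum of gfun y x and the conjugate of
    gfun x y is dominated by the real part of a function with mean value 2, and
    the conjugate term contributes at most 1. *)
Lemma mean_bound_gfun r n : 1 < r -> mean_bound (fun w => w ^+ n * g y x w) r (3 * r ^+ n).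
Proof.
move=> r1; have r0 : 0 <= r by lra.
have rn1 : 1 <= r ^+ n by rewrite exprn_ege1 // ltW.
have rn0 : 0 <= r ^+ n by lra.
have P : mean_bound (fun w => w ^+ n * (g y x w + conjc (g x y w))) r (2 * r ^+ n).
  have L := mlimD (mlim_gfun x x r1) (mlim_gfun y y r1).
  have := @Re_mean_bound _ (fun w => w ^+ n * (g y x w + conjc (g x y w)))
    (fun w => g x x w + g y y w) r _ (r ^+ n) r0 rn0 _ L.
  have -> : r ^+ n * complex.Re (cdot x x + cdot y y) = 2 * r ^+ n.
    by rewrite !cdot_self x1 y1 expr1n ReD /=; ring.
  apply => w wr; rewrite cabsM cabsX wr ler_wpM2l //.
  by apply: (gfun_cross m0 m1 Hrect); rewrite wr.
have Q : mean_bound (fun w => w ^+ n * conjc (g x y w)) r 1.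
  case: n {rn1 rn0 P} => [|n].
    have := mlim_conj (mlim_gfun y x r1) => L.
    have c1 : cabs (conjc (cdot x y)) <= 1.
      by rewrite cabs_conj; apply: le_trans (cdot_le _ _) _; rewrite x1 y1 mulr1.
    apply: eq_mean_bound (mlim_mean_bound c1 L) => // w _.
    by rewrite expr0 mul1r.
  have L := mlimZ (r%:C ^+ 2 ^+ n.+1) (mlim_conj (mlim_gfun_neg y x n r1)).
  have z1 : cabs (r%:C ^+ 2 ^+ n.+1 * conjc 0 : R[i]) <= 1.
    by rewrite -[conjc 0]/((0 : R[i])^*) rmorph0 mulr0 cabs0.
  apply: eq_mean_bound (mlim_mean_bound z1 L) => // w wr.
  have w0 : w != 0 by rewrite -cabs_gt0 wr; lra.
  rewrite -[conjc (_ * _)]/((w^-1 ^+ n.+1 * g x y w)^*) rmorphM rmorphXn fmorphV /=.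
  rewrite mulrA -exprMn; congr (_ ^+ _ * _).
  have -> : r%:C ^+ 2 = conjc w * w by rewrite -[RHS]sqr_cabsE wr rmorphXn.
  by rewrite mulrC mulKf // -cabs_gt0 cabs_conj wr; lra.
have := mean_boundD P (mean_boundZ (-1) Q).
apply: eq_mean_bound => //.
  by move=> w _; ring.
by rewrite cabsN cabs1; lra.
Qed.

Let geometric_tail (t : R) N D : 0 <= t -> t < 1 ->
  \sum_(i < N) (if (D + l <= i)%N then t ^+ (i - D) else 0) <= t ^+ l / (1 - t).
Proof.
move=> t0 t1; have t2 : 0 < 1 - t by lra.
rewrite ler_pdivlMr //.
suff : (\sum_(i < N) (if (D + l <= i)%N then t ^+ (i - D) else 0)) * (1 - t) =
    t ^+ l - t ^+ (maxn N (D + l) - D).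
  by move=> ->; rewrite gerBl exprn_ge0.
elim: N => [|N IH]; first by rewrite big_ord0 mul0r max0n addKn subrr.
rewrite big_ord_recr mulrDl IH; have [h|] := boolP (D + l <= N)%N.
  rewrite (maxn_idPl h) (maxn_idPl (leqW h)) subSn; last by lia.
  by rewrite exprS; ring.
rewrite -ltnNge => h; by rewrite (maxn_idPr (ltnW h)) (maxn_idPr h) mul0r addr0.
Qed.

(** Only the powers of w beyond the vanishing moments meet the operator
    function; Cauchy's estimate on the outer circle makes the sum geometric. *)
Lemma mean_bound_laurent (S : {poly R[i]}) D r rho B : 1 < r -> r < rho -> 0 <= B ->
  (forall w, cabs w = rho -> cabs (S.[w] * w^-1 ^+ D) <= B) ->
  mean_bound (fun w => S.[w] * w^-1 ^+ D * g y x w) r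
    (3 * B * ((r / rho) ^+ l / (1 - r / rho))).
Proof.
move=> r1 rrho B0 hS; have rho1 : 1 < rho by lra.
have r0 : 0 < r by lra.
have rho0 : 0 < rho by lra.
have t0 : 0 <= r / rho by rewrite divr_ge0 // ltW.
have t1 : r / rho < 1 by rewrite ltr_pdivrMr // mul1r.
pose M i : R := if (D + l <= i)%N then 3 * r ^+ (i - D) else 0.
have hM (i : 'I_(size S)) :
    mean_bound (fun w => S`_i * (w ^+ i * w^-1 ^+ D * g y x w)) r (cabs S`_i * M i).
  apply: mean_boundZ; rewrite /M.
  have E w : cabs w = r -> (if (D <= i)%N then w ^+ (i - D) else w^-1 ^+ (D - i)) * g y x w
      = w ^+ i * w^-1 ^+ D * g y x w.
    by move=> wr; rewrite wpow_split // -cabs_gt0 wr.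
  have z0 : cabs (0 : R[i]) <= 0 by rewrite cabs0.
  apply: (eq_mean_bound (ltW r0) E (lexx _)).
  case: (leqP D i) => Di; last first.
    have -> : (D + l <= i)%N = false by apply/negbTE; rewrite -ltnNge (leq_trans Di) ?leq_addr.
    have -> : (D - i)%N = (D - i).-1.+1 by rewrite prednK ?subn_gt0.
    exact: mlim_mean_bound z0 (mlim_gfun_neg x y _ r1).
  case: leqP => Dli; first exact: mean_bound_gfun.
  by apply: mlim_mean_bound z0 (mlim_gfun_low r1 _); rewrite ltn_subLR.
apply: eq_mean_bound (mean_bound_sum hM) => [||]; first exact: ltW.
  move=> w wr; rewrite horner_coef !mulr_suml.
  by apply: eq_bigr => i _; rewrite !mulrA.
have B3 : 0 <= 3 * B by rewrite mulr_ge0.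
apply: le_trans (ler_wpM2l B3 (geometric_tail (size S) D t0 t1)).
rewrite mulr_sumr; apply: ler_sum => i _; rewrite /M.
case: leqP => Dli; last by rewrite !mulr0.
have := laurent_coef_le (ltW rho1) B0 hS (ltn_ord i).
have Di : (i = D + (i - D) :> nat)%N.
  by rewrite subnKC // (leq_trans _ Dli) ?leq_addr.
rewrite {2}Di exprD mulrCA [leRHS]mulrC ler_pM2l ?exprn_gt0 // => h.
rewrite expr_div_n.
have p0 : 0 < rho ^+ (i - D) by rewrite exprn_gt0.
have -> : cabs S`_i * (3 * r ^+ (i - D)) = 3 * (cabs S`_i * r ^+ (i - D)) by ring.
rewrite -mulrA ler_pM2l // [leRHS]mulrA ler_pdivlMr // mulrAC ler_wpM2r //.
by rewrite exprn_ge0 // ltW.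
Qed.

Section Power.
Variables (kappa sigma : R[i]).

Let F w := kappa - sigma * Psi m w.
Let A : 'M[R[i]]_d := kappa%:M - sigma *: H.

Let F_hol r2 : hol 1 r2 F (fun w => - sigma * Psi1 m w).
Proof.
have := holD (hol_cst 1 r2 kappa) (holZ (- sigma) (lexx 1) (Psi_hol m0 m1 r2)).
by apply: eq_hol => w; rewrite ?add0r // /F mulNr.
Qed.

Let A_resolv w (u : 'cV_d) : 1 < cabs w ->
  F w *: (resolv m H w *m u) = resolv m H w *m (A *m u) - sigma *: u.
Proof.
move=> w1; rewrite /F /A mulmxBl mul_scalar_mx -scalemxAl mulmxBr -!scalemxAr.
rewrite -(H_resolv m0 m1 Hrect) // scalerBl -addrA; congr (_ + _).
by rewrite -scalerA (Psi_resolv m0 m1 Hrect) // scalerDr opprD addrC.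
Qed.

(** The functional calculus of the resolvent. Moving one factor F onto the vector
    leaves a multiple of the logarithmic derivative of a power of F, whose
    averages vanish. *)
Lemma mlim_power r j (u v : 'cV[R[i]]_d) : 1 < r ->
  mlim (fun w => F w ^+ j * g v u w) r (cdot v (A ^+ j *m u)).
Proof.
move=> r1; have r0 : 0 <= r by lra.
elim: j u => [|j IH] u.
  rewrite expr0 mul1mx; apply: eq_mlim (mlim_gfun u v r1) => // w _.
  by rewrite expr0 mul1r.
have hF : hol r r F (fun w => - sigma * Psi1 m w).
  by apply: hol_sub (F_hol r) => //; exact: ltW.
have L0 := mlimZ (j.+1%:R^-1 * cdot v u) (mlim_deriv (ltW r1) (holX j (ltW r1) hF)).
have := mlimD (IH (A *m u)) L0.
rewrite mulr0 addr0 mulmxA mulmxE -exprSr; apply: eq_mlim => // w wr.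
have w1 : 1 < cabs w by rewrite wr.
rewrite /gfun exprSr -[F w ^+ j * F w * _]mulrA.
have -> : F w * (Psi1 m w * cdot v (resolv m H w *m u)) =
  Psi1 m w * cdot v (F w *: (resolv m H w *m u)) by rewrite cdotZr; ring.
rewrite (A_resolv u w1) cdotBr cdotZr.
have n0 : j.+1%:R != 0 :> R[i] by rewrite pnatr_eq0.
by field.
Qed.

(** Caratheodory's bound on the inner circle meets Cauchy's estimate on the
    outer one: approximate F ^ j by a Laurent polynomial, split the average into
    powers of w, and sum the geometric series that starts at the first moment
    that may not vanish. *)
Lemma faber_bound j r rho B : 1 < r -> r < rho -> 0 <= B ->
  (forall w, cabs w = rho -> cabs (F w) <= B) ->
  cabs (cdot y (A ^+ j *m x)) <= 3 * B ^+ j * ((r / rho) ^+ l / (1 - r / rho)).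
Proof.
move=> r1 rrho B0 hB; have r0 : 0 < r by lra.
have rho1 : 1 < rho by lra.
have rho0 : 0 < rho by lra.
set G := (r / rho) ^+ l / (1 - r / rho).
have G0 : 0 <= G.
  have t1 : r / rho < 1 by rewrite ltr_pdivrMr // mul1r.
  have t0 : 0 <= r / rho by rewrite divr_ge0 // ltW.
  by rewrite divr_ge0 ?exprn_ge0 //; lra.
have [F1 [[M0 hM0] _]] := gfun_hol m0 m1 Hrect rho x y r1.
pose M := `|M0|.
have hM w : cabs w = r -> cabs (g y x w) <= M.
  move=> wr; have aw : annulus r rho w by rewrite /annulus wr lexx ltW.
  by have [h _] := hM0 _ aw; apply: le_trans h (ler_norm _).
have M_ge0 : 0 <= M by apply: normr_ge0.
have appr dl : 0 < dl -> exists D (S : {poly R[i]}), forall w, annulus 1 rho w ->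
    cabs (F w ^+ j - S.[w] * w^-1 ^+ D) <= dl.
  move=> dl0; case: j => [|n].
    by exists 0%N, 1 => w _; rewrite hornerC !expr0 mulr1 subrr cabs0 ltW.
  have [[K0 hK0] _] := F_hol rho.
  pose K := `|K0| + 1.
  have Kp : 0 < K by rewrite ltr_wpDl.
  pose e := Num.min 1 (dl / n.+1%:R / K ^+ n) / (cabs sigma + 1).
  have s0 : 0 < cabs sigma + 1 by rewrite ltr_wpDl ?cabs_ge0.
  have e0 : 0 < e by rewrite divr_gt0 // lt_min ltr01 !divr_gt0 ?exprn_gt0.
  have [D [Q hQ]] := Psi_laurent m0 m1 rho e0.
  exists (D * n.+1)%N, ((kappa *: 'X^D - sigma *: Q) ^+ n.+1) => w aw.
  have w0 := annulus_neq0 (lexx 1) aw.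
  pose J := kappa - sigma * (Q.[w] / w ^+ D).
  have -> : ((kappa *: 'X^D - sigma *: Q) ^+ n.+1).[w] * w^-1 ^+ (D * n.+1) = J ^+ n.+1.
    rewrite horner_exp exprM -exprMn; congr (_ ^+ _).
    rewrite !hornerE /J exprVn; field; exact: expf_neq0.
  have FJ : cabs (F w - J) <= Num.min 1 (dl / n.+1%:R / K ^+ n).
    have -> : F w - J = - sigma * (Psi m w - Q.[w] / w ^+ D) by rewrite /F /J; ring.
    rewrite cabsM cabsN; have := ler_wpM2l (cabs_ge0 sigma) (hQ w aw).
    move=> /le_trans; apply; rewrite /e mulrCA ler_piMr //.
      by rewrite le_min ler01 !divr_ge0 ?exprn_ge0 // ltW.
    by rewrite ler_pdivrMr // mul1r lerDl.
  have [FK _] := hK0 _ aw.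
  have FK' : cabs (F w) <= K.
    by apply: le_trans FK _; apply: le_trans (ler_norm _) _; rewrite lerDl.
  move: FJ; rewrite le_min => /andP[FJ1 FJ2].
  have JK : cabs J <= K.
    have := cabs_dist J (F w); rewrite [cabs (J - _)]cabs_distC => hJ.
    apply: le_trans hJ _; rewrite addrC /K; have := ler_norm K0; lra.
  apply: le_trans (expr_lip n JK FK') _.
  by rewrite mulrC -ler_pdivlMr ?mulr_gt0 ?exprn_gt0 // invfM mulrA.
have step dl : 0 < dl -> cabs (cdot y (A ^+ j *m x)) <= 3 * (B ^+ j + dl) * G + dl * M.
  move=> dl0; have [D [S hS]] := appr _ dl0.
  apply: mean_bound_mlim (mlim_power j x y r1) _.
  have Bj : 0 <= B ^+ j + dl by rewrite addr_ge0 ?exprn_ge0 // ltW.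
  have hS1 w : cabs w = rho -> cabs (S.[w] * w^-1 ^+ D) <= B ^+ j + dl.
    move=> wr; have aw : annulus 1 rho w by rewrite /annulus wr lexx ltW.
    have := cabs_dist (S.[w] * w^-1 ^+ D) (F w ^+ j); rewrite cabs_distC.
    have := hS w aw.
    have : cabs (F w ^+ j) <= B ^+ j.
      by rewrite cabsX lerXn2r ?nnegrE ?cabs_ge0 // hB.
    lra.
  have b1 := mean_bound_laurent r1 rrho Bj hS1.
  have b2 : mean_bound (fun w => (F w ^+ j - S.[w] * w^-1 ^+ D) * g y x w) r (dl * M).
    apply: cst_mean_bound; rewrite ?(ltW r0) ?mulr_ge0 ?(ltW dl0) //.
    move=> w wr; have aw : annulus 1 rho w by rewrite /annulus wr !ltW.
    by rewrite cabsM ler_pM ?cabs_ge0 ?hS ?hM.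
  apply: eq_mean_bound (mean_boundD b1 b2); rewrite ?(ltW r0) //.
  by move=> w _; rewrite -mulrDl addrC subrK.
apply/ler_addgt0Pr => e e0.
have GM : 0 < 3 * G + M + 1 by lra.
have := step (e / (3 * G + M + 1)); rewrite divr_gt0 // => /(_ isT) /le_trans; apply.
have -> : 3 * (B ^+ j + e / (3 * G + M + 1)) * G + e / (3 * G + M + 1) * M =
  3 * B ^+ j * G + (3 * G + M) / (3 * G + M + 1) * e by field; apply: lt0r_neq0.
rewrite lerD2l ler_piMl ?(ltW e0) // ler_pdivrMr // mul1r lerDl //.
Qed.

End Power.

End FaberEstimate.

(** * The rectangle around the numerical range *)

Section SpectralForm.
Variable R : realType.

Lemma cdot_adj m n (M : 'M[R[i]]_(m, n)) x y : cdot (M *m x) y = cdot x (M ^t* *m y).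
Proof. by rewrite /cdot trmx_mul map_mxM mulmxA. Qed.

Variable n : nat.
Implicit Types (M A : 'M[R[i]]_n) (u : 'cV[R[i]]_n).

Let P M := spectralmx M.
Let D M := spectral_diag M.

Lemma spectral_eigenvalue M j : M \is normalmx -> eigenvalue M (D M 0 j).
Proof.
move=> /orthomx_spectralP E; apply/eigenvalueP; exists (row j (P M)).
  rewrite -row_mul {2}E !mulmxA mulmxV ?spectral_unit // mul1mx row_mul.
  by apply/rowP => i; rewrite row_diag_mx -scalemxAl -rowE !mxE.
apply/negP => /eqP r0; have /row_freeP[B] : row_free (P M).
  by rewrite row_free_unit spectral_unit.
move=> /(congr1 (row j)); rewrite row_mul r0 mul0mx => /rowP/(_ j).
by rewrite !mxE eqxx => /esym/eqP; rewrite oner_eq0.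
Qed.

Lemma spectral_adj M : (P M)^t* *m P M = 1%:M.
Proof.
by rewrite -(invmx_unitary (spectral_unitarymx M)) mulVmx // spectral_unit.
Qed.

Lemma spectral_sum M u : \sum_j cabs ((P M *m u) j 0) ^+ 2 = enorm u ^+ 2.
Proof.
rewrite -sqr_enorm; have := cdot_self (P M *m u).
by rewrite cdot_adj mulmxA spectral_adj mul1mx cdot_self => /(congr1 (@complex.Re R)).
Qed.

Lemma spectral_cdot M u : M \is normalmx ->
  cdot u (M *m u) = \sum_j D M 0 j * (cabs ((P M *m u) j 0) ^+ 2)%:C.
Proof.
move=> /orthomx_spectralP E.
rewrite {1}E (invmx_unitary (spectral_unitarymx M)) -!mulmxA -cdot_adj -/(P M) -/(D M).
rewrite cdotE; apply: eq_bigr => j _.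
by rewrite mul_diag_mx [X in _ * X = _]mxE sqr_cabsE mulrCA.
Qed.

Lemma eigenvalue_bounded M : exists L, forall z, eigenvalue M z -> cabs z <= L.
Proof.
have [L L0 hL] := mulmx_bounded M^T; exists L => z /eigenvalueP[v vz v0].
have := hL v^T; rewrite -trmx_mul vz linearZ enormZ ler_pM2r // lt_neqAle enorm_ge0.
rewrite andbT eq_sym; apply/eqP => /enorm_eq0 /(congr1 trmx).
by rewrite trmxK trmx0 => v00; rewrite v00 eqxx in v0.
Qed.

Lemma spectral_radius_ge M u : M \is normalmx ->
  cabs (cdot u (M *m u)) <= spectral_radius M * enorm u ^+ 2.
Proof.
move=> nM; rewrite spectral_cdot // -(spectral_sum M) mulr_sumr.
apply: le_trans (cabs_sum _ _ _) _; apply: ler_sum => j _.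
rewrite cabsM cabs_real (ger0_norm (sqr_ge0 _)) ler_wpM2r ?sqr_ge0 //.
have [L hL] := eigenvalue_bounded M.
apply: ub_le_sup.
  by exists L => _ [z zM <-]; rewrite cabsE; apply: hL.
by exists (D M 0 j); [exact: spectral_eigenvalue|exact: cabsE].
Qed.

Lemma adj_normal M e : e * e = 1 -> M ^t* = e *: M -> M \is normalmx.
Proof.
by move=> e1 E; apply/normalmxP; rewrite E -scalemxAl -scalemxAr.
Qed.

Lemma adj_real_eigenvalue M j : M ^t* = M ->
  D M 0 j = (complex.Re (D M 0 j))%:C.
Proof.
move=> E; have hM : M \is hermsymmx.
  by apply/is_hermitianmxP; rewrite expr0 scale1r E.
have /mxOverP/(_ 0 j)/CrealP := hermitian_spectral_diag_real hM.
move=> c; apply: complex_eq => //=.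
have := congr1 (@complex.Im R) c; rewrite conjCE Im_conj; lra.
Qed.

Lemma adj_range M u : M ^t* = M ->
  lambda_min M * enorm u ^+ 2 <= complex.Re (cdot u (M *m u))
    <= lambda_max M * enorm u ^+ 2.
Proof.
move=> E; have nM : M \is normalmx.
  by apply: (@adj_normal _ 1); rewrite ?mulr1 ?scale1r.
have [L hL] := eigenvalue_bounded M.
have eD j : eigenvalue M (complex.Re (D M 0 j))%:C.
  by rewrite -adj_real_eigenvalue //; apply: spectral_eigenvalue.
have bd x : eigenvalue M x%:C -> - L <= x <= L.
  by move=> /hL; rewrite cabs_real ler_norml.
have -> : complex.Re (cdot u (M *m u)) =
    \sum_j complex.Re (D M 0 j) * cabs ((P M *m u) j 0) ^+ 2.
  rewrite spectral_cdot //; elim/big_rec2: _ => [//|j x y _ <-].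
  by rewrite ReD ReM /= mulr0 subr0.
rewrite -(spectral_sum M) !mulr_sumr; apply/andP; split.
  apply: ler_sum => j _; rewrite ler_wpM2r ?sqr_ge0 //.
  by apply: ge_inf (eD j); exists (- L) => x /bd /andP[].
apply: ler_sum => j _; rewrite ler_wpM2r ?sqr_ge0 //.
by apply: ub_le_sup (eD j); exists L => x /bd /andP[].
Qed.

(** The Hermitian part carries the real part of the quadratic form and the
    skew-Hermitian part the imaginary part; both are unitarily diagonalizable. *)
Lemma numerical_range A u :
  [/\ lambda_min (2%:R^-1 *: (A + A ^t*)) * enorm u ^+ 2 <= complex.Re (cdot u (A *m u)),
      complex.Re (cdot u (A *m u)) <= lambda_max (2%:R^-1 *: (A + A ^t*)) * enorm u ^+ 2 &
      `|complex.Im (cdot u (A *m u))| <=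
        spectral_radius (2%:R^-1 *: (A - A ^t*)) * enorm u ^+ 2].
Proof.
have cA : cdot u (A ^t* *m u) = conjc (cdot u (A *m u)).
  by rewrite -cdot_adj cdot_conj.
have i2 : (2%:R^-1 : R[i]) = (2^-1)%:C by rewrite fmorphV rmorph_nat.
have eS : (2%:R^-1 *: (A + A ^t*)) ^t* = 2%:R^-1 *: (A + A ^t*).
  apply/matrixP => i j; rewrite !mxE !conjCE; move: (A i j) (A j i) => x y.
  by rewrite i2; apply: complex_eq; rewrite !ReImE /=; ring.
have eK : (2%:R^-1 *: (A - A ^t*)) ^t* = - 1 *: (2%:R^-1 *: (A - A ^t*)).
  apply/matrixP => i j; rewrite !mxE !conjCE; move: (A i j) (A j i) => x y.
  by rewrite i2; apply: complex_eq; rewrite !ReImE /=; ring.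
have kn : 2%:R^-1 *: (A - A ^t*) \is normalmx.
  by apply: adj_normal eK; rewrite mulrNN mulr1.
have := adj_range u eS; have := spectral_radius_ge u kn.
rewrite -!scalemxAl mulmxBl mulmxDl !cdotZr cdotBr cdotDr cA.
move: (cdot u (A *m u)) => z.
have -> : 2%:R^-1 * (z + conjc z) = (complex.Re z)%:C.
  by rewrite i2; apply: complex_eq; rewrite !ReImE /=; field.
have e2 : 2%:R^-1 * (z - conjc z) = (complex.Im z)%:C * 'i%C.
  by rewrite i2; apply: complex_eq; rewrite !ReImE /=; field.
rewrite e2 cabsM cabs_real.
have -> : cabs ('i%C : R[i]) = 1.
  by apply/eqP; rewrite -(@eqrXn2 _ 2) ?cabs_ge0 // sqr_cabs /= expr0n /= add0r expr1n.
by rewrite mulr1 => h /andP[].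
Qed.

End SpectralForm.

(** * The Arnoldi relation *)

Section ArnoldiFacts.
Variables (R : realType) (n : nat) (A : 'M[R[i]]_n) (v : 'cV[R[i]]_n) (l : nat).
Variables (vs : nat -> 'cV[R[i]]_n) (h : nat -> nat -> R[i]).
Hypothesis harn : arnoldi A v l.+1 vs h.
Implicit Types x y : 'cV[R[i]]_l.+1.

Let V := arnoldi_basis l.+1 vs.
Let H := arnoldi_hess l.+1 h.
Let e1 := first_basis_vector R l.+1.
Let el : 'cV[R[i]]_l.+1 := delta_mx ord_max 0.

Lemma arnoldi_basisE y : V *m y = \sum_j y j 0 *: vs j.+1.
Proof.
apply/colP => i; rewrite mxE summxE; apply: eq_bigr => j _.
by rewrite !mxE mulrC.
Qed.

Lemma arnoldi_basis_cdot x y : cdot (V *m x) (V *m y) = cdot x y.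
Proof.
rewrite !arnoldi_basisE cdot_suml cdotE; apply: eq_bigr => i _.
rewrite cdotZl cdot_sumr; congr (_ * _).
rewrite (bigD1 i) //= big1 ?addr0 => [|j ji]; rewrite cdotZr (arnoldi_orthonormal harn) //.
- by rewrite eqxx mulr1.
- by have := ltn_ord i; lia.
- by have := ltn_ord i; lia.
- by rewrite eqSS val_eqE eq_sym (negbTE ji) mulr0.
- by have := ltn_ord i; lia.
- by have := ltn_ord j; lia.
Qed.

Lemma enorm_arnoldi_basis y : enorm (V *m y) = enorm y.
Proof.
apply/eqP; rewrite -(@eqrXn2 _ 2) ?enorm_ge0 //; apply/eqP.
have := arnoldi_basis_cdot y y; rewrite !cdot_self.
by move=> /(congr1 (@complex.Re R)).
Qed.

Lemma arnoldi_residual_orth y : cdot (V *m y) (vs l.+2) = 0.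
Proof.
rewrite arnoldi_basisE cdot_suml big1 // => i _; have il := ltn_ord i.
by rewrite cdotZl (arnoldi_orthonormal harn) ?eqSS ?(ltn_eqF il) ?mulr0 //; lia.
Qed.

Lemma arnoldi_residual_norm : enorm (vs l.+2) = 1.
Proof.
apply/eqP; rewrite -(@eqrXn2 _ 2) ?enorm_ge0 // expr1n.
have := arnoldi_orthonormal harn (i := l.+2) (j := l.+2); rewrite cdot_self eqxx.
by rewrite !ltnSn => /(_ isT isT) /(congr1 (@complex.Re R)) /= ->.
Qed.

Let last_coef j : R[i] := if j == l then h l.+2 l.+1 else 0.

Let arnoldi_col (j : 'I_l.+1) :
  A *m vs j.+1 = \sum_(i < l.+1) h i.+1 j.+1 *: vs i.+1 + last_coef j *: vs l.+2.
Proof.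
have jl := ltn_ord j.
have -> : A *m vs j.+1 = \sum_(1 <= i < j.+2) h i j.+1 *: vs i + h j.+2 j.+1 *: vs j.+2.
  by rewrite (arnoldi_step harn) ?jl // addrC subrK.
rewrite -(big_nat_recr _ _ (fun i => h i j.+1 *: vs i)) //= big_add1 /=.
rewrite -(big_mkord xpredT (fun i => h i.+1 j.+1 *: vs i.+1)) /last_coef.
case: eqP => [->|/eqP jnl]; first by rewrite big_nat_recr.
have jl' : (j < l)%N by lia.
rewrite scale0r addr0 [RHS](big_cat_nat (n := j.+2)) //=.
rewrite [X in _ = _ + X]big_nat_cond [X in _ = _ + X]big1 ?addr0 // => i /andP[/andP[ji il] _].
by rewrite (arnoldi_hessenberg harn) ?scale0r //; lia.
Qed.

Lemma arnoldi_relation y :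
  A *m (V *m y) = V *m (H *m y) + (h l.+2 l.+1 * y ord_max 0) *: vs l.+2.
Proof.
rewrite !arnoldi_basisE mulmx_sumr.
have -> : \sum_(j < l.+1) (H *m y) j 0 *: vs j.+1 =
    \sum_(j < l.+1) y j 0 *: \sum_(i < l.+1) h i.+1 j.+1 *: vs i.+1.
  under [RHS]eq_bigr => j _ do rewrite scaler_sumr.
  rewrite exchange_big; apply: eq_bigr => i _.
  rewrite mxE scaler_suml; apply: eq_bigr => j _.
  by rewrite mxE scalerA mulrC.
have -> : (h l.+2 l.+1 * y ord_max 0) *: vs l.+2 =
    \sum_(j < l.+1) y j 0 *: (last_coef j *: vs l.+2).
  rewrite (bigD1 ord_max) //= big1 ?addr0 => [|j jl].
    by rewrite /last_coef eqxx scalerA mulrC.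
  by rewrite /last_coef -[l]/(val (@ord_max l)) val_eqE (negbTE jl) scale0r scaler0.
rewrite -big_split; apply: eq_bigr => j _ /=.
by rewrite -scalemxAr arnoldi_col scalerDr.
Qed.

Lemma arnoldi_hess_cdot x y : cdot x (H *m y) = cdot (V *m x) (A *m (V *m y)).
Proof.
by rewrite arnoldi_relation cdotDr cdotZr arnoldi_residual_orth mulr0 addr0 arnoldi_basis_cdot.
Qed.

Lemma arnoldi_subdiag_cdot : h l.+2 l.+1 = cdot (vs l.+2) (A *m vs l.+1).
Proof.
have := arnoldi_step harn (j := l.+1); rewrite ltnSn => /(_ isT)/(congr1 (cdot (vs l.+2))).
rewrite cdotZr cdot_self arnoldi_residual_norm expr1n mulr1 => ->.
rewrite cdotBr cdot_sumr big_nat_cond big1 ?subr0 // => i /andP[/andP[i1 il] _].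
by rewrite cdotZr (arnoldi_orthonormal harn) ?gtn_eqF ?mulr0 //; lia.
Qed.

Lemma arnoldi_subdiag_le : cabs (h l.+2 l.+1) <= opnorm A.
Proof.
rewrite arnoldi_subdiag_cdot; apply: le_trans (cdot_le _ _) _.
rewrite arnoldi_residual_norm mul1r; apply: le_trans (enorm_opnorm _ _) _.
suff -> : enorm (vs l.+1) = 1 by rewrite mulr1.
apply/eqP; rewrite -(@eqrXn2 _ 2) ?enorm_ge0 // expr1n.
have := arnoldi_orthonormal harn (i := l.+1) (j := l.+1); rewrite cdot_self eqxx.
by rewrite !ltnS !leqnSn => /(_ isT isT) /(congr1 (@complex.Re R)) /= ->.
Qed.

Lemma arnoldi_start_col : V *m e1 = v.
Proof.
rewrite arnoldi_basisE (bigD1 ord0) //= big1 ?addr0 => [|j j0].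
  by rewrite mxE scale1r (arnoldi_start harn).
by rewrite mxE -[0%N]/(val (@ord0 l)) val_eqE (negbTE j0) scale0r.
Qed.

Lemma enorm_first_basis_vector : enorm e1 = 1.
Proof.
apply/eqP; rewrite -(@eqrXn2 _ 2) ?enorm_ge0 // expr1n sqr_enorm.
rewrite (bigD1 ord0) //= big1 ?addr0 => [|j j0]; rewrite mxE.
  by rewrite cabs1 expr1n.
by rewrite -[0%N]/(val (@ord0 l)) val_eqE (negbTE j0) cabs0 expr0n.
Qed.

Lemma cdot_last y : cdot el y = y ord_max 0.
Proof.
rewrite cdotE (bigD1 ord_max) //= big1 ?addr0 => [|j jl]; rewrite mxE eqxx andbT.
  by rewrite -[conjc _]/((1 : R[i])^*) rmorph1 mul1r.
by rewrite (negbTE jl) -[conjc _]/((0 : R[i])^*) rmorph0 mul0r.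
Qed.

Lemma enorm_last : enorm el = 1.
Proof.
apply/eqP; rewrite -(@eqrXn2 _ 2) ?enorm_ge0 // expr1n.
have := cdot_self el; rewrite cdot_last mxE !eqxx.
by move=> /(congr1 (@complex.Re R)) /= <-.
Qed.

(** Powers of a Hessenberg matrix fill one more subdiagonal at a time. *)
Lemma hessenberg_moments (G : 'M[R[i]]_l.+1) i :
  (forall p j : 'I_l.+1, (j.+1 < p)%N -> G p j = 0) -> (i < l)%N ->
  cdot el (G ^+ i *m e1) = 0.
Proof.
move=> hG il; rewrite cdot_last.
suff K : forall j : 'I_l.+1, (i < j)%N -> (G ^+ i *m e1) j 0 = 0 by exact: K.
elim: i {il} => [|i IH] j ij; first by rewrite expr0 mul1mx mxE gtn_eqF.
rewrite exprS -mulmxE -mulmxA mxE big1 // => p _.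
case: (ltnP i p) => ip; first by rewrite IH ?mulr0.
by rewrite hG ?mul0r //; lia.
Qed.

End ArnoldiFacts.

(** * The matrix exponential as a limit of powers *)

Section MatrixExponential.
Variable R : realType.

Lemma expR_psum_le (x : R) J : 0 <= x -> \sum_(l < J) x ^+ l / l`!%:R <= expR x.
Proof.
move=> x0; have nd : {homo series (exp_coeff x) : p q / (p <= q)%N >-> p <= q}.
  apply/nondecreasing_seqP => p; rewrite /series /= big_nat_recr //= lerDl.
  by rewrite divr_ge0 ?exprn_ge0.
have := nondecreasing_cvgn_le nd (is_cvg_series_exp_coeff x) J.
by rewrite /series /= big_mkord.
Qed.

(** The coefficients of the binomial expansion of (1 + x / N)^N, relative to
    those of the exponential. *)
Let ratio N l : R := (N ^_ l)%:R / N%:R ^+ l.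

Let ratioS N l : ratio N l.+1 = ratio N l * ((N - l)%:R / N%:R).
Proof. by rewrite /ratio ffactnSr natrM exprSr invfM mulrACA. Qed.

Let ratio_bounds N l : (0 < N)%N ->
  [/\ 0 <= ratio N l, ratio N l <= 1 & 1 - ratio N l <= 2 ^+ l / N%:R].
Proof.
move=> N0; have Np : 0 < N%:R :> R by rewrite ltr0n.
elim: l => [|l [b0 b1 h]].
  rewrite /ratio ffactn0 expr0 divr1 subrr ler01 lexx mul1r invr_ge0.
  by split=> //; exact: ltW.
have f0 : 0 <= (N - l)%:R / N%:R :> R by rewrite divr_ge0 // ltW.
have f1 : (N - l)%:R / N%:R <= 1 :> R.
  by rewrite ler_pdivrMr // mul1r ler_nat leq_subr.
have f2 : 1 - l%:R / N%:R <= (N - l)%:R / N%:R :> R.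
  rewrite -[X in X - _](mulfV (lt0r_neq0 Np)) -mulrBl ler_pM2r ?invr_gt0 //.
  by rewrite lerBlDr -natrD ler_nat; lia.
rewrite ratioS; split; first exact: mulr_ge0.
  by apply: le_trans (ler_piMr b0 f1) b1.
have l2 : l%:R / N%:R <= 2 ^+ l / N%:R :> R.
  by rewrite ler_pM2r ?invr_gt0 // -natrX ler_nat ltnW // ltn_expl.
have := ler_wpM2l b0 f2; rewrite mulrBr mulr1 => h2.
have l0 : 0 <= l%:R / N%:R :> R by rewrite divr_ge0 // ltW.
have := ler_wpM2r l0 b1; rewrite mul1r => h3.
rewrite [2 ^+ l.+1]exprS -mulrA [2 * _]mulr_natl mulr2n.
move: h h2 h3 l2; set p := ratio N l; set f := (N - l)%:R / _; set g := l%:R / _.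
set e := 2 ^+ l / _; clearbody p f g e; lra.
Qed.

Variable n : nat.
Implicit Types (M : 'M[R[i]]_n) (x : 'cV[R[i]]_n).

Let term M i j l : R[i] := (l`!%:R^-1 : R[i]) * (M ^+ l) i j.

Lemma entry_pow_le M : exists2 L, 0 <= L & forall l i j, cabs ((M ^+ l) i j) <= L ^+ l.
Proof.
have [L L0 hL] := mulmx_bounded M; exists L => // l i j.
have -> : (M ^+ l) i j = (M ^+ l *m (delta_mx j 0 : 'cV_n)) i 0.
  by transitivity (col j (M ^+ l) i 0); [rewrite mxE|rewrite colE].
apply: le_trans (entry_le_enorm _ _) _; apply: le_trans (mulmx_pow_bounded _ _ L0 hL) _.
suff -> : enorm (delta_mx j 0 : 'cV[R[i]]_n) = 1 by rewrite mulr1.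
apply/eqP; rewrite -(@eqrXn2 _ 2) ?enorm_ge0 // expr1n sqr_enorm.
rewrite (bigD1 j) //= big1 ?addr0 => [|p pj]; rewrite mxE !eqxx ?andbT.
  by rewrite cabs1 expr1n.
by rewrite (negbTE pj) cabs0 expr0n.
Qed.

Lemma mexp_entry M i j : mexp M i j = csum (term M i j).
Proof.
rewrite mxE /csum; congr (clim _); apply/funext => J.
by rewrite /mexp_sum summxE big_mkord; apply: eq_bigr => l _; rewrite mxE.
Qed.

Let euler_entry M i j N J : (0 < N)%N -> (N < J)%N ->
  ((1%:M + N%:R^-1 *: M) ^+ N) i j = \sum_(l < J) (ratio N l)%:C * term M i j l.
Proof.
move=> N0 NJ; rewrite -[1%:M]/(1 : 'M[R[i]]_n) exprDn_comm; last exact/commr_sym/commr1.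
rewrite summxE.
pose F l := (ratio N l)%:C * term M i j l.
rewrite -(big_mkord xpredT F) (big_cat_nat (n := N.+1)) //=.
rewrite [X in _ = _ + X]big_nat_cond [X in _ = _ + X]big1 ?addr0; last first.
  move=> l /andP[/andP[lN _] _].
  by rewrite /F /ratio ffact_small // mul0r mul0r.
rewrite big_mkord; apply: eq_bigr => l _; rewrite expr1n mul1r.
have -> : (N%:R^-1 *: M) ^+ l = (N%:R^-1 ^+ l) *: M ^+ l.
  by elim: (nat_of_ord l) => [|p IH]; rewrite ?expr0 ?scale1r // !exprS IH
    -!mulmxE -scalemxAl -scalemxAr scalerA.
rewrite -scaler_nat scalerA mxE /F /term mulrA; congr (_ * _).
rewrite /ratio -bin_ffact natrM !rmorphM fmorphV rmorphXn !rmorph_nat exprVn.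
rewrite -!mulrA; congr (_ * _); rewrite mulrCA mulfV ?mulr1 //.
Qed.

(** Relative to the exponential series the coefficients of the power are off by
    at most 2 ^ l / N, so the series of expR (2 L) bounds N times the error. *)
Lemma mexp_euler M x : exists2 K, 0 <= K & forall N, (0 < N)%N ->
  enorm (mexp M *m x - (1%:M + N%:R^-1 *: M) ^+ N *m x) <= K / N%:R.
Proof.
have [L L0 hL] := entry_pow_le M; set S := expR (2 * L).
have S0 : 0 <= S by apply: expR_ge0.
exists (\sum_(i < n) \sum_j S * cabs (x j 0)).
  by apply: sumr_ge0 => i _; apply: sumr_ge0 => j _; rewrite mulr_ge0 ?cabs_ge0.
move=> N N0; have Np : 0 < N%:R :> R by rewrite ltr0n.
suff ent i j : cabs (mexp M i j - ((1%:M + N%:R^-1 *: M) ^+ N) i j) <= S / N%:R.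
  rewrite -mulmxBl; apply: le_trans (enorm_le_sum _) _.
  rewrite mulr_suml; apply: ler_sum => i _; rewrite mxE.
  apply: le_trans (cabs_sum _ _ _) _; rewrite mulr_suml; apply: ler_sum => j _.
  rewrite cabsM mulrAC ler_wpM2r ?cabs_ge0 //.
  by apply: le_trans (ent i j); rewrite !mxE.
have dom : dominated (fun l => L ^+ l / l`!%:R) (term M i j).
  by move=> l; rewrite /term cabsM cabsV cabs_nat mulrC ler_wpM2r ?hL.
have sm : summable (fun l => L ^+ l / l`!%:R).
  by exists (expR L) => J; apply: expR_psum_le.
set E := ((1%:M + _) ^+ N) i j.
have lim : ccvg (fun J => psum (term M i j) (N.+1 + J) - E) (csum (term M i j) - E).
  apply: ccvgB (ccvg_cst _) => e e0; have [J0 h] := psum_ccvg dom sm e0.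
  by exists J0 => J J0J; apply: h; apply: leq_trans (leq_addl _ _).
rewrite mexp_entry; apply: (ccvg_le lim) => J.
rewrite /E (euler_entry M i j N0 (leq_addr J N.+1)) /psum -sumrB.
apply: le_trans (cabs_sum _ _ _) _.
apply: (@le_trans _ _ (\sum_(l < N.+1 + J) (2 * L) ^+ l / l`!%:R / N%:R)).
  apply: ler_sum => l _; have [b0 b1 b2] := ratio_bounds l N0.
  rewrite -{1}[term M i j l]mul1r -mulrBl -(rmorph1 (real_complex R)) -rmorphB cabsM.
  rewrite cabs_real ger0_norm ?subr_ge0 // exprMn.
  have -> : 2 ^+ l * L ^+ l / l`!%:R / N%:R = 2 ^+ l / N%:R * (L ^+ l / l`!%:R) by ring.
  by apply: ler_pM => //; rewrite ?subr_ge0 ?cabs_ge0.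
rewrite -mulr_suml ler_pM2r ?invr_gt0 //.
by apply: expR_psum_le; rewrite mulr_ge0.
Qed.

End MatrixExponential.

(** * The error of the Arnoldi approximation *)

Section Stepping.
Variable R : realType.

Lemma le_expR_sqr (t z s D : R) : 0 <= t -> t ^+ 2 <= 1 - 2 * s * z + s ^+ 2 * D ->
  t <= expR (- (s * z) + s ^+ 2 * D / 2).
Proof.
move=> t0 h; rewrite -(@ler_pXn2r _ 2) ?nnegrE ?expR_ge0 //.
apply: le_trans h _; rewrite -expRM_natl.
have := expR_ge1Dx (2%:R * (- (s * z) + s ^+ 2 * D / 2)); apply: le_trans.
by rewrite le_eqVlt; apply/orP; left; apply/eqP; field.
Qed.

Lemma enorm_euler_step n (A : 'M[R[i]]_n) (a z s L D : R) u : 0 <= s -> z <= a ->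
  0 <= L -> L ^+ 2 <= D -> a * enorm u ^+ 2 <= complex.Re (cdot u (A *m u)) ->
  enorm (A *m u) <= L * enorm u ->
  enorm ((1%:M - s%:C *: A) *m u) <= expR (- (s * z) + s ^+ 2 * D / 2) * enorm u.
Proof.
move=> s0 za L0 LD hA hL; have [u0|un0] := eqVneq (enorm u) 0.
  by rewrite (enorm_eq0 u0) mulmx0 enorm0 mulr0.
have up : 0 < enorm u by rewrite lt_neqAle eq_sym un0 enorm_ge0.
rewrite -ler_pdivrMr //; apply: le_expR_sqr; first by rewrite divr_ge0 ?enorm_ge0.
rewrite expr_div_n ler_pdivrMr ?exprn_gt0 //.
have -> : enorm ((1%:M - s%:C *: A) *m u) ^+ 2 =
    enorm u ^+ 2 - 2 * s * complex.Re (cdot u (A *m u)) + s ^+ 2 * enorm (A *m u) ^+ 2.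
  have := cdot_self ((1%:M - s%:C *: A) *m u) => /(congr1 (@complex.Re R)) /= <-.
  rewrite mulmxBl mul1mx -scalemxAl; set w := A *m u.
  rewrite cdotBr !cdotBl !cdotZr !cdotZl !cdot_self -(cdot_conj u w).
  by rewrite !ReImE /=; ring.
have p2 : enorm (A *m u) ^+ 2 <= D * enorm u ^+ 2.
  apply: (@le_trans _ _ ((L * enorm u) ^+ 2)).
    by rewrite lerXn2r ?nnegrE ?mulr_ge0 ?enorm_ge0.
  by rewrite exprMn ler_wpM2r ?sqr_ge0.
have p1 : z * enorm u ^+ 2 <= complex.Re (cdot u (A *m u)).
  by apply: le_trans hA; rewrite ler_wpM2r ?sqr_ge0.
have := ler_wpM2l s0 p1; have := ler_wpM2l (sqr_ge0 s) p2.
move: (enorm (A *m u) ^+ 2) (complex.Re _) (enorm u ^+ 2) => x y w.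
by rewrite !mulrDl; lra.
Qed.

Lemma expR_half_le2 : expR (1 / 2) <= 2 :> R.
Proof.
have := expR_ge1Dx (- (1 / 2) : R); rewrite expRN => h.
have e0 := expR_gt0 (1 / 2 : R).
have : expR (1 / 2) * (1 + - (1 / 2)) <= expR (1 / 2) * (expR (1 / 2))^-1 :> R.
  by rewrite ler_pM2l.
rewrite mulfV ?lt0r_neq0 //; lra.
Qed.

Lemma inner_radius (q : R) l : 0 < q -> q < 1 -> exists r, [/\ 1 < r, r < q^-1 &
  (r * q) ^+ l / (1 - r * q) <= 2 * (q ^+ l / (1 - q))].
Proof.
move=> q0 q1; pose t : R := (1 - q) / (4 * l.+1%:R).
have l0 : 0 < l.+1%:R :> R by rewrite ltr0n.
have t0 : 0 < t by rewrite divr_gt0 ?mulr_gt0 //; lra.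
have tl : t * l.+1%:R = (1 - q) / 4 by rewrite /t; field; apply: lt0r_neq0.
have tt : t <= (1 - q) / 4.
  by rewrite -tl ler_peMr ?(ltW t0) // (ler_nat R 1).
have tq : t * q <= (1 - q) / 4.
  by apply: le_trans tt; rewrite ler_piMr ?(ltW t0) // ltW.
have rE : (1 + t) * q = q + t * q by ring.
exists (1 + t); split; first by lra.
  by rewrite -[q^-1]mul1r ltr_pdivlMr // rE; lra.
have pw : (1 + t) ^+ l <= 4 / 3.
  apply: (@le_trans _ _ (expR (l%:R * t))).
    rewrite expRM_natl lerXn2r ?nnegrE ?expR_ge0 ?expR_ge1Dx //; lra.
  have lt4 : l%:R * t <= 1 / 4.
    apply: (@le_trans _ _ (t * l.+1%:R)); last by rewrite tl; lra.
    by rewrite mulrC ler_pM2l // ler_nat.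
  have := expR_ge1Dx (- (l%:R * t)); rewrite expRN => h.
  have e0 := expR_gt0 (l%:R * t).
  have : expR (l%:R * t) * (1 + - (l%:R * t)) <= 1.
    by rewrite -[leRHS](mulfV (lt0r_neq0 e0)) ler_pM2l.
  have := ler_wpM2l (ltW e0) lt4.
  by move: (expR (l%:R * t)) (l%:R * t) => x y; rewrite mulrDr mulrN; lra.
have d0 : 0 < 1 - q by lra.
have d1 : 3 / 4 * (1 - q) <= 1 - (1 + t) * q by rewrite rE; lra.
have d2 : 0 < 1 - (1 + t) * q by lra.
rewrite ler_pdivrMr // exprMn.
have ql : 0 <= q ^+ l by rewrite exprn_ge0 // ltW.
apply: le_trans (ler_wpM2r ql pw) _.
have c0 : 0 <= 2 * (q ^+ l / (1 - q)) by rewrite mulr_ge0 // divr_ge0 // ltW.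
apply: le_trans (ler_wpM2l c0 d1).
have -> : 2 * (q ^+ l / (1 - q)) * (3 / 4 * (1 - q)) = 3 / 2 * q ^+ l.
  by field; apply: lt0r_neq0.
by rewrite ler_wpM2r //; lra.
Qed.

Lemma step_count (tau z D K e : R) : 0 < tau -> 0 <= D -> 0 <= K -> 0 < e ->
  exists N, [/\ (0 < N)%N, K / N%:R <= e &
    expR (- (tau / N%:R * z) + (tau / N%:R) ^+ 2 * D / 2) ^+ N.-1 <=
    2 * expR (- (tau * z))].
Proof.
move=> tau0 D0 K0 e0; pose W1 := 2 * (tau * `|z| + tau ^+ 2 * D); pose W2 := K / e.
have W10 : 0 <= W1 by rewrite mulr_ge0 // addr_ge0 // mulr_ge0 ?sqr_ge0 // ltW.
have W20 : 0 <= W2 by rewrite divr_ge0 // ltW.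
pose N := (Num.truncn (W1 + W2)).+1; exists N.
have WN : W1 + W2 <= N%:R by rewrite ltW // truncnS_gt.
have N0 : (0 < N)%N by [].
have Np : 0 < N%:R :> R by rewrite ltr0n.
clearbody N; split=> //.
  rewrite ler_pdivrMr // mulrC -ler_pdivrMr //.
  by apply: le_trans WN; rewrite lerDr.
have Nn0 : N%:R != 0 :> R by apply: lt0r_neq0.
set s := tau / N%:R; have s0 : 0 <= s by rewrite divr_ge0 // ltW.
have Ns : N%:R * s = tau by rewrite mulrC divfK.
have small : s * `|z| + tau * s * D <= 1 / 2.
  have -> : s * `|z| + tau * s * D = (tau * `|z| + tau ^+ 2 * D) / N%:R.
    by rewrite /s; field.
  by rewrite ler_pdivrMr //; move: WN; rewrite /W1; lra.
have M1 : N.-1%:R = N%:R - 1 :> R by rewrite -[in RHS](prednK N0) -natr1 addrK.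
rewrite -expRM_natl M1; apply: (@le_trans _ _ (expR (1 / 2 + - (tau * z)))); last first.
  by rewrite expRD ler_wpM2r ?expR_ge0 // expR_half_le2.
rewrite ler_expR.
have zz := ler_wpM2l s0 (ler_norm z).
have sD : 0 <= s ^+ 2 * D by rewrite mulr_ge0 ?sqr_ge0.
have tsD : 0 <= tau * s * D by rewrite mulr_ge0 // mulr_ge0 // ltW.
clearbody s.
have -> : (N%:R - 1) * (- (s * z) + s ^+ 2 * D / 2) =
    - (N%:R * s * z) + s * z + N%:R * s * s * D / 2 - s ^+ 2 * D / 2 by ring.
by rewrite Ns; lra.
Qed.

End Stepping.

Section ErrorBound.
Variables (R : realType) (n : nat) (A : 'M[R[i]]_n) (v : 'cV[R[i]]_n) (l : nat).
Variables (vs : nat -> 'cV[R[i]]_n) (h : nat -> nat -> R[i]).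
Hypothesis harn : arnoldi A v l.+1 vs h.

Let V := arnoldi_basis l.+1 vs.
Let H := arnoldi_hess l.+1 h.
Let e1 := first_basis_vector R l.+1.
Let el : 'cV[R[i]]_l.+1 := delta_mx ord_max 0.

(** The discrete form of the variation of constants formula: replacing one step
    with A by one step with the Hessenberg matrix costs the last component of
    the current iterate. *)
Lemma euler_defect (s g p : R) N : 0 <= s -> 0 <= p -> 0 <= g ->
  (forall u, enorm ((1%:M - s%:C *: A) *m u) <= p * enorm u) ->
  (forall j, cabs (cdot el ((1%:M - s%:C *: H) ^+ j *m e1)) <= g * p ^+ j) ->
  enorm ((1%:M - s%:C *: A) ^+ N *m v - V *m ((1%:M - s%:C *: H) ^+ N *m e1)) <=
  N%:R * s * opnorm A * g * p ^+ N.-1.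
Proof.
set X := 1%:M - s%:C *: A; set Y := 1%:M - s%:C *: H => s0 p0 g0 hX hY.
have hXn i u : enorm (X ^+ i *m u) <= p ^+ i * enorm u.
  elim: i u => [|i IH] u; first by rewrite !expr0 mul1mx mul1r.
  rewrite exprSr -mulmxE -mulmxA; apply: le_trans (IH _) _.
  by rewrite exprSr -mulrA ler_wpM2l ?exprn_ge0.
pose T j := X ^+ (N - j) *m (V *m (Y ^+ j *m e1)).
have T0 : T 0%N = X ^+ N *m v by rewrite /T subn0 expr0 mul1mx (arnoldi_start_col harn).
have TN : T N = V *m (Y ^+ N *m e1) by rewrite /T subnn expr0 mul1mx.
rewrite -T0 -TN -opprB enormN -telescope_sumr // big_mkord.
apply: le_trans (enorm_sum _ _) _.
suff stp (j : 'I_N) : enorm (T j.+1 - T j) <= s * opnorm A * g * p ^+ N.-1.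
  apply: le_trans (ler_sum _ (fun j _ => stp j)) _.
  by rewrite sumr_const card_ord -[leLHS]mulr_natl !mulrA.
have jN := ltn_ord j.
set y := Y ^+ j *m e1.
have -> : T j.+1 - T j = X ^+ (N.-1 - j) *m
    ((s%:C * (h l.+2 l.+1 * cdot el y)) *: vs l.+2).
  rewrite /T; have -> : (N - j)%N = (N.-1 - j).+1 by lia.
  have -> : (N - j.+1)%N = (N.-1 - j)%N by lia.
  rewrite exprS [X ^+ _.+1]exprSr -!mulmxE -!mulmxA -mulmxBr -/y.
  congr (_ *m _); rewrite /X /Y !mulmxBl !mul1mx mulmxBr -!scalemxAl -!scalemxAr.
  rewrite (arnoldi_relation harn) -/V -/H cdot_last scalerDr scalerA.
  by rewrite opprB addrC addrA subrK addrAC subrr add0r.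
apply: le_trans (hXn _ _) _.
rewrite enormZ (arnoldi_residual_norm harn) mulr1 !cabsM cabs_real ger0_norm //.
have -> : N.-1 = (N.-1 - j + j)%N by lia.
rewrite exprD addnK.
have pj : 0 <= p ^+ (N.-1 - j) by rewrite exprn_ge0.
have -> : s * opnorm A * g * (p ^+ (N.-1 - j) * p ^+ j) =
  p ^+ (N.-1 - j) * (s * (opnorm A * (g * p ^+ j))) by ring.
rewrite ler_wpM2l // ler_wpM2l //; apply: ler_pM; rewrite ?cabs_ge0 ?hY //.
exact: (arnoldi_subdiag_le harn).
Qed.

(** On the circle |w| = 1 / q the symbol 1 - s (c0 + C Psi w) of an Euler step
    has modulus at most exp (- s z), up to a quadratic term in s. *)
Lemma euler_last_entry m (c0 C s z D q r : R) j : 0 < m -> m < 1 -> 0 < C -> 0 <= s ->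
  in_rectangle m ((C^-1)%:C *: (H - (c0%:C)%:M)) ->
  0 < q -> 1 < r -> r < q^-1 ->
  z = c0 - C * complex.Re (Psi m (q^-1)%:C) ->
  (forall w, cabs w = q^-1 -> cabs (c0%:C + C%:C * Psi m w) ^+ 2 <= D) ->
  cabs (cdot el ((1%:M - s%:C *: H) ^+ j *m e1)) <=
  3 * ((r * q) ^+ l / (1 - r * q)) * expR (- (s * z) + s ^+ 2 * D / 2) ^+ j.
Proof.
move=> m0 m1 C0 s0 rect q0 r1 rq zE hD.
set H0 := (C^-1)%:C *: _ in rect.
have Cn : C%:C != 0 :> R[i] by rewrite -cabs_gt0 cabs_real gtr0_norm.
have HE : H = C%:C *: H0 + (c0%:C)%:M.
  by rewrite scalerA fmorphV mulfV // scale1r subrK.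
have H0C : GRing.comm (C%:C *: H0) ((c0%:C)%:M).
  by rewrite /GRing.comm -!mulmxE scalar_mxC.
have el1 : enorm el = 1 by exact: enorm_last.
have e11 : enorm e1 = 1 by exact: enorm_first_basis_vector.
have mom i : (i < l)%N -> cdot el (H0 ^+ i *m e1) = 0.
  apply: hessenberg_moments => p j' pj; rewrite !mxE.
  have pnj : (p == j') = false by apply/negbTE/eqP => E; rewrite E in pj; lia.
  by rewrite pnj mulr0n subr0 (arnoldi_hessenberg harn) ?mulr0 // ltn_ord.
have stepE : 1%:M - s%:C *: H = (1 - s%:C * c0%:C)%:M - (s%:C * C%:C) *: H0.
  rewrite HE scalerDr scalerA opprD addrCA addrC; congr (_ - _).
  by rewrite scale_scalar_mx raddfB /=.
have hb w : cabs w = q^-1 ->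
    cabs ((1 - s%:C * c0%:C) - (s%:C * C%:C) * Psi m w) <=
    expR (- (s * z) + s ^+ 2 * D / 2).
  move=> wq; apply: le_expR_sqr; first exact: cabs_ge0.
  have w1 : 1 <= cabs w by rewrite wq; lra.
  set psi := c0%:C + C%:C * Psi m w.
  have -> : 1 - s%:C * c0%:C - s%:C * C%:C * Psi m w = 1 - s%:C * psi.
    by rewrite /psi; ring.
  have Rz : z <= complex.Re psi.
    have -> : complex.Re psi = c0 + C * complex.Re (Psi m w).
      by rewrite /psi ReD ReM /= mul0r subr0.
    have := Re_Psi_le m0 m1 w1; rewrite wq ler_norml => /andP[k _].
    have := ler_wpM2l (ltW C0) k; rewrite zE.
    by move: (complex.Re (Psi m w)) (complex.Re _) => x y; rewrite mulrN; lra.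
  have -> : cabs (1 - s%:C * psi) ^+ 2 =
      1 - 2 * s * complex.Re psi + s ^+ 2 * cabs psi ^+ 2.
    by rewrite !sqr_cabs !ReImE /=; ring.
  have := ler_wpM2l (sqr_ge0 s) (hD w wq); rewrite -/psi.
  have := ler_wpM2l s0 Rz.
  move: (complex.Re psi) (cabs psi ^+ 2) => x y; lra.
have := faber_bound m0 m1 rect e11 el1 mom j r1 rq (expR_ge0 _) hb.
rewrite -stepE invrK => k; apply: le_trans k _.
by rewrite mulrAC.
Qed.

(** Take N Euler steps of length tau / N and let N grow: each of the N defects is
    proportional to tau / N, and the quadratic terms vanish in the limit. The
    constant 12 is the 3 of faber_bound, times 2 for the choice of the inner
    radius, times 2 for what the quadratic terms may contribute. *)
Lemma arnoldi_error m (a c0 C z tau q : R) : 0 < m -> m < 1 -> 0 < C ->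
  enorm v = 1 -> 0 < tau -> 0 < q -> q < 1 ->
  in_rectangle m ((C^-1)%:C *: (H - (c0%:C)%:M)) ->
  (forall u, a * enorm u ^+ 2 <= complex.Re (cdot u (A *m u))) ->
  z = c0 - C * complex.Re (Psi m (q^-1)%:C) -> z <= a ->
  enorm (expm_exact A v tau - expm_arnoldi l.+1 vs h tau) <=
  12 * tau * opnorm A * (q ^+ l / (1 - q)) * expR (- (tau * z)).
Proof.
move=> m0 m1 C0 v1 tau0 q0 q1 rect hA zE za.
have [r [r1 rq rql]] := inner_radius l q0 q1.
have q11 : 1 < q^-1 by rewrite invf_gt1.
have L0 := opnorm_ge0 A v1; have hL := enorm_opnorm A.
have [[K0 hK0] _] := Psi_hol m0 m1 q^-1.
pose K := `|c0| + C * `|K0|.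
have Kge : 0 <= K by rewrite addr_ge0 // mulr_ge0 // ltW.
pose D := opnorm A ^+ 2 + K ^+ 2.
have D0 : 0 <= D by rewrite addr_ge0 // sqr_ge0.
have LD : opnorm A ^+ 2 <= D by rewrite lerDl sqr_ge0.
have hD w : cabs w = q^-1 -> cabs (c0%:C + C%:C * Psi m w) ^+ 2 <= D.
  move=> wq; apply: (@le_trans _ _ (K ^+ 2)); last by rewrite lerDr sqr_ge0.
  rewrite lerXn2r ?nnegrE ?cabs_ge0 //; apply: le_trans (cabsD _ _) _.
  rewrite cabs_real lerD2l cabsM cabs_real (gtr0_norm C0) ler_pM2l //.
  have [|h1 _] := hK0 w; first by rewrite /annulus wq lexx ltW.
  exact: le_trans h1 (ler_norm _).
have [K1 K10 hK1] := mexp_euler ((- tau)%:C *: A) v.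
have [K2 K20 hK2] := mexp_euler ((- tau)%:C *: H) e1.
apply/ler_addgt0Pr => e e0.
have [N [N0 eK pN]] := step_count z tau0 D0 (addr_ge0 K10 K20) e0.
have Np : 0 < N%:R :> R by rewrite ltr0n.
rewrite mulrDl in eK.
pose s := tau / N%:R; have s0 : 0 <= s by rewrite divr_ge0 // ltW.
have stepE d (M : 'M[R[i]]_d) :
    1%:M + N%:R^-1 *: ((- tau)%:C *: M) = 1%:M - s%:C *: M.
  rewrite scalerA -scaleNr; congr (_ + _ *: _).
  by rewrite /s !rmorphM rmorphN fmorphV rmorph_nat mulrN mulrC.
have := hK1 _ N0; have := hK2 _ N0; rewrite !stepE => d2 d1.
set p := expR (- (s * z) + s ^+ 2 * D / 2).
set g := 3 * ((r * q) ^+ l / (1 - r * q)).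
have rq1 : r * q < 1 by rewrite -ltr_pdivlMr // div1r.
have g0 : 0 <= g.
  by rewrite mulr_ge0 // divr_ge0 ?exprn_ge0 ?mulr_ge0 ?subr_ge0 ?ltW //; lra.
have hX u : enorm ((1%:M - s%:C *: A) *m u) <= p * enorm u.
  exact: enorm_euler_step (hA u) (hL u).
have hY j : cabs (cdot el ((1%:M - s%:C *: H) ^+ j *m e1)) <= g * p ^+ j.
  exact: euler_last_entry zE hD.
have := @euler_defect s g p N s0 (expR_ge0 _) g0 hX hY.
set X := _ ^+ N *m v; set Y := _ ^+ N *m e1 => dXY.
have E : expm_exact A v tau - expm_arnoldi l.+1 vs h tau =
    (expm_exact A v tau - X) + (X - V *m Y) -
    V *m (mexp ((- tau)%:C *: H) *m e1 - Y).
  by rewrite addrA subrK mulmxBr opprB addrA subrK /expm_arnoldi mulmxA.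
have dV : enorm (V *m (mexp ((- tau)%:C *: H) *m e1 - Y)) <= K2 / N%:R.
  by rewrite (enorm_arnoldi_basis harn).
have main : N%:R * s * opnorm A * g * p ^+ N.-1 <=
    12 * tau * opnorm A * (q ^+ l / (1 - q)) * expR (- (tau * z)).
  have -> : N%:R * s = tau by rewrite mulrC divfK // lt0r_neq0.
  have -> : 12 * tau * opnorm A * (q ^+ l / (1 - q)) * expR (- (tau * z)) =
    tau * opnorm A * (3 * (2 * (q ^+ l / (1 - q)))) * (2 * expR (- (tau * z))) by ring.
  have t0 : 0 <= tau * opnorm A by rewrite mulr_ge0 // ltW.
  have gg : g <= 3 * (2 * (q ^+ l / (1 - q))) by apply: ler_wpM2l rql.
  exact: ler_pM (mulr_ge0 t0 g0) (exprn_ge0 _ (expR_ge0 _)) (ler_wpM2l t0 gg) pN.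
rewrite E; apply: le_trans (enormB _ _) _.
have := enormD (expm_exact A v tau - X) (X - V *m Y).
have dA : enorm (expm_exact A v tau - X) <= K1 / N%:R by exact: d1.
move: dXY dV dA main eK; lra.
Qed.

End ErrorBound.

(** * The error bound *)

Theorem theorem5p2 (R : realType) (n : nat) (A : 'M[R[i]]_n)
    (v : 'cV[R[i]]_n) (tau a b c : R)
    (v_unit : enorm v = 1) (tau_gt0 : 0 < tau)
    (a_def : a = lambda_min (2%:R^-1 *: (A + A ^t*)))
    (b_def : b = lambda_max (2%:R^-1 *: (A + A ^t*)))
    (c_def : c = spectral_radius (2%:R^-1 *: (A - A ^t*)))
    (a_lt_b : a < b) (c_gt0 : 0 < c)
    (k : nat) (k_gt0 : (0 < k)%N)
    (vs : nat -> 'cV[R[i]]_n) (h : nat -> nat -> R[i])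
    (vs_h_arnoldi : arnoldi A v k vs h)
    (alpha beta m lambda : R)
    (alpha_def : alpha = (b - a) / 2) (beta_def : beta = c)
    (m_gt0 : 0 < m) (m_lt1 : m < 1)
    (lambda_lhs :
      lambda = (ellipticE m - (1 - m) * ellipticK m) / beta)
    (lambda_rhs :
      lambda = (ellipticE (1 - m) - m * ellipticK (1 - m)) / alpha)
    (q : R) (q_gt0 : 0 < q) (q_lt1 : q < 1)
    (z : R)
    (z_def : z = a - lambda^-1 *
      \int[@lebesgue_measure R]_(s in `[0, 2^-1 * (q^-1 - q)])
        (Num.sqrt (m + s ^+ 2) / Num.sqrt (1 + s ^+ 2))) :
  enorm (expm_exact A v tau - expm_arnoldi k vs h tau) <=
    2 * (1108 / 100) * tau * opnorm A * (q ^+ k.-1 / (1 - q)) *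
    expR (- (tau * Num.min a 0) - tau * z).
Proof.
have al0 : 0 < alpha by rewrite alpha_def divr_gt0 // subr_gt0.
have be0 : 0 < beta by rewrite beta_def.
have iP := Im_Psi_corner m_gt0 m_lt1; have rP := Re_Psi_corner m_gt0 m_lt1.
have iP0 := Im_Psi_corner_gt0 m_gt0 m_lt1.
have la_im : 2 * (lambda * beta) = complex.Im (Psi m (corner m)).
  by rewrite iP lambda_lhs divfK // lt0r_neq0.
have la_re : 2 * (lambda * alpha) = complex.Re (Psi m (corner m)).
  by rewrite rP lambda_rhs divfK // lt0r_neq0.
have la0 : 0 < lambda by rewrite -(pmulr_lgt0 _ be0); lra.
(* C maps the rectangle of Psi to the rectangle of half sides alpha and beta. *)
pose C := (2 * lambda)^-1.
have C0 : 0 < C by rewrite invr_gt0 mulr_gt0.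
have C_re : C^-1 * alpha = complex.Re (Psi m (corner m)) by rewrite invrK -la_re mulrA.
have C_im : C^-1 * beta = complex.Im (Psi m (corner m)) by rewrite invrK -la_im mulrA.
pose c0 := (a + b) / 2.
set I := \int[_]_(_ in _) _ in z_def.
have I0 : 0 <= I.
  apply: Rintegral_ge0 => s _; by rewrite divr_ge0 ?sqrtr_ge0.
have zE : z = c0 - C * complex.Re (Psi m (q^-1)%:C).
  rewrite Psi_real_integral // -/I -Re_Psi_corner_one // -C_re z_def /C /c0 alpha_def.
  by field; apply: lt0r_neq0.
have za : z <= a.
  by rewrite z_def gerBl mulr_ge0 // invr_ge0 ltW.
case: k k_gt0 vs_h_arnoldi => [//|l] _ harn /=.
have rng := numerical_range A; rewrite -a_def -b_def -c_def in rng.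
have rect : in_rectangle m ((C^-1)%:C *: (arnoldi_hess l.+1 h - (c0%:C)%:M)).
  move=> u; have [] := rng (arnoldi_basis l.+1 vs *m u).
  rewrite -(arnoldi_hess_cdot harn) (enorm_arnoldi_basis harn) => ra rb rc.
  rewrite -scalemxAl mulmxBl mul_scalar_mx cdotZr cdotBr cdotZr cdot_self.
  rewrite -C_re -C_im beta_def; have Ci : 0 <= C^-1 by rewrite invr_ge0 ltW.
  move: (cdot u _) ra rb rc => w ra rb rc.
  have -> : complex.Re ((C^-1)%:C * (w - c0%:C * (enorm u ^+ 2)%:C)) =
      C^-1 * (complex.Re w - c0 * enorm u ^+ 2) by rewrite !ReImE /=; ring.
  have -> : complex.Im ((C^-1)%:C * (w - c0%:C * (enorm u ^+ 2)%:C)) =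
      C^-1 * complex.Im w by rewrite !ReImE /=; ring.
  rewrite !normrM (ger0_norm Ci) -!mulrA !ler_wpM2l // ler_norml alpha_def /c0.
  by apply/andP; split; lra.
have hA u : a * enorm u ^+ 2 <= complex.Re (cdot u (A *m u)) by case: (rng u).
apply: le_trans (arnoldi_error harn m_gt0 m_lt1 C0 v_unit tau_gt0 q_gt0 q_lt1 rect hA zE za) _.
have L0 := opnorm_ge0 A v_unit.
have G0 : 0 <= tau * opnorm A * (q ^+ l / (1 - q)).
  have q1 : 0 <= 1 - q by rewrite subr_ge0 ltW.
  exact: mulr_ge0 (mulr_ge0 (ltW tau_gt0) L0) (divr_ge0 (exprn_ge0 _ (ltW q_gt0)) q1).
have ex : expR (- (tau * z)) <= expR (- (tau * Num.min a 0) - tau * z).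
  by rewrite ler_expR lerDr oppr_ge0 pmulr_rle0 // ge_min lexx orbT.
have -> : 12 * tau * opnorm A * (q ^+ l / (1 - q)) * expR (- (tau * z)) =
  tau * opnorm A * (q ^+ l / (1 - q)) * (12 * expR (- (tau * z))) by ring.
have -> : 2 * (1108 / 100) * tau * opnorm A * (q ^+ l / (1 - q)) *
    expR (- (tau * Num.min a 0) - tau * z) =
  tau * opnorm A * (q ^+ l / (1 - q)) *
    (2 * (1108 / 100) * expR (- (tau * Num.min a 0) - tau * z)) by ring.
apply: (ler_wpM2l G0); have := expR_ge0 (- (tau * z)); move: ex.
by move: (expR _) (expR _) => x y; lra.
Qed.
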